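(* Let $n$ be a positive integer, $\mathcal{H}$ a multiset of subgroups of $D_n$, and $d:=d_{D_n}(\mathcal{H})$. (i) If $d$ is odd, then the $D_n$-lattice $J_{D_n/\mathcal{H}}$ is quasi-permutation. (ii) If $d$ is even, then $J_{D_n/\mathcal{H}}$ is quasi-permutation if and only if it is quasi-invertible. Moreover, these equivalent conditions hold if and only if there is a set $\mathcal{H}'$ of subgroups of $D_n$ with $J_{D_n/\mathcal{H}}$ similar to $J_{D_n/\mathcal{H}'}$, where one of the following holds: (a) $d\in2\mathbb{Z}\setminus4\mathbb{Z}$ and $\mathcal{H}'=\{\langle\sigma_n^{d/2}\rangle\}$; (b) $d\in2\mathbb{Z}\setminus4\mathbb{Z}$ and $\mathcal{H}'=\{\langle\sigma_n^{d},\sigma_n^{j}\tau_n\rangle\}$ for some $j\in\{0,1\}$; (c) $d\in2\mathbb{Z}\setminus4\mathbb{Z}$ and $\mathcal{H}'=\{\langle\sigma_n^{d/2}\rangle,\langle\sigma_n^{d},\sigma_n^{j}\tau_n\rangle\}$ for some $j\in\{0,1\}$; (d) $\mathcal{H}'=\{\langle\sigma_n^{d},\tau_n\rangle,\langle\sigma_n^{d},\sigma_n\tau_n\rangle\}$.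
   Context: $D_{n}:=\langle\sigma_n,\tau_n\mid\sigma_n^n=\tau_n^2=1,\ \tau_n\sigma_n\tau_n^{-1}=\sigma_n^{-1}\rangle$ is the dihedral group of order $2n$. A $G$-lattice is a finitely generated free abelian group with a left $G$-action; $M^\circ:=\mathrm{Hom}_{\mathbb{Z}}(M,\mathbb{Z})$ with $(gf)(x)=f(g^{-1}x)$. Permutation: has a $\mathbb{Z}$-basis permuted by $G$; quasi-permutation: there is an exact sequence $0\to M\to R\to F\to0$ with $R,F$ permutation; quasi-invertible: direct summand of a quasi-permutation lattice. Two $G$-lattices $M_1,M_2$ are similar if $M_1\oplus R_1\cong M_2\oplus R_2$ for some permutation $G$-lattices $R_1,R_2$. For a multiset $\mathcal{H}$ of subgroups, $I_{G/\mathcal{H}}:=\ker(\bigoplus_{H\in\mathcal{H}}\mathbb{Z}[G/H]\to\mathbb{Z})$ (sum of augmentation maps, with multiplicity) and $J_{G/\mathcal{H}}:=I_{G/\mathcal{H}}^\circ$. $d_G(\mathcal{H}):=\gcd((G:H)\mid H\in\mathcal{H})$.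
   Formalization: The multiset of subgroups is assumed nonempty; for the empty multiset (d = 0, J = 0) the equivalence in (ii) fails for every n ≥ 2, because the lattice in (d) is not stably permutation. *)

(* Defs.v *)
From HB Require Import structures.
From mathcomp Require Import all_boot all_order all_algebra all_fingroup.
Set Implicit Arguments. Unset Strict Implicit. Unset Printing Implicit Defensive.
Import GRing.Theory.
Local Open Scope ring_scope.

(* G-lattices, for a finite group G : {group gT}, are encoded concretely:
   a lattice of rank r is Z^r (integer column vectors 'cV[int]_r) together
   with matrices  lrep g : 'M[int]_r  (g acting on the left: x |-> lrep g *m x). *)
Record lattice (gT : finGroupType) := Lat {
  lrk : nat;
  lrep : gT -> 'M[int]_lrk }.
Arguments Lat {gT} lrk lrep.

Section Lattices.
Variables (gT : finGroupType) (G : {group gT}).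

Definition is_lattice (L : lattice gT) : Prop :=
  lrep L 1%g = 1%:M /\
  {in G &, forall g h, lrep L (g * h)%g = lrep L g *m lrep L h}.

Definition Ghom (L1 L2 : lattice gT) (A : 'M[int]_(lrk L2, lrk L1)) : Prop :=
  {in G, forall g, A *m lrep L1 g = lrep L2 g *m A}.

Definition Giso (L1 L2 : lattice gT) : Prop :=
  exists (A : 'M[int]_(lrk L2, lrk L1)) (B : 'M[int]_(lrk L1, lrk L2)),
    [/\ Ghom A, A *m B = 1%:M & B *m A = 1%:M].

(* permutation lattice: there is a Z-basis (the columns of the unimodular
   matrix P) which is permuted by every g in G *)
Definition permutation_lattice (L : lattice gT) : Prop :=
  is_lattice L /\
  exists P : 'M[int]_(lrk L), P \in unitmx /\
    {in G, forall g, exists s : 'S_(lrk L), lrep L g *m P = P *m perm_mx s}.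

Definition quasi_permutation (L : lattice gT) : Prop :=
  exists (R F : lattice gT) (A : 'M[int]_(lrk R, lrk L)) (B : 'M[int]_(lrk F, lrk R)),
    [/\ permutation_lattice R, permutation_lattice F, Ghom A, Ghom B &
     [/\ (forall x : 'cV[int]_(lrk L), A *m x = 0 -> x = 0),
         (forall y : 'cV[int]_(lrk F), exists x, B *m x = y),
         B *m A = 0 &
         (forall x : 'cV[int]_(lrk R), B *m x = 0 -> exists y, x = A *m y)]].

Definition lsum (L1 L2 : lattice gT) : lattice gT :=
  Lat (lrk L1 + lrk L2)%N (fun g => block_mx (lrep L1 g) 0 0 (lrep L2 g)).

(* dual lattice Hom_Z(L, Z), in the dual basis: (g f)(x) = f(g^-1 x) *)
Definition ldual (L : lattice gT) : lattice gT :=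
  Lat (lrk L) (fun g => (lrep L g^-1)^T).

Definition quasi_invertible (L : lattice gT) : Prop :=
  exists L' Q : lattice gT,
    [/\ is_lattice L', quasi_permutation Q & Giso (lsum L L') Q].

Definition lat_similar (L1 L2 : lattice gT) : Prop :=
  exists R1 R2 : lattice gT,
    [/\ permutation_lattice R1, permutation_lattice R2 &
        Giso (lsum L1 R1) (lsum L2 R2)].

(* The multiset H (a seq of subgroups).  Basis of (+)_{H in Hs} Z[G/H]:
   the list of pairs (k, C), k the position of H in Hs, C a left coset of H. *)
Definition coset_seq (Hs : seq {group gT}) : seq (nat * {set gT}) :=
  flatten [seq [seq (k, C) | C <- enum (lcosets (nth 1%G Hs k) G)]
          | k <- iota 0 (size Hs)].

Definition coset_act (g : gT) (c : nat * {set gT}) : nat * {set gT} :=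
  (c.1, (g *: c.2)%g).

Definition pentry (Hs : seq {group gT}) (g : gT) (i j : nat) : int :=
  (nth (0%N, set0) (coset_seq Hs) i
     == coset_act g (nth (0%N, set0) (coset_seq Hs) j))%:R.

(* I_{G/H} = kernel of the augmentation (+)_H Z[G/H] -> Z, written in the
   Z-basis f_j = e_{j+1} - e_0 (j < N-1, N = size (coset_seq Hs)) *)
Definition Ilat (Hs : seq {group gT}) : lattice gT :=
  Lat (size (coset_seq Hs)).-1
      (fun g => \matrix_(i, j) (pentry Hs g i.+1 j.+1 - pentry Hs g i.+1 0)).

Definition Jlat (Hs : seq {group gT}) : lattice gT := ldual (Ilat Hs).

Definition dG (Hs : seq {group gT}) : nat :=
  \big[gcdn/0%N]_(H <- Hs) (#|G : H|)%g.

End Lattices.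

(* Main.v *)
Require Import Defs.
From mathcomp Require Import all_boot all_order all_algebra all_fingroup.
From mathcomp Require Import cyclic zify ring lra.
Set Implicit Arguments. Unset Strict Implicit. Unset Printing Implicit Defensive.
Import Order.TTheory GRing.Theory Num.Theory.

(** J_{G/H} is the lattice of integral functions on the disjoint union X of the
    coset spaces, modulo constants.  Equivariant maps Z[X] -> Z[X'] -> Z[X] that
    preserve the augmentation make J_X and J_X' similar; by Bezout such maps exist
    as soon as the Sylow subgroups of the stabilizers agree up to conjugacy, so the
    family may be replaced by at most one rotation group <s^(2^c d')> and two
    dihedral groups <s^(2^a d'), s^j t>, d' being the odd part of d.  For the
    families of the theorem, and for d odd, explicit sequences
    0 -> J -> R -> F -> 0 of functions on vertices, edges and cycles of a graph
    show that J is quasi-permutation.  For the remaining families, a subgroup K of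
    G has a nonzero class in H^1(K, J (x) Q/Z) = H^2(K, J) which vanishes on all
    cyclic subgroups, whereas no such class exists for a direct summand of a
    quasi-permutation lattice. *)

(** The property of a permutation lattice F behind most arguments: for an invariant element of F (x)
    Q/Z, the fractional parts of its coordinates in a permuted basis form an invariant rational
    vector. It gives an extension theorem for equivariant maps, hence cancellation of permutation
    summands, so that quasi-permutation depends only on the similarity class; it also gives the
    vanishing of locally trivial classes. Coefficients Q/Z keep the obstruction at the level of
    1-cochains, that is, of rational functions on cosets.

    Odd factors of augmentations can be cleared, and conjugation by s turns s^j t into s^(j+2) t.
    For even d a family is therefore governed by the least 2-adic exponents of its rotation groups
    and of its dihedral groups of each parity of j.

    An obstructing K = <s^m, s^j t> is seen through its Klein quotient by <s^(2m)>. Either all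
    stabilizers in K lie in <s^(2m)>, and the commutator pairing of the quotient survives; or s^m
    fixes a point of one part of X and every reflection of K a point of the other, and the values
    1/2 and 0 prescribed there fit no character of K. *)

Section IntegerMatrices.
Local Open Scope ring_scope.

Lemma mx_of_additive (a b : nat) (f : 'cV[int]_a -> 'cV[int]_b) :
  (forall x y, f (x + y) = f x + f y) ->
  exists A : 'M[int]_(b, a), forall x, A *m x = f x.
Proof.
move=> fD.
have f0 : f 0 = 0 by apply: (addIr (f 0)); rewrite -fD !add0r.
have fN x : f (- x) = - f x by apply: (addIr (f x)); rewrite -fD !addNr f0.
have fMn x n : f (x *+ n) = f x *+ n.
  by elim: n => [|n IH]; rewrite ?mulr0n // !mulrS fD IH.
have fZ c x : f (c *: x) = c *: f x.
  by rewrite -[c]intz !scaler_int; case: c => n; rewrite ?NegzE ?mulrNz ?fN -?pmulrn fMn.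
have fS (I : Type) (r : seq I) F : f (\sum_(i <- r) F i) = \sum_(i <- r) f (F i).
  by elim: r => [|i r IH]; rewrite ?big_nil // !big_cons fD IH.
exists (\matrix_(i, j) f (delta_mx j 0) i 0) => x.
rewrite {2}(matrix_sum_delta x) fS; apply/matrixP=> i j; rewrite ord1 !mxE.
rewrite summxE; apply: eq_bigr => k _.
by rewrite big_ord1 fZ !mxE mulrC.
Qed.

Lemma eq_mx_mulcV (R : pzRingType) (a b : nat) (A B : 'M[R]_(b, a)) :
  (forall x : 'cV[R]_a, A *m x = B *m x) -> A = B.
Proof.
move=> eqAB; apply/matrixP=> i j; move/matrixP: (eqAB (delta_mx j 0)) => /(_ i 0).
by rewrite -!colE !mxE.
Qed.

Lemma mx_of_cols (a b c : nat) (A : 'M[int]_(b, a)) (C : 'M[int]_(b, c)) :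
  (forall j, exists x : 'cV[int]_a, A *m x = col j C) ->
  exists X : 'M[int]_(a, c), A *m X = C.
Proof.
move=> /fin_all_exists[f fP]; exists (\matrix_(i, j) f j i 0).
apply/matrixP=> i j; have /matrixP/(_ i 0) := fP j; rewrite !mxE => <-.
by apply: eq_bigr => k _; rewrite mxE.
Qed.

Lemma perm_mx_inj (R : nzRingType) n : injective (@perm_mx R n).
Proof.
move=> s t /matrixP est; apply/permP=> i.
have := est i (s i); rewrite !mxE eqxx; case: eqP => // _ /eqP.
by rewrite oner_eq0.
Qed.

Lemma perm_mx_mulE (R : pzRingType) m n (s : 'S_m) (A : 'M[R]_(m, n)) i j :
  (perm_mx s *m A) i j = A (s i) j.
Proof. by rewrite -row_permE mxE. Qed.

Lemma mul_perm_mxE (R : pzRingType) m n (s : 'S_n) (A : 'M[R]_(m, n)) i j :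
  (A *m perm_mx s) i j = A i (s^-1%g j).
Proof. by rewrite -[s in LHS]invgK -col_permE mxE. Qed.

Lemma mxsubrE (V : zmodType) m n (A B : 'M[V]_(m, n)) i j : (A - B) i j = A i j - B i j.
Proof. by rewrite !mxE. Qed.

(** Elements of L (x) Q/Z are handled as rational vectors, with [intm] standing for being zero. *)
Definition ratm (a b : nat) (A : 'M[int]_(a, b)) : 'M[rat]_(a, b) := map_mx intr A.
Definition intm (a b : nat) (A : 'M[rat]_(a, b)) := A \is a mxOver Num.int.

Lemma ratmM a b c (A : 'M_(a, b)) (B : 'M_(b, c)) : ratm (A *m B) = ratm A *m ratm B.
Proof. exact: map_mxM. Qed.

Lemma ratm1 a : ratm (1%:M : 'M_a) = 1%:M.
Proof. exact: map_mx1. Qed.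

Lemma ratm_inj a b : injective (@ratm a b).
Proof.
move=> A B /matrixP e; apply/matrixP=> i j.
by apply: (@intr_inj rat); have := e i j; rewrite !mxE.
Qed.

Lemma intm_ratm a b (A : 'M[int]_(a, b)) : intm (ratm A).
Proof. by apply/mxOverP=> i j; rewrite mxE intr_int. Qed.

Lemma intmM a b c (A : 'M_(a, b)) (B : 'M_(b, c)) : intm A -> intm B -> intm (A *m B).
Proof. exact: mxOverM. Qed.

Lemma intmB a b (A B : 'M_(a, b)) : intm A -> intm B -> intm (A - B).
Proof.
by move=> /mxOverP iA /mxOverP iB; apply/mxOverP=> i j; rewrite !mxE rpredB.
Qed.

Lemma intmD a b (A B : 'M_(a, b)) : intm A -> intm B -> intm (A + B).
Proof.
by move=> /mxOverP iA /mxOverP iB; apply/mxOverP=> i j; rewrite !mxE rpredD.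
Qed.

Definition floorm (a b : nat) (A : 'M[rat]_(a, b)) : 'M[int]_(a, b) := map_mx Num.floor A.

(** Turns a congruence modulo Z into an equality in Q; every passage from invariance modulo Z to
    true invariance goes through it. *)
Lemma floor_fracE (x y : rat) : x - y \is a Num.int ->
  x - (Num.floor x)%:~R = y - (Num.floor y)%:~R.
Proof.
move=> /intrP[m e]; have -> : x = m%:~R + y by rewrite -e subrK.
by rewrite (floorDzr (intr_int _ m)) intrKfloor intrD; ring.
Qed.

End IntegerMatrices.

(** * Permutation lattices, split sequences and cancellation of permutation summands *)

Section Lattices.
Local Open Scope ring_scope.
Variables (gT : finGroupType) (G : {group gT}).
Implicit Types (L M R F P : lattice gT).

(** The definition grants one permutation for each group element; together they form a homomorphism
    because [perm_mx] is injective and [U] can be cancelled. *)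
Lemma permutation_latticeP L : permutation_lattice G L ->
  exists (U : 'M[int]_(lrk L)) (s : gT -> 'S_(lrk L)),
    [/\ U \in unitmx, {in G &, forall g h, s (g * h)%g = (s g * s h)%g} &
        {in G, forall g, lrep L g *m U = U *m perm_mx (s g)}].
Proof.
case=> -[_ rM] [U [uU Us]]; exists U.
pose s g := odflt 1%g [pick s : 'S_(lrk L) | lrep L g *m U == U *m perm_mx s].
have sE : {in G, forall g, lrep L g *m U = U *m perm_mx (s g)}.
  move=> g /Us[t et]; rewrite /s; case: pickP => [x /eqP //|/(_ t)].
  by rewrite et eqxx.
exists s; split=> // g h Gg Gh; apply: (@perm_mx_inj int).
apply: (can_inj (mulKmx uU)).
by rewrite -sE ?groupM // rM // -mulmxA sE // mulmxA sE // -mulmxA -perm_mxM.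
Qed.

Definition block_perm_fun m n (s : 'S_m) (t : 'S_n) (i : 'I_(m + n)) : 'I_(m + n) :=
  match split i with inl i => lshift n (s i) | inr i => rshift m (t i) end.

Lemma block_perm_inj m n s t : injective (@block_perm_fun m n s t).
Proof.
move=> i j; rewrite /block_perm_fun; case: splitP => i' ei; case: splitP => j' ej.
- by move/lshift_inj/perm_inj => e; apply: val_inj; rewrite /= ei ej e.
- by move/eqP; rewrite eq_lrshift.
- by move/eqP; rewrite eq_rlshift.
- by move/rshift_inj/perm_inj => e; apply: val_inj; rewrite /= ei ej e.
Qed.

Lemma block_perm_mx m n (s : 'S_m) (t : 'S_n) :
  block_mx (perm_mx s) 0 0 (perm_mx t) = perm_mx (perm (@block_perm_inj m n s t)) :> 'M[int]__.
Proof.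
apply/matrixP=> i j; rewrite !mxE permE /block_perm_fun.
case: (splitP i) => i' ei; rewrite !mxE; case: splitP => j' ej; rewrite !mxE.
- by congr (_%:R); congr nat_of_bool; rewrite -val_eqE -[RHS]val_eqE /= ej.
- by rewrite -[_ == j]val_eqE /= ej; case: eqP => // e; have := ltn_ord (s i'); lia.
- by rewrite -[_ == j]val_eqE /= ej; case: eqP => // e; have := ltn_ord j'; lia.
- by congr (_%:R); congr nat_of_bool; rewrite -val_eqE -[RHS]val_eqE /= ej eqn_add2l.
Qed.

Lemma is_lattice_lsum L M : is_lattice G L -> is_lattice G M -> is_lattice G (lsum L M).
Proof.
move=> [L1 LM] [M1 MM]; split; first by rewrite /= L1 M1 -scalar_mx_block.
move=> g h Gg Gh /=; rewrite mulmx_block !mulmx0 !mul0mx !addr0 add0r.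
by rewrite LM // MM.
Qed.

Lemma permutation_lattice_lsum L M :
  permutation_lattice G L -> permutation_lattice G M -> permutation_lattice G (lsum L M).
Proof.
move=> [latL [U [uU Us]]] [latM [V [uV Vs]]]; split; first exact: is_lattice_lsum.
exists (block_mx U 0 0 V); split.
  by rewrite unitmxE det_ublock unitrM -!unitmxE uU.
move=> g Gg; have [s es] := Us g Gg; have [t et] := Vs g Gg.
exists (perm (@block_perm_inj _ _ s t)); rewrite -block_perm_mx /=.
by rewrite !mulmx_block !mulmx0 !mul0mx !addr0 !add0r es et.
Qed.

(* The maps [S] and [T] are Z-linear only: a section of [B] and the
   corresponding retraction of [A]. *)
Lemma split_exact (l r f : nat) (A : 'M[int]_(r, l)) (B : 'M[int]_(f, r)) :
    (forall x : 'cV_l, A *m x = 0 -> x = 0) ->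
    (forall y : 'cV_f, exists x, B *m x = y) -> B *m A = 0 ->
    (forall x : 'cV_r, B *m x = 0 -> exists y, x = A *m y) ->
  exists (S : 'M[int]_(r, f)) (T : 'M[int]_(l, r)),
    [/\ B *m S = 1%:M, A *m T = 1%:M - S *m B & T *m A = 1%:M].
Proof.
move=> Ainj Bsurj BA Bex.
have [S BS] : exists S, B *m S = 1%:M by apply: mx_of_cols => j; apply: Bsurj.
have [T AT] : exists T, A *m T = 1%:M - S *m B.
  apply: mx_of_cols => j.
  have [|y ->] := Bex (col j (1%:M - S *m B)); last by exists y.
  by rewrite colE mulmxA mulmxBr mulmx1 mulmxA BS mul1mx subrr mul0mx.
exists S, T; split=> //; apply: eq_mx_mulcV => x; apply/eqP; rewrite -subr_eq0.
apply/eqP/Ainj; rewrite mulmxBr mul1mx !mulmxA AT mulmxBl mul1mx -(mulmxA S) BA.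
by rewrite mulmx0 subr0 subrr.
Qed.

Lemma quasi_permutation_split L : quasi_permutation G L ->
  exists R F (A : 'M_(lrk R, lrk L)) (B : 'M_(lrk F, lrk R))
    (S : 'M_(lrk R, lrk F)) (T : 'M_(lrk L, lrk R)),
    [/\ permutation_lattice G R, permutation_lattice G F, Ghom G A, Ghom G B &
     [/\ B *m A = 0, B *m S = 1%:M, A *m T = 1%:M - S *m B & T *m A = 1%:M]].
Proof.
move=> [R [F [A [B [pR pF hA hB [inj sur ba ex]]]]]].
by have [S [T [? ? ?]]] := split_exact inj sur ba ex; exists R, F, A, B, S, T.
Qed.

Lemma quasi_permutation_of_split L R F (A : 'M_(lrk R, lrk L)) (B : 'M_(lrk F, lrk R))
    (S : 'M_(lrk R, lrk F)) (T : 'M_(lrk L, lrk R)) :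
    permutation_lattice G R -> permutation_lattice G F -> Ghom G A -> Ghom G B ->
    B *m A = 0 -> B *m S = 1%:M -> A *m T = 1%:M - S *m B -> T *m A = 1%:M ->
  quasi_permutation G L.
Proof.
move=> pR pF hA hB BA BS AT TA; exists R, F, A, B; split=> //; split=> //.
- by move=> x Ax; rewrite -[x]mul1mx -TA -mulmxA Ax mulmx0.
- by move=> y; exists (S *m y); rewrite mulmxA BS mul1mx.
- by move=> x Bx; exists (T *m x); rewrite mulmxA AT mulmxBl mul1mx -mulmxA Bx mulmx0 subr0.
Qed.

Lemma Ghom_comp L M P (A : 'M_(lrk M, lrk L)) (B : 'M_(lrk P, lrk M)) :
  Ghom G A -> Ghom G B -> @Ghom _ G L P (B *m A).
Proof. by move=> hA hB g Gg; rewrite -mulmxA hA // mulmxA hB // mulmxA. Qed.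

Lemma Ghom_inv L M (A : 'M_(lrk M, lrk L)) (B : 'M_(lrk L, lrk M)) :
  Ghom G A -> A *m B = 1%:M -> B *m A = 1%:M -> Ghom G B.
Proof.
move=> hA AB BA g Gg.
by rewrite -[LHS]mulmx1 -AB mulmxA -(mulmxA B) -hA // !mulmxA BA mul1mx.
Qed.

Lemma quasi_permutation_Giso L M : Giso G L M -> quasi_permutation G M -> quasi_permutation G L.
Proof.
move=> [C [D [hC CD DC]]] /quasi_permutation_split.
move=> [R [F [A [B [S [T [pR pF hA hB [BA BS AT TA]]]]]]]].
apply: (@quasi_permutation_of_split L R F (A *m C) B S (D *m T)) => //.
- exact: Ghom_comp hC hA.
- by rewrite mulmxA BA mul0mx.
- by rewrite mulmxA -(mulmxA A) CD mulmx1.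
- by rewrite mulmxA -(mulmxA D) TA mulmx1.
Qed.

Lemma quasi_permutation_lsum L P :
  permutation_lattice G P -> quasi_permutation G L -> quasi_permutation G (lsum L P).
Proof.
move=> pP /quasi_permutation_split [R [F [A [B [S [T [pR pF hA hB [BA BS AT TA]]]]]]]].
apply: (@quasi_permutation_of_split (lsum L P) (lsum R P) F
  (block_mx A 0 0 1%:M) (row_mx B 0) (col_mx S 0) (block_mx T 0 0 1%:M)) => //.
- exact: permutation_lattice_lsum.
- move=> g Gg /=; rewrite !mulmx_block !mulmx0 !mul0mx !addr0 !add0r hA //.
  by rewrite mulmx1 mul1mx.
- by move=> g Gg /=; rewrite mul_row_block !mulmx0 !mul0mx !addr0 hB // mul_mx_row mulmx0.
- by rewrite mul_row_block !mulmx0 !mul0mx !addr0 BA row_mx0.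
- by rewrite mul_row_col mulmx0 addr0.
- rewrite mul_col_row mulmx_block !mulmx0 !mul0mx !addr0 !add0r AT mulmx1.
  rewrite [X in _ = X - _]scalar_mx_block opp_block_mx add_block_mx.
  by rewrite !oppr0 !addr0.
- by rewrite mulmx_block !mulmx0 !mul0mx !addr0 !add0r TA mulmx1 -scalar_mx_block.
Qed.

Lemma ratm_perm n (s : 'S_n) : ratm (perm_mx s) = perm_mx s.
Proof. exact: map_perm_mx. Qed.

Lemma is_lattice_repV L : is_lattice G L ->
  {in G, forall g, lrep L g *m lrep L g^-1%g = 1%:M}.
Proof. by move=> [l1 lM] g Gg; rewrite -lM ?groupV // mulgV l1. Qed.

(* Averaging makes the extension [p *m T] equivariant over the rationals; the
   resulting denominators live on [F], where they can be removed by subtracting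
   fractional parts, which are invariant as both lattices are permutation. *)
Lemma extend_to_permutation L R F P (A : 'M_(lrk R, lrk L)) (B : 'M_(lrk F, lrk R))
    (S : 'M_(lrk R, lrk F)) (T : 'M_(lrk L, lrk R)) (p : 'M_(lrk P, lrk L)) :
    is_lattice G R -> permutation_lattice G F -> permutation_lattice G P ->
    Ghom G A -> Ghom G B -> Ghom G p ->
    B *m A = 0 -> B *m S = 1%:M -> A *m T = 1%:M - S *m B -> T *m A = 1%:M ->
  exists q : 'M_(lrk P, lrk R), Ghom G q /\ q *m A = p.
Proof.
move=> latR pF pP hA hB hp BA BS AT TA.
have [U [s [uU sM Us]]] := permutation_latticeP pF.
have [V [t [uV tM Vt]]] := permutation_latticeP pP.
have latP := proj1 pP.
(* [q0] extends [p] but is only Z-linear; its average [q1] is equivariant but only rational. *)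
pose q0 := p *m T.
pose q1 := (#|G|%:R : rat)^-1 *:
  \sum_(g in G) ratm (lrep P g *m q0 *m lrep R g^-1%g).
have G0 : (#|G|%:R : rat) != 0 by rewrite pnatr_eq0 -lt0n cardG_gt0.
have q1A : q1 *m ratm A = ratm p.
  rewrite -scalemxAl mulmx_suml (eq_bigr (fun=> ratm p)); last first.
    move=> g Gg; rewrite -ratmM -!mulmxA -hA ?groupV // (mulmxA T) TA mul1mx.
    by rewrite hp ?groupV // mulmxA is_lattice_repV // mul1mx.
  by rewrite sumr_const -scaler_nat scalerA mulVf // scale1r.
have hq1 : {in G, forall g, q1 *m ratm (lrep R g) = ratm (lrep P g) *m q1}.
  move=> g Gg; rewrite -scalemxAl -scalemxAr; congr (_ *: _).
  rewrite mulmx_suml mulmx_sumr (reindex_inj (mulgI g)) /=.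
  apply: eq_big => [h|h Gh]; first by rewrite groupMl.
  rewrite groupMl // in Gh.
  rewrite -!ratmM invMg (proj2 latP) // (proj2 latR) ?groupV // -!mulmxA.
  by have := is_lattice_repV latR (groupVr Gg); rewrite invgK => ->; rewrite mulmx1.
(* Both [q0] and [q1] extend [p], so their difference vanishes on the image of [A] and factors
   through [B]. *)
have [v vB] : exists v, q1 - ratm q0 = v *m ratm B.
  exists ((q1 - ratm q0) *m ratm S); rewrite -mulmxA -ratmM.
  have -> : S *m B = 1%:M - A *m T by rewrite AT opprB addrC subrK.
  rewrite /ratm map_mxB -!/(ratm _) ratm1 ratmM mulmxBr mulmx1 mulmxA mulmxBl.
  by rewrite q1A -ratmM /q0 -mulmxA TA mulmx1 subrr mul0mx subr0.
have vint : {in G, forall g, intm (ratm (lrep P g) *m v - v *m ratm (lrep F g))}.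
  move=> g Gg.
  have -> : ratm (lrep P g) *m v - v *m ratm (lrep F g) =
      ratm ((- (lrep P g *m q0 - q0 *m lrep R g)) *m S).
    have e : (ratm (lrep P g) *m v - v *m ratm (lrep F g)) *m ratm B =
             ratm (- (lrep P g *m q0 - q0 *m lrep R g)).
      rewrite mulmxBl -!mulmxA -vB -ratmM -hB // ratmM (mulmxA v) -vB mulmxBr mulmxBl.
      rewrite hq1 // /ratm !(map_mxN, map_mxB, map_mxM) /= -!/(ratm _).
      by rewrite !opprB [LHS]addrC addrA subrK !mulmxA.
    by rewrite ratmM -e -mulmxA -ratmM BS ratm1 mulmx1.
  exact: intm_ratm.
(* In permuted bases the group only permutes the entries of [v'], so the entrywise fractional part
   [u'] is strictly equivariant. Removing it from [v'] leaves an integral correction of [q0]. *)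
pose v' := ratm (invmx V) *m v *m ratm U.
pose u' := v' - ratm (floorm v').
have uE i j : u' i j = v' i j - (Num.floor (v' i j))%:~R.
  by rewrite mxsubrE [ratm _ i j]mxE [floorm _ i j]mxE.
have hu' : {in G, forall g, perm_mx (t g) *m u' = u' *m perm_mx (s g)}.
  move=> g Gg; have: intm (perm_mx (t g) *m v' - v' *m perm_mx (s g)).
    have -> : perm_mx (t g) *m v' - v' *m perm_mx (s g) =
        ratm (invmx V) *m (ratm (lrep P g) *m v - v *m ratm (lrep F g)) *m ratm U.
      rewrite mulmxBr mulmxBl -!mulmxA -(ratmM _ U) Us // (mulmxA _ (ratm (lrep P g))).
      rewrite -(ratmM (invmx V)).
      have -> : invmx V *m lrep P g = perm_mx (t g) *m invmx V.
        by apply: (can_inj (mulmxK uV)); rewrite mulmxKV // -mulmxA Vt // mulKmx.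
      by rewrite !ratmM !ratm_perm !mulmxA.
    by rewrite !intmM ?intm_ratm ?vint.
  move=> /mxOverP vi; apply/matrixP=> i j; have := vi i j.
  rewrite mxsubrE !perm_mx_mulE !mul_perm_mxE !uE.
  exact: floor_fracE.
exists (q0 + V *m floorm v' *m invmx U *m B); split; last first.
  by rewrite mulmxDl /q0 -!mulmxA TA BA !mulmx0 mulmx1 addr0.
have e : ratm (q0 + V *m floorm v' *m invmx U *m B) =
    q1 - ratm V *m u' *m ratm (invmx U) *m ratm B.
  have -> : ratm V *m u' *m ratm (invmx U) = v - ratm (V *m floorm v' *m invmx U).
    rewrite /u' mulmxBr mulmxBl !ratmM; congr (_ - _).
    rewrite /v' !mulmxA -(ratmM V) mulmxV // ratm1 mul1mx -mulmxA -ratmM.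
    by rewrite mulmxV // ratm1 mulmx1.
  rewrite mulmxBl -vB -ratmM opprB addrCA opprB [q1 + _]addrC subrK addrC.
  by rewrite /ratm map_mxD.
move=> g Gg; apply: ratm_inj; rewrite ratmM [RHS]ratmM e [LHS]mulmxBl [RHS]mulmxBr hq1 //.
congr (_ - _); clearbody u'.
rewrite -!mulmxA -(ratmM B) hB // ratmM.
have e2 : invmx U *m lrep F g = perm_mx (s g) *m invmx U.
  by apply: (can_inj (mulmxK uU)); rewrite mulmxKV // -mulmxA Us // mulKmx.
rewrite (mulmxA (ratm (invmx U))) -ratmM e2 !mulmxA -(ratmM _ V) Vt // !ratmM !ratm_perm.
by rewrite mulmxA -(mulmxA _ u' (perm_mx _)) -hu' // !mulmxA.
Qed.

(** The projection to [P] extends to some [q] on [R], and [L] becomes the kernel of (B, q) from [R]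
    to the permutation lattice F + P. This cancellation makes quasi-permutation a similarity
    invariant. *)
Lemma quasi_permutation_lsumI L P :
  permutation_lattice G P -> quasi_permutation G (lsum L P) -> quasi_permutation G L.
Proof.
move=> pP /quasi_permutation_split [R [F [A [B [S [T [pR pF hA hB [BA BS AT TA]]]]]]]].
pose i1 : 'M[int]_(lrk (lsum L P), lrk L) := col_mx 1%:M 0.
pose i2 : 'M[int]_(lrk (lsum L P), lrk P) := col_mx 0 1%:M.
pose p1 : 'M[int]_(lrk L, lrk (lsum L P)) := row_mx 1%:M 0.
pose p2 : 'M[int]_(lrk P, lrk (lsum L P)) := row_mx 0 1%:M.
have hi1 : @Ghom _ G L (lsum L P) i1.
  by move=> g _ /=; rewrite mul_col_mx mul_block_col !mulmx0 !mul0mx mul1mx mulmx1 !addr0.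
have hp2 : @Ghom _ G (lsum L P) P p2.
  by move=> g _ /=; rewrite mul_row_block mul_mx_row !mulmx0 !mul0mx mul1mx mulmx1 !add0r.
have e1 : i1 *m p1 = 1%:M - i2 *m p2.
  rewrite !mul_col_row !mul1mx !mul0mx [X in _ = X - _]scalar_mx_block opp_block_mx.
  by rewrite add_block_mx !oppr0 !addr0 subrr.
have p1i1 : p1 *m i1 = 1%:M by rewrite mul_row_col mulmx0 mulmx1 addr0.
have p2i1 : p2 *m i1 = 0 by rewrite mul_row_col mulmx0 mul0mx addr0.
have p2i2 : p2 *m i2 = 1%:M by rewrite mul_row_col mulmx0 mulmx1 add0r.
have p1i2 : p1 *m i2 = 0 by rewrite mul_row_col mulmx0 mul0mx addr0.
have [q [hq qA]] := extend_to_permutation (proj1 pR) pF pP hA hB hp2 BA BS AT TA.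
apply: (@quasi_permutation_of_split L R (lsum F P) (A *m i1) (col_mx B q)
  (row_mx (S - A *m i2 *m (q *m S)) (A *m i2)) (p1 *m T)) => //.
- exact: permutation_lattice_lsum.
- exact: Ghom_comp hi1 hA.
- move=> g Gg /=; rewrite mul_col_mx mul_block_col !mul0mx addr0 add0r.
  by rewrite hB // hq.
- by rewrite mul_col_mx !mulmxA BA mul0mx qA p2i1 col_mx0.
- rewrite mul_col_row !mulmxBr !mulmxA BA !mul0mx BS subr0 qA p2i2 mul1mx subrr.
  by rewrite -scalar_mx_block.
- have pT : p2 *m T = q - q *m S *m B by rewrite -qA -mulmxA AT mulmxBr mulmx1 mulmxA.
  rewrite mulmxA -(mulmxA A) e1 mulmxBr mulmx1 mulmxBl AT (mulmxA A i2) -(mulmxA _ p2) pT.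
  rewrite mul_row_col mulmxBl mulmxBr !mulmxA !opprD !opprK -!addrA.
  by congr (_ + (_ + _)); rewrite addrC.
- by rewrite mulmxA -(mulmxA p1) TA mulmx1 p1i1.
Qed.

Lemma Giso_sym L M : Giso G L M -> Giso G M L.
Proof. by move=> [A [B [hA AB BA]]]; exists B, A; split=> //; apply: Ghom_inv hA AB BA. Qed.

Lemma quasi_permutation_similar L M :
  lat_similar G L M -> quasi_permutation G M -> quasi_permutation G L.
Proof.
move=> [R1 [R2 [pR1 pR2 iso]]] qM; apply: (quasi_permutation_lsumI pR1).
by apply: quasi_permutation_Giso iso _; apply: quasi_permutation_lsum.
Qed.

Lemma Giso_lsum0 L (Z : lattice gT) : lrk Z = 0%N -> Giso G (lsum L Z) L.
Proof.
case: Z => z rz /= z0; subst z.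
exists (row_mx 1%:M 0), (col_mx 1%:M 0); split.
- by move=> g _ /=; rewrite mul_row_block mul_mx_row !mulmx0 !mul0mx mul1mx mulmx1 !addr0.
- by rewrite mul_row_col mulmx0 addr0 mulmx1.
- rewrite mul_col_row !mul1mx !mul0mx [RHS]scalar_mx_block.
  by congr block_mx; apply/matrixP=> - [].
Qed.

Lemma quasi_permutation_invertible L : quasi_permutation G L -> quasi_invertible G L.
Proof.
move=> qL; exists (@Lat gT 0 (fun=> 0)), L; split=> //; last exact: Giso_lsum0.
by split=> [|g h _ _]; apply/matrixP=> - [].
Qed.

End Lattices.

(** * Locally trivial classes with coefficients in Q/Z *)

Section LocallyTrivialCocycles.
Local Open Scope ring_scope.
Variables (gT : finGroupType) (G : {group gT}).
Implicit Types (L M R F P : lattice gT).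

(* Triviality of the kernel of H^1(K, L (x) Q/Z) -> prod_k H^1(<k>, L (x) Q/Z);
   classes are represented by rational vectors modulo integral ones. *)
Definition locally_trivial_trivial (K : {set gT}) L : Prop :=
  forall b : gT -> 'cV[rat]_(lrk L),
    {in K &, forall g h, intm (b (g * h)%g - b g - ratm (lrep L g) *m b h)} ->
    {in K, forall g, exists f, intm (b g - (ratm (lrep L g) *m f - f))} ->
  exists f, {in K, forall g, intm (b g - (ratm (lrep L g) *m f - f))}.

Lemma locally_trivial_retract (K : {set gT}) L M
    (i : 'M_(lrk M, lrk L)) (p : 'M_(lrk L, lrk M)) :
  K \subset G -> Ghom G i -> Ghom G p -> p *m i = 1%:M ->
  locally_trivial_trivial K M -> locally_trivial_trivial K L.
Proof.
move=> /subsetP sKG hi hp pi lM b bc bl.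
have [|g Kg|f fP] := lM (fun g => ratm i *m b g).
- move=> g h Kg Kh; rewrite mulmxA -ratmM -hi ?sKG // ratmM -mulmxA -!mulmxBr.
  by rewrite intmM ?intm_ratm ?bc.
- have [f fP] := bl g Kg; exists (ratm i *m f).
  rewrite mulmxA -ratmM -hi ?sKG // ratmM -mulmxA -!mulmxBr.
  by rewrite intmM ?intm_ratm.
exists (ratm p *m f) => g Kg.
have -> : b g - (ratm (lrep L g) *m (ratm p *m f) - ratm p *m f) =
    ratm p *m (ratm i *m b g - (ratm (lrep M g) *m f - f)).
  rewrite !mulmxBr !mulmxA -!ratmM pi ratm1 mul1mx hp ?sKG //.
by rewrite intmM ?intm_ratm ?fP.
Qed.

Lemma intm_unit n m (U : 'M[int]_n) (v : 'M[rat]_(n, m)) : U \in unitmx ->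
  intm (ratm U *m v) = intm v.
Proof.
move=> uU; apply/idP/idP => iv; last by rewrite intmM ?intm_ratm.
by rewrite -[v]mul1mx -ratm1 -(mulVmx uU) ratmM -mulmxA intmM ?intm_ratm.
Qed.

(* On an orbit with chosen base point, the cochain is determined modulo Z by
   its values along paths to the base point; independence of the path is the
   vanishing of the cocycle on stabilizers, which is a local condition. *)
Lemma locally_trivial_permutation (K : {group gT}) P :
  K \subset G -> permutation_lattice G P -> locally_trivial_trivial K P.
Proof.
move=> /subsetP sKG pP b bc bl.
have [U [s [uU sM Us]]] := permutation_latticeP pP.
pose c g := ratm (invmx U) *m b g.
have UP g : g \in K -> invmx U *m lrep P g = perm_mx (s g) *m invmx U.
  by move=> Kg; apply: (can_inj (mulmxK uU)); rewrite mulmxKV // -mulmxA Us ?sKG // mulKmx.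
have cc : {in K &, forall g h i, c (g * h)%g i 0 - c g i 0 - c h (s g i) 0 \is a Num.int}.
  move=> g h Kg Kh i.
  have : intm (ratm (invmx U) *m (b (g * h)%g - b g - ratm (lrep P g) *m b h)).
    by rewrite intmM ?intm_ratm ?bc.
  rewrite !mulmxBr mulmxA -ratmM UP // ratmM ratm_perm -mulmxA => /mxOverP /(_ i 0).
  by rewrite !mxsubrE perm_mx_mulE.
(* A coboundary has zero coordinate at an index fixed by [g], so local triviality makes this entry
   integral. *)
have c_stab g i : g \in K -> s g i = i -> c g i 0 \is a Num.int.
  move=> Kg gi; have [f fP] := bl g Kg.
  have : intm (ratm (invmx U) *m (b g - (ratm (lrep P g) *m f - f))).
    by rewrite intmM ?intm_ratm.
  rewrite !mulmxBr mulmxA -ratmM UP // ratmM ratm_perm -mulmxA => /mxOverP /(_ i 0).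
  by rewrite !mxsubrE perm_mx_mulE gi subrr subr0.
pose e i j := [exists g in K, s g i == j].
pose base i := odflt i [pick j | e i j].
have s1 : s 1%g = 1%g by apply: (mulgI (s 1%g)); rewrite -sM // mulg1 mulg1.
have baseP i : e i (base i).
  rewrite /base; case: pickP => [j //|/(_ i)]; rewrite /e.
  by case/existsP; exists 1%g; rewrite group1 s1 perm1 eqxx.
have base_s g i : g \in K -> base (s g i) = base i.
  move=> Kg; rewrite /base.
  have ee : e (s g i) =1 e i.
    move=> j; apply/existsP/existsP => -[h /andP[Kh /eqP hj]].
      by exists (g * h)%g; rewrite groupM // sM ?sKG // permM hj eqxx.
    exists (g^-1 * h)%g; rewrite groupM ?groupV // -permM -sM ?sKG ?groupM ?groupV //.
    by rewrite mulKVg hj eqxx.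
  rewrite (eq_pick ee); case: pickP => // /(_ (base i)); by rewrite baseP.
pose r i := odflt 1%g [pick g in K | s g i == base i].
have rP i : r i \in K /\ s (r i) i = base i.
  rewrite /r; case: pickP => [g /andP[Kg /eqP //]|H].
  by have /existsP[g] := baseP i; rewrite H.
pose f := - \col_i c (r i) i 0.
exists (ratm U *m f) => g Kg.
have -> : b g - (ratm (lrep P g) *m (ratm U *m f) - ratm U *m f) =
    ratm U *m (c g - (perm_mx (s g) *m f - f)).
  rewrite /c !mulmxBr !mulmxA -!ratmM mulmxV // ratm1 mul1mx Us ?sKG //.
  by rewrite ratmM ratm_perm.
rewrite intm_unit //; apply/mxOverP=> i j; rewrite ord1 !mxsubrE perm_mx_mulE {j}.
have fE j : f j 0 = - c (r j) j 0 by rewrite /f mxE [X in - X]mxE.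
rewrite !fE.
have [Ki si] := rP i; have [Kj sj] := rP (s g i).
(* This element is a loop at the base point of the orbit: back to [i], along [g], then to the base
   point again. [c_stab] applies to it. *)
have Kl : ((r i)^-1 * (g * r (s g i)))%g \in K by rewrite !groupM ?groupV.
have c1 := cc _ _ Kg Kj i.
have c2 := cc _ _ Ki Kl i; rewrite mulKVg in c2.
have c3 : c ((r i)^-1 * (g * r (s g i)))%g (s (r i) i) 0 \is a Num.int.
  apply: c_stab => //; rewrite -permM -sM ?sKG // mulKVg sM ?sKG // permM.
  by rewrite sj base_s.
have -> : c g i 0 - (- c (r (s g i)) (s g i) 0 - - c (r i) i 0) =
   (c (g * r (s g i))%g i 0 - c (r i) i 0 - c ((r i)^-1 * (g * r (s g i)))%g (s (r i) i) 0)
   + c ((r i)^-1 * (g * r (s g i)))%g (s (r i) i) 0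
   - (c (g * r (s g i))%g i 0 - c g i 0 - c (r (s g i)) (s g i) 0) by ring.
by apply: rpredB => //; apply: rpredD.
Qed.

(** The class becomes the coboundary of some [f] in [R]. Then [B f] is invariant modulo Z, and as
    [F] is a permutation lattice it differs by an integral vector from an invariant rational one.
    Lifting both parts to [R] and subtracting them brings [f] into the image of [A]. *)
Lemma locally_trivial_quasi_permutation (K : {group gT}) L :
  K \subset G -> quasi_permutation G L -> locally_trivial_trivial K L.
Proof.
move=> sKG /quasi_permutation_split.
move=> [R [F [A [B [S [T [pR pF hA hB [BA BS AT TA]]]]]]]] b bc bl.
have latR := proj1 pR; have sK := subsetP sKG.
have [|g Kg|f fP] := locally_trivial_permutation sKG pR (b := fun g => ratm A *m b g).
- move=> g h Kg Kh; rewrite mulmxA -ratmM -hA ?sK // ratmM -mulmxA -!mulmxBr.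
  by rewrite intmM ?intm_ratm ?bc.
- have [f fP] := bl g Kg; exists (ratm A *m f).
  rewrite mulmxA -ratmM -hA ?sK // ratmM -mulmxA -!mulmxBr.
  by rewrite intmM ?intm_ratm.
have [U [s [uU sM Us]]] := permutation_latticeP pF.
pose v := ratm (invmx U) *m (ratm B *m f).
have UF g : g \in K -> invmx U *m lrep F g = perm_mx (s g) *m invmx U.
  by move=> Kg; apply: (can_inj (mulmxK uU)); rewrite mulmxKV // -mulmxA Us ?sK // mulKmx.
have vint g : g \in K -> intm (perm_mx (s g) *m v - v).
  move=> Kg; have: intm (ratm 0 - ratm (invmx U) *m (ratm B *m
      (ratm A *m b g - (ratm (lrep R g) *m f - f)))).
    by rewrite intmB ?intmM ?intm_ratm ?fP.
  rewrite mulmxBr mulmxA -ratmM BA ![ratm 0]map_mx0 mul0mx !sub0r !mulmxN opprK.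
  rewrite !mulmxBr (mulmxA (ratm B)) -ratmM hB ?sK // ratmM -mulmxA.
  by rewrite (mulmxA (ratm (invmx U))) -(ratmM _ (lrep F g)) UF // ratmM ratm_perm -mulmxA.
pose u := v - ratm (floorm v).
have uinv g : g \in K -> perm_mx (s g) *m u = u.
  move=> Kg; apply/matrixP=> i j; rewrite perm_mx_mulE.
  have uE k : u k j = v k j - (Num.floor (v k j))%:~R.
    by rewrite mxsubrE [ratm _ k j]mxE [floorm _ k j]mxE.
  rewrite !uE; apply: floor_fracE; have /mxOverP/(_ i j) := vint g Kg.
  by rewrite mxsubrE perm_mx_mulE.
pose uF := ratm U *m u.
have uFinv g : g \in K -> ratm (lrep F g) *m uF = uF.
  by move=> Kg; rewrite /uF mulmxA -ratmM Us ?sK // ratmM ratm_perm -mulmxA uinv.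
have BfE : ratm B *m f = uF + ratm (U *m floorm v).
  by rewrite /uF /u mulmxBr ratmM subrK /v (mulmxA (ratm U)) -(ratmM U) mulmxV // ratm1 mul1mx.
clearbody uF.
(* [z] is an integral lift of the integral part of [B f], and [w] an invariant lift of [uF],
   obtained by averaging over [K]. Subtracting [w] does not change the coboundary of [f];
   subtracting [z] changes it by integers. *)
pose z := S *m (U *m floorm v).
pose w := (#|K|%:R : rat)^-1 *: \sum_(g in K) ratm (lrep R g) *m (ratm S *m uF).
have K0 : (#|K|%:R : rat) != 0 by rewrite pnatr_eq0 -lt0n cardG_gt0.
have winv g : g \in K -> ratm (lrep R g) *m w = w.
  move=> Kg; rewrite -scalemxAr; congr (_ *: _); rewrite mulmx_sumr.
  rewrite [RHS](reindex_inj (mulgI g)) /=; apply: eq_big => h; first by rewrite groupMl.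
  move=> Kh; rewrite (mulmxA (ratm (lrep R g))) -(ratmM (lrep R g)).
  by rewrite -(proj2 latR) ?sK.
have Bw : ratm B *m w = uF.
  rewrite -scalemxAr mulmx_sumr (eq_bigr (fun=> uF)).
    by rewrite sumr_const -scaler_nat scalerA mulVf // scale1r.
  move=> g Kg; rewrite (mulmxA (ratm B)) -(ratmM B) hB ?sK // ratmM -mulmxA (mulmxA (ratm B)).
  rewrite -(ratmM B) BS.
  by rewrite ratm1 mul1mx uFinv.
pose f1 := f - w - ratm z.
have Bf1 : ratm B *m f1 = 0.
  by rewrite !mulmxBr Bw BfE -(ratmM B) mulmxA BS mul1mx [uF + _]addrC addrK subrr.
have f1E : f1 = ratm A *m (ratm T *m f1).
  rewrite mulmxA -ratmM AT [ratm (_ - _)]map_mxB -!/(ratm _) ratm1 mulmxBl mul1mx.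
  by rewrite ratmM -mulmxA Bf1 mulmx0 subr0.
exists (ratm T *m f1) => g Kg.
have -> : b g - (ratm (lrep L g) *m (ratm T *m f1) - ratm T *m f1) =
   ratm T *m ((ratm A *m b g - (ratm (lrep R g) *m f - f))
              + (ratm (lrep R g) *m ratm z - ratm z)).
  have -> : (ratm A *m b g - (ratm (lrep R g) *m f - f)) + (ratm (lrep R g) *m ratm z - ratm z)
     = ratm A *m b g - (ratm (lrep R g) *m f1 - f1).
    rewrite /f1 !mulmxBr winv // -addrA; congr (_ + _).
    set x := _ *m f; set y := _ *m ratm z.
    by apply/matrixP=> i j; rewrite !mxE; ring.
  move: (ratm T *m f1) f1E => y ->.
  rewrite (mulmxA _ (ratm A)) -ratmM -hA ?sK // ratmM -mulmxA -!mulmxBr.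
  by rewrite mulmxA -ratmM TA ratm1 mul1mx.
by rewrite intmM ?intm_ratm // intmD ?fP // intmB ?intmM ?intm_ratm.
Qed.

Lemma locally_trivial_quasi_invertible (K : {group gT}) L :
  K \subset G -> quasi_invertible G L -> locally_trivial_trivial K L.
Proof.
move=> sKG [L' [Q [latL' qQ [A [B [hA AB BA]]]]]].
have hB := Ghom_inv hA AB BA.
pose i1 : 'M[int]_(lrk (lsum L L'), lrk L) := col_mx 1%:M 0.
pose p1 : 'M[int]_(lrk L, lrk (lsum L L')) := row_mx 1%:M 0.
have hi1 : @Ghom _ G L (lsum L L') i1.
  by move=> g _ /=; rewrite mul_col_mx mul_block_col !mulmx0 !mul0mx mul1mx mulmx1 !addr0.
have hp1 : @Ghom _ G (lsum L L') L p1.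
  by move=> g _ /=; rewrite mul_row_block mul_mx_row !mulmx0 !mul0mx mul1mx mulmx1 !addr0.
apply: (@locally_trivial_retract K L Q (A *m i1) (p1 *m B)) => //.
- exact: Ghom_comp hi1 hA.
- exact: Ghom_comp hB hp1.
- by rewrite mulmxA -(mulmxA p1) BA mulmx1 mul_row_col mulmx0 mulmx1 addr0.
- exact: locally_trivial_quasi_permutation.
Qed.

End LocallyTrivialCocycles.

(** * Lattices of functions on disjoint unions of coset spaces *)

Section CosetLattices.
Local Open Scope ring_scope.
Variables (gT : finGroupType) (G : {group gT}).
Implicit Types (Hs Rs Fs : seq {group gT}) (g h : gT) (k : nat).

Definition all_sub Hs := all (fun H : {group gT} => H \subset G) Hs.

Local Notation grp Hs k := (nth 1%G Hs k).
Local Notation cs Hs := (coset_seq G Hs).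
Local Notation c0 := (0%N, set0 : {set gT}).

Lemma mem_coset_seq Hs k (C : {set gT}) :
  ((k, C) \in cs Hs) = (k < size Hs)%N && (C \in lcosets (grp Hs k) G).
Proof.
apply/flatten_mapP/andP => [[k' + /mapP[C' + [-> ->]]]|[ks CG]].
  by rewrite mem_iota mem_enum.
by exists k; rewrite ?mem_iota //; apply/mapP; exists C; rewrite ?mem_enum.
Qed.

Lemma coset_seq_uniq Hs : uniq (cs Hs).
Proof.
apply: allpairs_uniq_dep; rewrite ?iota_uniq //; first by move=> k _; apply: enum_uniq.
by move=> [k C] [k' C'] /= _ _ [-> ->].
Qed.

Lemma coset_seq_nonempty Hs : Hs != [::] -> (0 < size (cs Hs))%N.
Proof.
case: Hs => // H Hs _; suff : (0%N, gval H) \in cs (H :: Hs) by case: (cs _).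
by rewrite mem_coset_seq /=; apply/lcosetsP; exists 1%g; rewrite ?lcoset1.
Qed.

Lemma nth_coset_seq Hs i : all_sub Hs -> (i < size (cs Hs))%N ->
  exists k x, [/\ (k < size Hs)%N, x \in G, x = repr (nth c0 (cs Hs) i).2 &
    nth c0 (cs Hs) i = (k, x *: grp Hs k)%g].
Proof.
move=> sHs /(mem_nth c0); case: (nth _ _ i) => k C.
rewrite mem_coset_seq => /andP[ks /lcosetsP[x Gx ->]].
have sH := allP sHs _ (mem_nth 1%G ks).
exists k, (repr (x *: grp Hs k))%g; split=> //=.
  have := mem_repr x (lcoset_refl (grp Hs k) x) => /lcosetP[h Hh ->].
  by rewrite groupM // (subsetP sH).
by congr (_, _); have := mem_repr x (lcoset_refl (grp Hs k) x) => /lcoset_eqP.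
Qed.

Lemma index_coset_seq Hs k g : (k < size Hs)%N -> g \in G ->
  (k, g *: grp Hs k)%g \in cs Hs.
Proof. by move=> ks Gg; rewrite mem_coset_seq ks; apply/lcosetsP; exists g. Qed.

(* A function on the disjoint union of the G/H_k is encoded as a family of
   functions on G, the k-th one being right H_k-invariant. *)
Definition right_inv (T : Type) (f : gT -> T) (H : {set gT}) :=
  {in G & H, forall g h, f (g * h)%g = f g}.
Definition inv_fam (T : Type) Hs (phi : nat -> gT -> T) :=
  forall k, (k < size Hs)%N -> right_inv (phi k) (grp Hs k).
Definition eq_fam (T : Type) Hs (phi psi : nat -> gT -> T) :=
  forall k g, (k < size Hs)%N -> g \in G -> phi k g = psi k g.
Definition translate (T : Type) (g : gT) (phi : nat -> gT -> T) k x := phi k (g^-1 * x)%g.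

Lemma inv_fam_translate (T : Type) Hs (phi : nat -> gT -> T) g : g \in G ->
  inv_fam Hs phi -> inv_fam Hs (translate g phi).
Proof. by move=> Gg ok k ks x h Gx Hh; rewrite /translate mulgA ok // groupM ?groupV. Qed.

(** Z[X] is self-dual, so the same lattice serves as the integral functions on X with the action
    [translate]. *)
Definition Plat Hs : lattice gT :=
  Lat (size (cs Hs)) (fun g => \matrix_(i, j) pentry G Hs g i j).

(** * Coordinates of functions, over Z for equivariant maps and over Q for cocycles *)

Section Coordinates.
Variable R : pzRingType.
Implicit Type phi : nat -> gT -> R.

Definition at_coset phi (c : nat * {set gT}) := phi c.1 (repr c.2).
Definition pvec Hs phi : 'cV[R]_(lrk (Plat Hs)) := \col_i at_coset phi (nth c0 (cs Hs) i).
(** A functional on the augmentation kernel is a function on X modulo constants; its coordinates are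
    its values on the basis e_(i+1) - e_0. *)
Definition jvec Hs phi : 'cV[R]_(lrk (Jlat G Hs)) :=
  \col_i (at_coset phi (nth c0 (cs Hs) i.+1) - at_coset phi (nth c0 (cs Hs) 0)).

Definition nth_col n (v : 'cV[R]_n) (i : nat) : R := oapp (fun o => v o 0) 0 (insub i).
Definition pfam Hs (v : 'cV[R]_(lrk (Plat Hs))) k g : R :=
  nth_col v (index (k, g *: grp Hs k)%g (cs Hs)).
(** The representative that vanishes at coset number 0. This normalization is not equivariant, so
    identities about it hold only up to an additive constant. *)
Definition jfam Hs (v : 'cV[R]_(lrk (Jlat G Hs))) k g : R :=
  if index (k, g *: grp Hs k)%g (cs Hs) is i.+1 then nth_col v i else 0.

Lemma nth_col_ord n (v : 'cV[R]_n) (i : 'I_n) : nth_col v i = v i 0.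
Proof. by rewrite /nth_col valK. Qed.

Lemma inv_pfam Hs v : inv_fam Hs (@pfam Hs v).
Proof. by move=> k ks g h Gg Hh; rewrite /pfam lcosetM lcoset_id. Qed.

Lemma inv_jfam Hs v : inv_fam Hs (@jfam Hs v).
Proof. by move=> k ks g h Gg Hh; rewrite /jfam lcosetM lcoset_id. Qed.

Lemma at_cosetE Hs phi k g : all_sub Hs -> inv_fam Hs phi -> (k < size Hs)%N -> g \in G ->
  at_coset phi (k, g *: grp Hs k)%g = phi k g.
Proof.
move=> sHs ok ks Gg; rewrite /at_coset /=.
have := mem_repr g (lcoset_refl (grp Hs k) g) => /lcosetP[h Hh ->].
exact: ok.
Qed.

Lemma eq_at_coset Hs phi psi i : all_sub Hs -> eq_fam Hs phi psi -> (i < size (cs Hs))%N ->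
  at_coset phi (nth c0 (cs Hs) i) = at_coset psi (nth c0 (cs Hs) i).
Proof.
move=> sHs e /(nth_coset_seq sHs)[k [x [ks Gx ex ec]]].
by rewrite /at_coset -ex ec /= e.
Qed.

Lemma eq_pvec Hs phi psi : all_sub Hs -> eq_fam Hs phi psi -> pvec Hs phi = pvec Hs psi.
Proof. by move=> sHs e; apply/matrixP=> i j; rewrite !mxE (eq_at_coset sHs e). Qed.

Lemma ltn_predS n i : (i < n.-1)%N -> (i.+1 < n)%N. Proof. lia. Qed.

Lemma eq_jvec Hs phi psi : all_sub Hs -> eq_fam Hs phi psi -> jvec Hs phi = jvec Hs psi.
Proof.
move=> sHs e; apply/matrixP=> i j; have ltiN := ltn_predS (ltn_ord i).
by rewrite !mxE !(eq_at_coset sHs e) // (leq_ltn_trans _ ltiN).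
Qed.

Lemma pvecK Hs v : all_sub Hs -> pvec Hs (@pfam Hs v) = v.
Proof.
move=> sHs; apply/matrixP=> i j; rewrite ord1 !mxE.
have [k [x [ks Gx ex ec]]] := nth_coset_seq sHs (ltn_ord i).
rewrite /at_coset -ex {1}ec /= /pfam -ec index_uniq ?coset_seq_uniq //.
by rewrite nth_col_ord.
Qed.

Lemma pfamK Hs phi : all_sub Hs -> inv_fam Hs phi -> eq_fam Hs (pfam (pvec Hs phi)) phi.
Proof.
move=> sHs ok k g ks Gg; rewrite /pfam; have := index_coset_seq ks Gg.
rewrite -index_mem => lti; rewrite -[index _ _]/(nat_of_ord (Ordinal lti)) nth_col_ord mxE.
by rewrite /= nth_index -?index_mem // (at_cosetE sHs).
Qed.

Lemma jvecK Hs v : all_sub Hs -> jvec Hs (@jfam Hs v) = v.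
Proof.
move=> sHs; apply/matrixP=> i j; rewrite ord1 !mxE; have ltiN := ltn_predS (ltn_ord i).
have [k [x [ks Gx ex ec]]] := nth_coset_seq sHs ltiN.
have [k' [x' [ks' Gx' ex' ec']]] := nth_coset_seq sHs (leq_ltn_trans (leq0n _) ltiN).
rewrite /at_coset -ex -ex' {1}ec {1}ec' /= /jfam -ec -ec' !index_uniq ?coset_seq_uniq //.
  by rewrite nth_col_ord subr0.
exact: leq_ltn_trans (leq0n _) ltiN.
Qed.

Lemma jfamK Hs phi : all_sub Hs -> inv_fam Hs phi ->
  eq_fam Hs (jfam (jvec Hs phi)) (fun k g => phi k g - at_coset phi (nth c0 (cs Hs) 0)).
Proof.
move=> sHs ok k g ks Gg; rewrite /jfam; have := index_coset_seq ks Gg => mc.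
rewrite -[phi k g](at_cosetE sHs ok ks Gg) -[in at_coset _ (k, _)](nth_index c0 mc).
move: mc; rewrite -index_mem; case: (index _ _) => [|i] lti; first by rewrite subrr.
have lti' : (i < (size (cs Hs)).-1)%N by case: (size _) lti.
by rewrite -[i in nth_col _ i]/(nat_of_ord (Ordinal lti')) nth_col_ord mxE.
Qed.

Lemma pentry_sum Hs g i (f : nat -> R) : all_sub Hs -> g \in G -> (i < size (cs Hs))%N ->
  \sum_(0 <= j < size (cs Hs)) (pentry G Hs g j i)%:~R * f j =
  f (index (coset_act g (nth c0 (cs Hs) i)) (cs Hs)).
Proof.
move=> sHs Gg lti; have [k [x [ks Gx ex ec]]] := nth_coset_seq sHs lti.
have mi : coset_act g (nth c0 (cs Hs) i) \in cs Hs.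
  by rewrite ec /coset_act /= -lcosetM index_coset_seq ?groupM.
rewrite (bigD1_seq (index (coset_act g (nth c0 (cs Hs) i)) (cs Hs))) ?iota_uniq //=; last first.
  by rewrite mem_index_iota index_mem.
rewrite /pentry nth_index // eqxx mul1r big_seq_cond big1 ?addr0 // => j.
rewrite mem_index_iota => /andP[ltj /negbTE nj]; case: eqP => [e|]; last by rewrite mul0r.
by rewrite -e index_uniq ?coset_seq_uniq ?eqxx in nj.
Qed.

Lemma pentryV Hs g i j : pentry G Hs g^-1%g i j = pentry G Hs g j i.
Proof.
rewrite /pentry; congr (_%:R); congr nat_of_bool.
case: (nth _ _ i) => k C; case: (nth _ _ j) => k' C'; rewrite /coset_act /= !xpair_eqE.
rewrite eq_sym; congr (_ && _); apply/eqP/eqP => ->.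
  by rewrite -lcosetM mulgV lcoset1.
by rewrite -lcosetM mulVg lcoset1.
Qed.

Lemma at_coset_act Hs phi g i : all_sub Hs -> inv_fam Hs phi -> g \in G ->
    (i < size (cs Hs))%N ->
  at_coset phi (nth c0 (cs Hs) (index (coset_act g^-1%g (nth c0 (cs Hs) i)) (cs Hs))) =
  at_coset (translate g phi) (nth c0 (cs Hs) i).
Proof.
move=> sHs ok Gg lti; have [k [x [ks Gx ex ec]]] := nth_coset_seq sHs lti.
rewrite {2}/at_coset -ex ec /coset_act /= -lcosetM nth_index; last first.
  by rewrite index_coset_seq ?groupM ?groupV.
by rewrite (at_cosetE sHs) ?groupM ?groupV.
Qed.

Lemma pvec_translate Hs phi g : all_sub Hs -> inv_fam Hs phi -> g \in G ->
  map_mx intr (lrep (Plat Hs) g) *m pvec Hs phi = pvec Hs (translate g phi).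
Proof.
move=> sHs ok Gg; apply/matrixP=> i j; rewrite ord1 !mxE -at_coset_act //.
rewrite -(pentry_sum (fun j => at_coset phi (nth c0 (cs Hs) j))) ?groupV //.
by rewrite big_mkord; apply: eq_bigr => l _; rewrite !mxE pentryV.
Qed.

Lemma jvec_translate Hs phi g : all_sub Hs -> inv_fam Hs phi -> g \in G ->
  map_mx intr (lrep (Jlat G Hs) g) *m jvec Hs phi = jvec Hs (translate g phi).
Proof.
move=> sHs ok Gg; apply/matrixP=> i j; rewrite ord1 !mxE {j}.
pose f j := at_coset phi (nth c0 (cs Hs) j) - at_coset phi (nth c0 (cs Hs) 0).
have ltiN := ltn_predS (ltn_ord i).
have N0 := leq_ltn_trans (leq0n _) ltiN.
(* Since [f] vanishes at coset 0, a sum over the other cosets is already the full permutation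
   sum. *)
have shift l : (l < size (cs Hs))%N ->
    \sum_(j < (size (cs Hs)).-1) (pentry G Hs g^-1%g j.+1 l)%:~R * f j.+1 =
    at_coset (translate g phi) (nth c0 (cs Hs) l) - at_coset phi (nth c0 (cs Hs) 0).
  move=> ltl; rewrite -at_coset_act // -[RHS]/(f (index _ _)).
  have := @pentry_sum Hs g^-1%g l f sHs; rewrite groupV => /(_ Gg ltl) <-.
  have f0 : f 0 = 0 by rewrite /f subrr.
  by rewrite big_ltn // f0 mulr0 add0r big_add1 big_mkord.
rewrite (eq_bigr (fun j : 'I_(size (cs Hs)).-1 =>
  (pentry G Hs g^-1%g j.+1 i.+1)%:~R * f j.+1 - (pentry G Hs g^-1%g j.+1 0)%:~R * f j.+1)).
  by rewrite sumrB !shift // opprB addrA subrK.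
by move=> l _; rewrite !mxE intrB mulrBl.
Qed.

End Coordinates.

Lemma map_intr_id m n (A : 'M[int]_(m, n)) : map_mx intr A = A.
Proof. by apply/matrixP=> i j; rewrite mxE intz. Qed.

Lemma jfamD Hs (u v : 'cV[int]_(lrk (Jlat G Hs))) k g :
  jfam (u + v) k g = jfam u k g + jfam v k g.
Proof.
rewrite /jfam; case: index => [|i]; rewrite ?addr0 // /nth_col.
by case: insub => [o|] /=; rewrite ?mxE ?addr0.
Qed.

Lemma pfamD Hs (u v : 'cV[int]_(lrk (Plat Hs))) k g :
  pfam (u + v) k g = pfam u k g + pfam v k g.
Proof. by rewrite /pfam /nth_col; case: insub => [o|] /=; rewrite ?mxE ?addr0. Qed.

Lemma pvecD Hs (phi psi : nat -> gT -> int) :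
  pvec Hs (fun k g => phi k g + psi k g) = pvec Hs phi + pvec Hs psi.
Proof. by apply/matrixP=> i j; rewrite !mxE. Qed.

Lemma jvecD Hs (phi psi : nat -> gT -> int) :
  jvec Hs (fun k g => phi k g + psi k g) = jvec Hs phi + jvec Hs psi.
Proof. by apply/matrixP=> i j; rewrite !mxE /at_coset; ring. Qed.

Lemma jvec_shift Hs (phi : nat -> gT -> int) c :
  jvec Hs (fun k g => phi k g - c) = jvec Hs phi.
Proof. by apply/matrixP=> i j; rewrite !mxE /at_coset; ring. Qed.

Lemma Plat_permutation Hs : all_sub Hs -> permutation_lattice G (Plat Hs).
Proof.
move=> sHs.
have hom v : {in G, forall g, lrep (Plat Hs) g *m v = pvec Hs (translate g (pfam v))}.
  by move=> g Gg; rewrite -pvec_translate // ?map_intr_id ?pvecK //; apply: inv_pfam.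
split; first split.
- apply: eq_mx_mulcV => v; rewrite hom // mul1mx -[RHS](pvecK v) //; apply: eq_pvec => // k g _ _.
  by rewrite /translate invg1 mul1g.
- move=> g h Gg Gh; apply: eq_mx_mulcV => v; rewrite -mulmxA !hom ?groupM //.
  apply: eq_pvec => // k x ks Gx; rewrite /translate pfamK // ?groupM ?groupV //.
    by rewrite /translate invMg mulgA.
  by apply: inv_fam_translate => //; apply: inv_pfam.
exists 1%:M; rewrite unitmx1; split=> // g Gg.
pose a (i : 'I_(size (cs Hs))) := index (coset_act g^-1%g (nth c0 (cs Hs) i)) (cs Hs).
have am (i : 'I_(size (cs Hs))) : coset_act g^-1%g (nth c0 (cs Hs) i) \in cs Hs.
  have [k [x [ks Gx _ ->]]] := nth_coset_seq sHs (ltn_ord i).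
  by rewrite /coset_act /= -lcosetM index_coset_seq ?groupM ?groupV.
have aP i : (a i < size (cs Hs))%N by rewrite index_mem am.
have aI : injective (fun i => Ordinal (aP i)).
  move=> i j [] /(congr1 (nth c0 (cs Hs))); rewrite !nth_index ?am // => e.
  have {}e : nth c0 (cs Hs) i = nth c0 (cs Hs) j.
    move: e; case: (nth _ _ i) => k C; case: (nth _ _ j) => k' C' [-> e]; congr (_, _).
    by rewrite -[C](lcoset1) -(mulgV g) lcosetM e -lcosetM mulgV lcoset1.
  by apply/val_inj/eqP; rewrite -(nth_uniq c0 _ _ (coset_seq_uniq Hs)) ?e ?ltn_ord //; apply: ltn_ord.
exists (perm aI); rewrite mulmx1 mul1mx; apply/matrixP=> i j; rewrite !mxE permE -pentryV /pentry.
congr (_%:R); congr nat_of_bool; rewrite -(inj_eq val_inj) /= eq_sym.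
by rewrite -(nth_uniq c0 _ _ (coset_seq_uniq Hs)) // ?aP // nth_index ?am.
Qed.

(* Linear combinations of right translations: these are the equivariant maps
   between spaces of functions on coset spaces. *)
Definition rcomb Hs (F : (nat -> gT -> int) -> gT -> int) :=
  exists t : seq (int * nat * gT),
    all (fun c => (c.1.2 < size Hs)%N && (c.2 \in G)) t /\
    forall phi g, F phi g = \sum_(c <- t) c.1.1 * phi c.1.2 (g * c.2)%g.

Lemma rcomb0 Hs : rcomb Hs (fun _ _ => 0).
Proof. by exists [::]; split=> // phi g; rewrite big_nil. Qed.

Lemma rcomb_atom Hs k x : (k < size Hs)%N -> x \in G ->
  rcomb Hs (fun phi g => phi k (g * x)%g).
Proof.
by move=> ks Gx; exists [:: (1, k, x)]; rewrite /= ks Gx; split=> // phi g; rewrite big_seq1 mul1r.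
Qed.

Lemma rcomb_id Hs k : (k < size Hs)%N -> rcomb Hs (fun phi g => phi k g).
Proof.
move=> ks; have [t [tv tE]] := rcomb_atom ks (group1 G).
by exists t; split=> // phi g; rewrite -tE mulg1.
Qed.

Lemma rcomb_add Hs F F' : rcomb Hs F -> rcomb Hs F' ->
  rcomb Hs (fun phi g => F phi g + F' phi g).
Proof.
move=> [t [tv tE]] [t' [tv' tE']]; exists (t ++ t'); rewrite all_cat tv tv'.
by split=> // phi g; rewrite big_cat tE tE'.
Qed.

Lemma rcomb_scale Hs c F : rcomb Hs F -> rcomb Hs (fun phi g => c * F phi g).
Proof.
move=> [t [tv tE]]; exists [seq (c * a.1.1, a.1.2, a.2) | a <- t]; rewrite all_map.
by split=> // phi g; rewrite big_map tE big_distrr; apply: eq_bigr => a _ /=; rewrite mulrA.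
Qed.

Lemma rcomb_opp Hs F : rcomb Hs F -> rcomb Hs (fun phi g => - F phi g).
Proof.
move=> /(rcomb_scale (-1))[t [tv tE]]; exists t; split=> // phi g.
by rewrite -tE mulN1r.
Qed.

Lemma rcomb_sum Hs (I : Type) (r : seq I) F : (forall i, rcomb Hs (F i)) ->
  rcomb Hs (fun phi g => \sum_(i <- r) F i phi g).
Proof.
move=> rF; elim: r => [|i r [t [tv tE]]].
  by have [t [tv tE]] := rcomb0 Hs; exists t; split=> // phi g; rewrite big_nil -tE.
have [t' [tv' tE']] := rcomb_add (rF i) (ex_intro _ t (conj tv tE)).
by exists t'; split=> // phi g; rewrite big_cons -tE'.
Qed.

Lemma rcombD Hs F : rcomb Hs F -> forall phi psi chi g,
  (forall k g, chi k g = phi k g + psi k g) -> F chi g = F phi g + F psi g.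
Proof.
move=> [t [_ tE]] phi psi chi g e; rewrite !tE -big_split; apply: eq_bigr => c _ /=.
by rewrite e mulrDr.
Qed.

Lemma rcomb_eq Hs F : rcomb Hs F -> forall phi psi g,
  g \in G -> eq_fam Hs phi psi -> F phi g = F psi g.
Proof.
move=> [t [tv tE]] phi psi g Gg e; rewrite !tE big_seq [RHS]big_seq.
by apply: eq_bigr => c /(allP tv)/andP[ck cG]; rewrite e ?groupM.
Qed.

Lemma rcomb_translate Hs F : rcomb Hs F -> forall phi g x,
  F (translate g phi) x = F phi (g^-1 * x)%g.
Proof. by move=> [t [_ tE]] phi g x; rewrite !tE /translate; under eq_bigr do rewrite mulgA. Qed.

Lemma rcomb_const Hs F : rcomb Hs F -> forall c g,
  F (fun _ _ => c) g = c * F (fun _ _ => 1) 1%g.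
Proof.
move=> [t [_ tE]] c g; rewrite !tE big_distrr; apply: eq_bigr => a _ /=.
by rewrite mulr1 mulrC.
Qed.

Lemma rcomb_shift Hs F : rcomb Hs F -> forall phi c g,
  F (fun k x => phi k x - c) g = F phi g - c * F (fun _ _ => 1) 1%g.
Proof.
move=> rF phi c g; rewrite -(rcomb_const rF c g).
have -> := @rcombD _ _ rF (fun k x => phi k x - c) (fun _ _ => c) phi g.
  by rewrite addrK.
by move=> k x; rewrite subrK.
Qed.

Definition apply_ops (T : nat -> (nat -> gT -> int) -> gT -> int) phi l g := T l phi g.
(** The first clause gives linearity and equivariance, the second that the results descend to the
    cosets in [Rs]. The value of [T l] on the constant function 1 is its augmentation. *)
Definition ops Hs Rs T :=
  (forall l, (l < size Rs)%N -> rcomb Hs (T l)) /\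
  (forall phi, inv_fam Hs phi -> inv_fam Rs (apply_ops T phi)).

Lemma eq_fam_sub_const Hs T Rs phi c : ops Hs Rs T ->
  (forall l, (l < size Rs)%N -> T l (fun _ _ => 1) 1%g = 0) ->
  eq_fam Rs (apply_ops T (fun k x => phi k x - c)) (apply_ops T phi).
Proof.
by move=> [rT _] T1 l g ls Gg; rewrite /apply_ops (rcomb_shift (rT l ls)) T1 // mulr0 subr0.
Qed.

Lemma Ghom_fun (L M : lattice gT) (A : 'M_(lrk M, lrk L)) :
  (forall x : 'cV_(lrk L), {in G, forall g, A *m (lrep L g *m x) = lrep M g *m (A *m x)}) -> Ghom G A.
Proof. by move=> h g Gg; apply: eq_mx_mulcV => x; rewrite -!mulmxA h. Qed.

(** As every [T l] kills the constants, [T] descends to J, where representatives are fixed only up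
    to a constant. Exactness can then be tested on right-invariant functions on G instead of
    matrices. *)
Lemma quasi_permutation_Jlat Hs Rs Fs T S :
    Hs != [::] -> all_sub Hs -> all_sub Rs -> all_sub Fs ->
    ops Hs Rs T -> ops Rs Fs S ->
    (forall l, (l < size Rs)%N -> T l (fun _ _ => 1) 1%g = 0) ->
    (forall phi, inv_fam Hs phi -> eq_fam Rs (apply_ops T phi) (fun _ _ => 0) ->
       exists c, eq_fam Hs phi (fun _ _ => c)) ->
    (forall phi, inv_fam Hs phi -> eq_fam Fs (apply_ops S (apply_ops T phi)) (fun _ _ => 0)) ->
    (forall psi, inv_fam Rs psi -> eq_fam Fs (apply_ops S psi) (fun _ _ => 0) ->
       exists2 phi, inv_fam Hs phi & eq_fam Rs psi (apply_ops T phi)) ->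
    (forall chi, inv_fam Fs chi ->
       exists2 psi, inv_fam Rs psi & eq_fam Fs chi (apply_ops S psi)) ->
  quasi_permutation G (Jlat G Hs).
Proof.
move=> Hs0 sHs sRs sFs oT oS T1 Tinj ST Tex Ssurj.
have [rT iT] := oT; have [rS iS] := oS.
have [A AE] : exists A : 'M[int]_(lrk (Plat Rs), lrk (Jlat G Hs)),
    forall x : 'cV_(lrk (Jlat G Hs)), A *m x = pvec Rs (apply_ops T (jfam x)).
  apply: mx_of_additive => x y; rewrite -pvecD; apply: eq_pvec => // l g ls Gg.
  by apply: (rcombD (rT l ls)) => k h; rewrite jfamD.
have [B BE] : exists B : 'M[int]_(lrk (Plat Fs), lrk (Plat Rs)),
    forall x : 'cV_(lrk (Plat Rs)), B *m x = pvec Fs (apply_ops S (pfam x)).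
  apply: mx_of_additive => x y; rewrite -pvecD; apply: eq_pvec => // l g ls Gg.
  by apply: (rcombD (rS l ls)) => k h; rewrite pfamD.
have Ajvec phi : inv_fam Hs phi -> A *m jvec Hs phi = pvec Rs (apply_ops T phi).
  move=> ok; rewrite AE; apply: eq_pvec => // l g ls Gg.
  rewrite -(eq_fam_sub_const phi (at_coset phi (nth c0 (cs Hs) 0)) oT T1 ls Gg).
  by apply: (rcomb_eq (rT l ls)) => //; apply: jfamK.
have Bpvec psi : inv_fam Rs psi -> B *m pvec Rs psi = pvec Fs (apply_ops S psi).
  move=> ok; rewrite BE; apply: eq_pvec => // l g ls Gg.
  by apply: (rcomb_eq (rS l ls)) => //; apply: pfamK.
have iJ := @inv_jfam int Hs; have iP := @inv_pfam int.
exists (Plat Rs), (Plat Fs), A, B; split; try exact: Plat_permutation.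
- apply: Ghom_fun => x g Gg; rewrite -{1}[x]jvecK // -[lrep _ g in LHS]map_intr_id.
  rewrite jvec_translate // Ajvec; last exact: inv_fam_translate.
  rewrite AE -[lrep _ g in RHS]map_intr_id pvec_translate //; last exact: iT.
  by apply: eq_pvec => // l y ls Gy; rewrite /apply_ops (rcomb_translate (rT l ls)).
- apply: Ghom_fun => x g Gg; rewrite -{1}[x]pvecK // -[lrep _ g in LHS]map_intr_id.
  rewrite pvec_translate // Bpvec; last by apply: inv_fam_translate => //; apply: iP.
  rewrite BE -[lrep _ g in RHS]map_intr_id pvec_translate //; last exact/iS/iP.
  by apply: eq_pvec => // l y ls Gy; rewrite /apply_ops (rcomb_translate (rS l ls)).
split.
- move=> x Ax; have [|c cE] := Tinj (jfam x) (iJ x).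
    move=> l g ls Gg; rewrite -(pfamK sRs (iT _ (iJ x)) ls Gg) -AE Ax.
    by rewrite /pfam /nth_col; case: insub => //= o; rewrite mxE.
  rewrite -(jvecK x sHs) (eq_jvec sHs cE); apply/matrixP=> i j.
  by rewrite !mxE /at_coset subrr.
- move=> y; have [psi ok e] := Ssurj (pfam y) (iP _ y).
  by exists (pvec Rs psi); rewrite Bpvec // -(eq_pvec sFs e) pvecK.
- apply: eq_mx_mulcV => x; rewrite -mulmxA AE Bpvec; last exact: iT.
  rewrite mul0mx (eq_pvec sFs (ST _ (iJ x))); apply/matrixP=> i j.
  by rewrite !mxE /at_coset.
- move=> x Bx; have [|phi ok e] := Tex (pfam x) (iP _ x).
    move=> l g ls Gg; rewrite -(pfamK sFs (iS _ (iP _ x)) ls Gg) -BE Bx.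
    by rewrite /pfam /nth_col; case: insub => //= o; rewrite mxE.
  by exists (jvec Hs phi); rewrite Ajvec // -(eq_pvec sRs e) pvecK.
Qed.

Lemma lsum_mul_col (L M : lattice gT) g (u : 'cV_(lrk L)) (v : 'cV_(lrk M)) :
  lrep (lsum L M) g *m col_mx u v = col_mx (lrep L g *m u) (lrep M g *m v).
Proof. by rewrite /= mul_block_col !mul0mx addr0 add0r. Qed.

(** * Similarity from equivariant maps of augmentation 1 in both directions *)

Section Similarity.
Variables (Hs Rs : seq {group gT}) (T S : nat -> (nat -> gT -> int) -> gT -> int).
Hypotheses (sHs : all_sub Hs) (sRs : all_sub Rs).
Hypotheses (oT : ops Hs Rs T) (oS : ops Rs Hs S).
Hypothesis T1 : forall l, (l < size Rs)%N -> T l (fun _ _ => 1) 1%g = 1.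
Hypothesis S1 : forall l, (l < size Hs)%N -> S l (fun _ _ => 1) 1%g = 1.

(** The pair of [jfam x] and [mid x y] is a function on the union of the two coset spaces, [y] being
    the deviation of its second half from [T x]. A constant added to the representative of [x] moves
    [mid] by the same constant, as T 1 = 1, and leaves [compl] unchanged, as S 1 = 1. *)
Let mid (x : 'cV[int]_(lrk (Jlat G Hs))) (y : 'cV[int]_(lrk (Plat Rs))) k g :=
  pfam y k g + T k (jfam x) g.
Let compl x y k g := jfam x k g - S k (mid x y) g.

Lemma inv_mid x y : inv_fam Rs (mid x y).
Proof.
move=> k ks g h Gg Hh; rewrite /mid (@inv_pfam int Rs y) //.
by have := (oT.2 _ (inv_jfam x)) k ks g h Gg Hh; rewrite /apply_ops => ->.
Qed.

Lemma inv_compl x y : inv_fam Hs (compl x y).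
Proof.
move=> k ks g h Gg Hh; rewrite /compl (inv_jfam x) //.
by have := (oS.2 _ (inv_mid x y)) k ks g h Gg Hh; rewrite /apply_ops => ->.
Qed.

Lemma similar_mx : exists A : 'M[int]_(lrk (lsum (Jlat G Rs) (Plat Hs)),
                                     lrk (lsum (Jlat G Hs) (Plat Rs))),
  Ghom G A /\
  forall (x : 'cV_(lrk (Jlat G Hs))) (y : 'cV_(lrk (Plat Rs))),
    A *m col_mx x y = col_mx (jvec Rs (mid x y)) (pvec Hs (compl x y)).
Proof.
have midD x y x' y' k g : (k < size Rs)%N ->
    mid (x + x') (y + y') k g = mid x y k g + mid x' y' k g.
  move=> ks; rewrite /mid pfamD.
  have -> := rcombD (oT.1 k ks) g (fun k h => jfamD x x' k h).
  ring.
have complD x y x' y' k g : (k < size Hs)%N -> g \in G ->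
    compl (x + x') (y + y') k g = compl x y k g + compl x' y' k g.
  move=> ks Gg; rewrite /compl jfamD.
  have -> : S k (mid (x + x') (y + y')) g = S k (fun k g => mid x y k g + mid x' y' k g) g.
    by apply: (rcomb_eq (oS.1 k ks)) => // l h ls Gh; rewrite midD.
  rewrite (@rcombD _ _ (oS.1 k ks) (mid x y) (mid x' y')) //; ring.
have [A AE] : exists A : 'M[int]_(lrk (lsum (Jlat G Rs) (Plat Hs)),
                                     lrk (lsum (Jlat G Hs) (Plat Rs))),
    forall z, A *m z = col_mx (jvec Rs (mid (usubmx z) (dsubmx z)))
                              (pvec Hs (compl (usubmx z) (dsubmx z))).
  apply: mx_of_additive => z z'; rewrite add_col_mx -jvecD -pvecD !linearD.
  congr col_mx; first by apply: eq_jvec => // k g ks Gg; rewrite midD.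
  by apply: eq_pvec => // k g ks Gg; rewrite complD.
exists A; split; last by move=> x y; rewrite AE col_mxKu col_mxKd.
apply: Ghom_fun => z g Gg; pose x := usubmx z; pose y := dsubmx z.
have zE : lrep (lsum (Jlat G Hs) (Plat Rs)) g *m z =
    col_mx (lrep (Jlat G Hs) g *m x) (lrep (Plat Rs) g *m y).
  by rewrite -lsum_mul_col vsubmxK.
rewrite !AE lsum_mul_col zE !col_mxKu !col_mxKd -/x -/y.
have [c cE] : exists c, eq_fam Hs (jfam (lrep (Jlat G Hs) g *m x))
    (fun k h => translate g (jfam x) k h - c).
  exists (at_coset (translate g (jfam x)) (nth c0 (cs Hs) 0)).
  rewrite -{1}[x]jvecK // -[lrep _ g]map_intr_id jvec_translate //; last exact: inv_jfam.
  by apply: jfamK => //; apply: inv_fam_translate => //; apply: inv_jfam.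
have yE : eq_fam Rs (pfam (lrep (Plat Rs) g *m y)) (translate g (pfam y)).
  rewrite -{1}[y]pvecK // -[lrep _ g]map_intr_id pvec_translate //; last exact: inv_pfam.
  by apply: pfamK => //; apply: inv_fam_translate => //; apply: inv_pfam.
have midE : eq_fam Rs (mid (lrep (Jlat G Hs) g *m x) (lrep (Plat Rs) g *m y))
    (fun k h => translate g (mid x y) k h - c).
  move=> k h ks Gh; rewrite /mid yE // (rcomb_eq (oT.1 k ks) Gh cE).
  rewrite (rcomb_shift (oT.1 k ks)) T1 // mulr1 (rcomb_translate (oT.1 k ks)).
  by rewrite /translate addrA.
rewrite -[lrep (Jlat G Rs) g]map_intr_id jvec_translate //; last exact: inv_mid.
have := @pvec_translate int Hs _ g sHs (inv_compl x y) Gg; rewrite map_intr_id => ->.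
congr col_mx; first by rewrite (eq_jvec sRs midE) jvec_shift.
apply: eq_pvec => // k h ks Gh; rewrite /compl cE // (rcomb_eq (oS.1 k ks) Gh midE).
rewrite (rcomb_shift (oS.1 k ks)) S1 // mulr1 (rcomb_translate (oS.1 k ks)) /translate.
ring.
Qed.

End Similarity.

(** Both matrices describe the same function on the union, read from either end; after one round
    trip it has changed only by the constant [c]. *)
Lemma similarK Hs Rs T S : all_sub Hs -> all_sub Rs -> ops Hs Rs T -> ops Rs Hs S ->
    (forall l, (l < size Rs)%N -> T l (fun _ _ => 1) 1%g = 1) ->
    (forall l, (l < size Hs)%N -> S l (fun _ _ => 1) 1%g = 1) ->
  forall (A : 'M_(lrk (Jlat G Rs) + lrk (Plat Hs), lrk (Jlat G Hs) + lrk (Plat Rs)))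
    (B : 'M_(lrk (Jlat G Hs) + lrk (Plat Rs), lrk (Jlat G Rs) + lrk (Plat Hs))),
    (forall (x : 'cV_(lrk (Jlat G Hs))) (y : 'cV_(lrk (Plat Rs))),
     A *m col_mx x y = col_mx (jvec Rs (fun k g => pfam y k g + T k (jfam x) g))
       (pvec Hs (fun k g => jfam x k g - S k (fun k g => pfam y k g + T k (jfam x) g) g))) ->
    (forall (x : 'cV_(lrk (Jlat G Rs))) (y : 'cV_(lrk (Plat Hs))),
     B *m col_mx x y = col_mx (jvec Hs (fun k g => pfam y k g + S k (jfam x) g))
       (pvec Rs (fun k g => jfam x k g - T k (fun k g => pfam y k g + S k (jfam x) g) g))) ->
  B *m A = 1%:M.
Proof.
move=> sHs sRs oT oS T1 S1 A B AE BE; apply: eq_mx_mulcV => z.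
rewrite -[z]vsubmxK -mulmxA AE BE mul1mx; set x := usubmx z; set y := dsubmx z.
pose m k g := pfam y k g + T k (jfam x) g.
pose c := at_coset m (nth c0 (cs Rs) 0).
have im : inv_fam Rs m := inv_mid oT x y.
have mE : eq_fam Rs (jfam (jvec Rs m)) (fun k g => m k g - c) by apply: jfamK.
pose w k g := jfam x k g - S k m g.
have wE : eq_fam Hs (pfam (pvec Hs w)) w by apply: pfamK => //; apply: (inv_compl oT oS x y).
have nE : eq_fam Hs (fun k g => pfam (pvec Hs w) k g + S k (jfam (jvec Rs m)) g)
                    (fun k g => jfam x k g - c).
  move=> k g ks Gg; rewrite wE // (rcomb_eq (oS.1 k ks) Gg mE).
  by rewrite (rcomb_shift (oS.1 k ks)) S1 // mulr1 /w addrA subrK.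
congr col_mx; first by rewrite (eq_jvec sHs nE) jvec_shift jvecK.
rewrite -[RHS](pvecK y) //; apply: eq_pvec => // k g ks Gg.
rewrite mE // (rcomb_eq (oT.1 k ks) Gg nE) (rcomb_shift (oT.1 k ks)) T1 // mulr1 /m.
ring.
Qed.

(* The lattice attached to the disjoint union of the two coset spaces splits off
   the functions on either of them. *)
Lemma similar_Jlat Hs Rs T S : all_sub Hs -> all_sub Rs -> ops Hs Rs T -> ops Rs Hs S ->
    (forall l, (l < size Rs)%N -> T l (fun _ _ => 1) 1%g = 1) ->
    (forall l, (l < size Hs)%N -> S l (fun _ _ => 1) 1%g = 1) ->
  lat_similar G (Jlat G Hs) (Jlat G Rs).
Proof.
move=> sHs sRs oT oS T1 S1; exists (Plat Rs), (Plat Hs).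
split; try exact: Plat_permutation.
have [A [hA AE]] := similar_mx sHs sRs oT oS T1 S1.
have [B [_ BE]] := similar_mx sRs sHs oS oT S1 T1.
exists A, B; split=> //.
  exact: (similarK sRs sHs oS oT S1 T1 BE AE).
exact: (similarK sHs sRs oT oS T1 S1 AE BE).
Qed.

End CosetLattices.

(** * Periodic functions on Z and potentials *)

Section PeriodicFunctions.
Local Open Scope ring_scope.

Definition periodic (T : Type) (m : nat) (f : int -> T) := forall i, f (i + m%:Z) = f i.
Definition psum (m : nat) (f : int -> int) := \sum_(k < m) f k%:Z.

Lemma periodic_sub (T : Type) m (f : int -> T) : periodic m f -> forall i, f (i - m%:Z) = f i.
Proof. by move=> pf i; rewrite -pf subrK. Qed.

Lemma periodicM (T : Type) m (f : int -> T) : periodic m f ->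
  forall i (q : int), f (i + q * m%:Z) = f i.
Proof.
move=> pf i; elim/int_rec => [|q IH|q IH]; first by rewrite mul0r addr0.
  by rewrite -[RHS]IH -[RHS]pf; congr f; lia.
by rewrite -[RHS]IH -[LHS]pf; congr f; lia.
Qed.

Lemma periodic_dvd (T : Type) m n (f : int -> T) : (m %| n)%N -> periodic m f -> periodic n f.
Proof. by move=> /dvdnP[q ->] pf i; rewrite PoszM periodicM. Qed.

Lemma periodic_modz (T : Type) m (f : int -> T) : periodic m f ->
  forall i, f (i %% m%:Z)%Z = f i.
Proof. by move=> pf i; rewrite {2}(divz_eq i m) addrC periodicM. Qed.

Lemma eq_psum m f g : f =1 g -> psum m f = psum m g.
Proof. by move=> e; apply: eq_bigr => k _. Qed.

Lemma psumD m f g : psum m (fun i => f i + g i) = psum m f + psum m g.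
Proof. exact: big_split. Qed.

Lemma psumN m f : psum m (fun i => - f i) = - psum m f.
Proof. exact: sumrN. Qed.

Lemma psumC m c : psum m (fun=> c) = m%:Z * c.
Proof. by rewrite /psum sumr_const card_ord -mulr_natl natz. Qed.

Lemma psum_shift1 m f : periodic m f -> psum m (fun i => f (i + 1)) = psum m f.
Proof.
case: m => [|m] pf; rewrite /psum; first by rewrite !big_ord0.
rewrite [LHS]big_ord_recr [RHS]big_ord_recl [LHS]addrC /=; congr (_ + _).
  by rewrite -[RHS]pf; congr f; lia.
by apply: eq_bigr => i _; congr f; rewrite /= /bump /=; lia.
Qed.

Lemma psum_shift m f a : periodic m f -> psum m (fun i => f (a + i)) = psum m f.
Proof.
move=> pf.
have pa b : periodic m (fun i => f (b + i)) by move=> i; rewrite addrA pf.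
elim/int_rec: a => [|q IH|q IH].
- by apply: eq_psum => i; rewrite add0r.
- by rewrite -IH -[RHS]psum_shift1 //; apply: eq_psum => i; congr f; lia.
- by rewrite -IH -[LHS]psum_shift1 //; apply: eq_psum => i; congr f; lia.
Qed.

Lemma psum_reflect m f a : periodic m f -> psum m (fun i => f (a - i)) = psum m f.
Proof.
move=> pf; rewrite /psum (reindex_inj rev_ord_inj) /= -/(psum m f).
rewrite -(psum_shift (a - m%:Z + 1) pf); apply: eq_bigr => i _; congr f.
by rewrite -subzn //; lia.
Qed.

Lemma antiderivative m (d : int -> int) : (0 < m)%N -> periodic m d -> psum m d = 0 ->
  exists2 P : int -> int, periodic m P & forall i, P (i + 1) = P i + d i.
Proof.
move=> m0 pd d0; pose P (i : int) := \sum_(k < `|(i %% m)%Z|%N) d k%:Z.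
exists P => [i|i]; first by rewrite /P modzDr.
have mz : m%:Z != 0 by lia.
pose r := `|(i %% m)%Z|%N.
have rE : (i %% m)%Z = r%:Z by rewrite /r gez0_abs // modz_ge0.
have ltrm : (r < m)%N by have := ltz_pmod i (_ : 0 < m%:Z); lia.
have -> : d i = d r%:Z by rewrite -rE periodic_modz.
have e1 : ((i + 1) %% m)%Z = ((r + 1)%N%:Z %% m)%Z by rewrite -modzDml rE PoszD.
have -> : P i = \sum_(k < r) d k%:Z by [].
rewrite /P e1; have [e|ne] := eqVneq (r + 1)%N m.
  rewrite e modzz big_ord0; have : psum (r + 1) d = 0 by rewrite e.
  by rewrite /psum addn1 big_ord_recr /= => ->.
by rewrite modz_small ?addn1 ?big_ord_recr //; lia.
Qed.

(* The generators t and s t of order two present G, so a 1-cochain on them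
   integrates as soon as it respects the relations t^2, (st)^2 and the rotation. *)
Lemma potential m (E0 E1 : int -> bool -> int) : (0 < m)%N ->
    (forall b, periodic m (E0^~ b)) -> (forall b, periodic m (E1^~ b)) ->
    (forall i, E0 i true = - E0 i false) -> (forall i, E1 (i + 1) true = - E1 i false) ->
    psum m (E0^~ false) + psum m (E1^~ true) = 0 ->
  exists P : int -> bool -> int, [/\ forall b, periodic m (P^~ b),
    forall i, P i true = P i false + E0 i false &
    forall i, P (i + 1) true = P i false + E1 i false].
Proof.
move=> m0 p0 p1 a0 a1 loop.
(* The increment of the potential along one rotation step: forward along the edge of s t, then back
   along the edge of t. *)
pose d i := E1 i false - E0 (i + 1) false.
have pd : periodic m d by move=> i; rewrite /d p1 addrAC p0.
have d0 : psum m d = 0.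
  rewrite psumD psumN (psum_shift1 (p0 false)); move: loop.
  rewrite -(psum_shift1 (p1 true)) (eq_psum _ a1) psumN; lia.
have [Q pQ QE] := antiderivative m0 pd d0.
exists (fun i b => if b then Q i + E0 i false else Q i); split=> //.
  by case=> i; rewrite ?pQ ?p0.
by move=> i; rewrite QE /d; ring.
Qed.

End PeriodicFunctions.

(** * Coordinates on the dihedral group and its subgroups *)

Section Dihedral.
Local Open Scope ring_scope.
Variable gT : finGroupType.

Definition dihedral (G : {group gT}) (n : nat) (s t : gT) :=
  [/\ (0 < n)%N, G :=: <<[set s; t]>>%g, #|G| = (2 * n)%N &
   [/\ (s ^+ n = 1)%g, (t ^+ 2 = 1)%g & (t * s * t^-1 = s^-1)%g]].

Section Coordinates.
Variables (G : {group gT}) (n : nat) (s t : gT).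
Hypothesis D : dihedral G n s t.

Let n0 : (0 < n)%N. Proof. by case: D. Qed.
Let sn : (s ^+ n = 1)%g. Proof. by case: D => _ _ _ []. Qed.
Let tt : (t * t = 1)%g. Proof. by case: D => _ _ _ []. Qed.
Let ts : (t * s = s^-1 * t)%g.
Proof. by case: D => _ _ _ [_ _ <-]; rewrite mulgKV. Qed.

(** Integer exponents, reduced modulo n, turn computations in G into ring identities on
    exponents. *)
Definition sg (i : int) (b : bool) : gT := (s ^+ `|(i %% n)%Z|%N * t ^+ b)%g.

Lemma sgE i b (k : nat) : (i = k%:Z %[mod n])%Z -> sg i b = (s ^+ k * t ^+ b)%g.
Proof.
move=> e; congr (_ * _)%g; rewrite e modz_nat absz_nat.
by rewrite expg_mod.
Qed.

Lemma sg_nat (k : nat) b : sg k%:Z b = (s ^+ k * t ^+ b)%g.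
Proof. exact: sgE. Qed.

Lemma int_mod_nat (i : int) : exists k : nat, (i = k%:Z %[mod n])%Z.
Proof.
by exists `|(i %% n)%Z|%N; rewrite gez0_abs ?modz_mod // modz_ge0 //; lia.
Qed.

Lemma tsX k : (t * s ^+ k = s ^- k * t)%g.
Proof.
elim: k => [|k IH]; first by rewrite invg1 mulg1 mul1g.
by rewrite expgSr mulgA IH -mulgA ts mulgA -invMg -expgS -expgSr.
Qed.

Lemma sgM i b j c : (sg i b * sg j c)%g = sg (i + (if b then - j else j)) (b (+) c).
Proof.
have [k ek] := int_mod_nat i; have [l el] := int_mod_nat j.
rewrite (sgE b ek) (sgE c el); case: b => /=.
  (* The exponent -l is represented by the natural number n * l - l. *)
  have e : (i - j = (k + (n * l - l))%N%:Z %[mod n])%Z.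
    apply/eqP; rewrite PoszD -subzn ?leq_pmull // PoszM eqz_mod_dvd.
    have -> : i - j - (k%:Z + (n%:Z * l%:Z - l%:Z)) = (i - k%:Z) - (j - l%:Z) - l%:Z * n%:Z.
      by ring.
    apply: rpredB; last exact: dvdz_mull.
    by apply: rpredB; rewrite -eqz_mod_dvd; apply/eqP.
  rewrite (sgE _ e) expg1 mulgA -(mulgA _ t) tsX mulgA -mulgA; congr (_ * _)%g; last first.
    by case: c; rewrite ?expg0 ?expg1 ?mulg1.
  rewrite expgD; congr (_ * _)%g; apply: (mulIg (s ^+ l)%g); rewrite mulVg -expgD subnK ?leq_pmull //.
  by rewrite mulnC expgM expgAC sn expg1n.
have e : (i + j = (k + l)%N%:Z %[mod n])%Z by rewrite -modzDml ek modzDml -modzDmr el modzDmr PoszD.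
by rewrite (sgE _ e) expg0 mulg1 expgD mulgA.
Qed.

Lemma sg1 : sg 0 false = 1%g.
Proof. by rewrite -[0]/(0%N%:Z) sg_nat mulg1. Qed.

Lemma sg_per b : periodic n (sg^~ b).
Proof. by move=> i; rewrite /sg modzDr. Qed.

Lemma sgin i b : sg i b \in G.
Proof.
case: D => _ GE _ _; rewrite GE groupM ?groupX // mem_gen // !inE eqxx ?orbT //.
Qed.

Lemma sg_surj g : g \in G -> exists i b, g = sg i b.
Proof.
pose A := [set sg x.1%:Z x.2 | x : 'I_n * bool].
have AP g' : reflect (exists i b, g' = sg i b) (g' \in A).
  apply: (iffP imsetP) => [[[i b] _ ->]|[i [b ->]]]; first by exists i%:Z, b.
  have [k ek] := int_mod_nat i.
  exists (Ordinal (ltn_pmod k n0), b); rewrite // (sgE b ek).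
  by rewrite sg_nat /= expg_mod.
have gA : group_set A.
  apply/group_setP; split; first by apply/AP; exists 0, false; rewrite sg1.
  by move=> x y /AP[i [b ->]] /AP[j [c ->]]; apply/AP; rewrite sgM; do 2 eexists.
case: D => _ GE _ _ Gg; apply/AP; suff: G \subset Group gA by move/subsetP; apply.
rewrite GE gen_subG; apply/subsetP=> x; rewrite !inE => /orP[]/eqP->; apply/AP.
  by exists 1%N%:Z, false; rewrite sg_nat mulg1 expg1.
by exists 0%N%:Z, true; rewrite sg_nat mul1g.
Qed.

Lemma sg_inj i b j c : sg i b = sg j c -> (i = j %[mod n])%Z /\ b = c.
Proof.
move=> e; pose f (x : 'I_n * bool) := sg x.1%:Z x.2.
have fE (i' : int) b' : exists2 x, f x = sg i' b' & (x.1%:Z = i' %[mod n])%Z /\ x.2 = b'.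
  have [k ek] := int_mod_nat i'; exists (Ordinal (ltn_pmod k n0), b').
    by rewrite /f (sgE b' ek) sg_nat /= expg_mod.
  by rewrite /= ek modz_nat modn_mod -modz_nat.
(* The map from n * 2 pairs reaches all of a group of order 2n, so it is injective. *)
have inj : injective f.
  suff: {in setT &, injective f} by move=> H x y; apply: H; rewrite inE.
  apply/imset_injP; rewrite eqn_leq leq_imset_card /= cardsT card_prod card_ord card_bool mulnC.
  case: D => _ _ <- _; apply/subset_leq_card/subsetP=> g /sg_surj[i' [b' ->]].
  by have [x <- _] := fE i' b'; apply: imset_f; rewrite inE.
have [x fx [<- <-]] := fE i b; have [y fy [<- <-]] := fE j c.
by have -> : x = y by apply: inj; rewrite fx fy.
Qed.

Definition of_coord (T : Type) (u : int -> bool -> T) (g : gT) : T :=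
  let x := odflt (0%N%:Z, false) (omap (fun x : 'I_n * bool => (x.1%:Z, x.2))
             [pick x : 'I_n * bool | g == sg x.1%:Z x.2]) in u x.1 x.2.

Lemma of_coordE (T : Type) (u : int -> bool -> T) i b :
  (forall b, periodic n (u^~ b)) -> of_coord u (sg i b) = u i b.
Proof.
move=> pu; rewrite /of_coord; case: pickP => [[k c] /eqP/sg_inj[e ->]|].
  by rewrite /= -[RHS](periodic_modz (pu c)) e (periodic_modz (pu c)).
have [k ek] := int_mod_nat i => /(_ (Ordinal (ltn_pmod k n0), b)).
by rewrite (sgE b ek) sg_nat /= expg_mod // eqxx.
Qed.

Definition Cm (m : nat) : {group gT} := <[(s ^+ m)%g]>%G.
Definition Dm (m j : nat) : {group gT} := <<[set (s ^+ m)%g; (s ^+ j * t)%g]>>%G.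

Lemma sgX (k : nat) : (s ^+ k)%g = sg k%:Z false.
Proof. by rewrite sg_nat mulg1. Qed.

Lemma sgXt (k : nat) : (s ^+ k * t)%g = sg k%:Z true.
Proof. by rewrite sg_nat expg1. Qed.

Lemma CmG m : Cm m \subset G.
Proof. by rewrite cycle_subG sgX sgin. Qed.

Lemma DmG m j : Dm m j \subset G.
Proof.
by rewrite gen_subG; apply/subsetP=> x; rewrite !inE => /orP[]/eqP->; rewrite ?sgXt ?sgX sgin.
Qed.

Lemma right_inv_gen (T : eqType) (f : gT -> T) (A : {set gT}) :
  A \subset G -> right_inv G f A -> right_inv G f <<A>>%g.
Proof.
move=> sAG fA; pose K := [set h in G | [forall g in G, f (g * h)%g == f g]].
have KP h : reflect (h \in G /\ forall g, g \in G -> f (g * h)%g = f g) (h \in K).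
  rewrite inE; apply: (iffP andP) => -[Gh H]; split=> //.
    by move=> g Gg; apply/eqP; move/forall_inP: H; apply.
  by apply/forall_inP=> g Gg; rewrite H.
have gK : group_set K.
  apply/group_setP; split; first by apply/KP; split=> // g _; rewrite mulg1.
  move=> x y /KP[Gx Kx] /KP[Gy Ky]; apply/KP; split; first exact: groupM.
  by move=> g Gg; rewrite mulgA Ky ?groupM // Kx.
have sAK : <<A>>%g \subset Group gK.
  rewrite gen_subG; apply/subsetP=> h Ah; apply/KP; split; first exact: (subsetP sAG).
  by move=> g Gg; apply: fA.
by move=> g h Gg /(subsetP sAK)/KP[_]; apply.
Qed.

Lemma right_inv_Cm (T : eqType) (f : gT -> T) m :
  right_inv G f (Cm m) <-> forall b, periodic m (fun i => f (sg i b)).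
Proof.
split=> [iv b i|pf].
  have mC : (s ^+ m)%g \in Cm m by rewrite cycle_id.
  case: b; last by rewrite -(iv (sg i false) _ (sgin _ _) mC) sgX sgM.
  by rewrite -(iv _ _ (sgin (i + m%:Z) true) mC) sgX sgM addrK.
apply: right_inv_gen; first by rewrite sub1set sgX sgin.
move=> g h /sg_surj[i [b ->]] /set1P->; rewrite sgX sgM addbF.
by case: b; rewrite ?pf // (periodic_sub (pf true)).
Qed.

(** Right multiplication by s^j t sends (i, false) to (i + j, true): an invariant function is
    determined by its values on the rotations. *)
Lemma right_inv_Dm (T : eqType) (f : gT -> T) m j :
  right_inv G f (Dm m j) <-> (forall b, periodic m (fun i => f (sg i b))) /\
    forall i, f (sg (i + j%:Z) true) = f (sg i false).
Proof.
split=> [iv|[pf fj]].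
  have m1 : (s ^+ m)%g \in Dm m j by rewrite mem_gen // !inE eqxx.
  have m2 : (s ^+ j * t)%g \in Dm m j by rewrite mem_gen // !inE eqxx orbT.
  split; last by move=> i; rewrite -[RHS](iv _ _ (sgin _ _) m2) sgXt sgM.
  apply/right_inv_Cm => g h Gg /cycleP[k ->]; apply: iv => //; exact: groupX.
apply: right_inv_gen.
  by apply/subsetP=> x; rewrite !inE => /orP[]/eqP->; rewrite ?sgXt ?sgX sgin.
move=> g h /sg_surj[i [b ->]]; rewrite !inE => /orP[]/eqP->; rewrite ?sgXt ?sgX sgM ?addbF.
  by case: b; rewrite ?pf // (periodic_sub (pf true)).
by case: b; rewrite /= ?fj // -fj subrK.
Qed.

Lemma right_inv_full (T : eqType) (f : gT -> T) :
  right_inv G f G <-> forall i b, f (sg i b) = f 1%g.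
Proof.
split=> [iv i b|fc].
  by rewrite -[sg i b]mul1g iv ?sgin.
by move=> g h /sg_surj[i [b ->]] /sg_surj[j [c ->]]; rewrite sgM !fc.
Qed.

End Coordinates.
End Dihedral.

(** * Sums over periods and over residue classes *)

Section PeriodicSums.
Local Open Scope ring_scope.

(** An integral section of [psum m]: the prescribed sum is concentrated on the multiples of m. *)
Definition comb (m : nat) (v i : int) : int := if (m %| i)%Z then v else 0.

Lemma comb_periodic m v : periodic m (comb m v).
Proof. by move=> i; rewrite /comb rpredDr ?dvdzz. Qed.

Lemma psum_comb m v : (0 < m)%N -> psum m (comb m v) = v.
Proof.
case: m => // m _; rewrite /psum big_ord_recl /comb dvdz0 big1 ?addr0 // => i _.
by rewrite dvdzE /= /bump /= gtnNdvd // add1n ltnS ltn_ord.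
Qed.

Implicit Types f g : int -> int.

(** The transfer from functions of period d * m to functions of period d, along <s^d> modulo
    <s^(dm)>. *)
Definition steps (d m : nat) f (i : int) := psum m (fun k => f (i + k * d%:Z)).
Local Notation step2 := (steps 2).

Lemma periodic_steps d m f : periodic (d * m) f ->
  forall i, periodic m (fun k => f (i + k * d%:Z)).
Proof. by move=> pf i k /=; rewrite -[RHS]pf PoszM; congr f; ring. Qed.

Lemma steps_periodic d m f : periodic (d * m) f -> periodic d (steps d m f).
Proof.
move=> pf i; rewrite /steps -(psum_shift1 (periodic_steps pf i)).
by apply: eq_psum => k; congr f; ring.
Qed.

Lemma step2_pred m f : periodic (2 * m) f -> forall i, step2 m f (i - 1) = step2 m f (i + 1).
Proof. by move=> pf i; rewrite -[LHS](steps_periodic pf); congr steps; lia. Qed.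

Lemma eq_steps d m f g : f =1 g -> steps d m f =1 steps d m g.
Proof. by move=> e i; apply: eq_psum => k. Qed.

Lemma stepsD d m f g i : steps d m (fun i => f i + g i) i = steps d m f i + steps d m g i.
Proof. exact: psumD. Qed.

Lemma stepsN d m f i : steps d m (fun i => - f i) i = - steps d m f i.
Proof. exact: psumN. Qed.

Lemma steps_const d m f i : periodic d f -> steps d m f i = m%:Z * f i.
Proof. by move=> pf; rewrite -psumC; apply: eq_psum => k; apply: (periodicM pf). Qed.

Lemma steps_add d m f i a : steps d m (fun j => f (j + a)) i = steps d m f (i + a).
Proof. by apply: eq_psum => k; congr f; ring. Qed.

Lemma psum_step2 m f : psum (2 * m) f = step2 m f 0 + step2 m f 1.
Proof.
rewrite /steps /psum; elim: m => [|m IH]; first by rewrite !big_ord0.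
rewrite mulnS !addSn add0n !big_ord_recr /= IH.
have -> : 0 + m%:Z * 2 = (2 * m)%N%:Z by lia.
have -> : 1 + m%:Z * 2 = (2 * m).+1%:Z by lia.
ring.
Qed.

Lemma psum_double m f : psum (2 * m) f = psum m f + psum m (fun i => f (i + m%:Z)).
Proof.
rewrite mul2n -addnn /psum big_split_ord /=; congr (_ + _).
by apply: eq_bigr => i _; congr f; rewrite PoszD addrC.
Qed.

Lemma comb2 v i : comb 2 v i + comb 2 v (i + 1) = v.
Proof.
have [q [e|e]] : exists q : int, i = q * 2 \/ i = q * 2 + 1.
  by exists (i %/ 2)%Z; lia.
all: rewrite /comb e; case: dvdzP => h1; case: dvdzP => h2; rewrite ?addr0 ?add0r //.
all: exfalso; try (case: h1 => q1 h1; case: h2 => q2 h2; lia).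
- by apply: h1; exists q.
- by apply: h2; exists (q + 1); lia.
Qed.

Lemma half_odd m (x : int) : odd m -> 2 * ((m.+1)./2%:Z * x) = m%:Z * x + x.
Proof.
move=> om; have e : 2 * (m.+1)./2%:Z = m%:Z + 1.
  by have := odd_double_half m.+1; rewrite /= om; lia.
by rewrite mulrA e mulrDl mul1r.
Qed.

End PeriodicSums.

(** * Explicit resolutions for the families of the theorem *)

Section QuasiPermutation.
Local Open Scope ring_scope.
Variables (gT : finGroupType) (G : {group gT}) (n : nat) (s t : gT).
Hypothesis D : dihedral G n s t.
Local Notation sg := (sg n s t).
Local Notation Cm := (Cm s).
Local Notation Dm := (Dm s t).
Local Notation coord := (of_coord n s t).
Local Notation step2 := (steps 2).
Implicit Types phi psi chi : nat -> gT -> int.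

Lemma sum_rot (f : gT -> int) m i b : periodic m (fun i => f (sg i b)) ->
  \sum_(k < m) f (sg i b * sg k%:Z false)%g = psum m (fun j => f (sg j b)).
Proof.
move=> pf; under eq_bigr => k _ do rewrite (sgM D) addbF.
by case: b pf => pf; [apply: (psum_reflect i pf) | apply: (psum_shift i pf)].
Qed.

Lemma sum_ref (f : gT -> int) m i b : periodic m (fun i => f (sg i (~~ b))) ->
  \sum_(k < m) f (sg i b * sg k%:Z true)%g = psum m (fun j => f (sg j (~~ b))).
Proof.
move=> pf; under eq_bigr => k _ do rewrite (sgM D) addbT.
by case: b pf => pf; [apply: (psum_reflect i pf) | apply: (psum_shift i pf)].
Qed.

Lemma coordE m (u : int -> bool -> int) i b : (m %| n)%N ->
  (forall b, periodic m (u^~ b)) -> coord u (sg i b) = u i b.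
Proof. by move=> mn pu; apply: (of_coordE D) => c; apply: periodic_dvd mn (pu c). Qed.

Lemma coord_psum m (u : int -> bool -> int) b : (m %| n)%N ->
  (forall b, periodic m (u^~ b)) -> psum m (fun j => coord u (sg j b)) = psum m (u^~ b).
Proof. by move=> mn pu; apply: eq_psum => j; rewrite (coordE _ _ mn pu). Qed.

Ltac rcomb_tac := repeat first
  [ exact: rcomb0 | apply: rcomb_opp | apply: rcomb_add | apply: rcomb_scale
  | (apply: rcomb_atom; [done | exact: (sgin D)]) | (apply: rcomb_id; done)
  | (apply: rcomb_sum => ?)].

Let one : sg 0 false = 1%g := sg1 D.

Lemma const_of_rot_ref (f : gT -> int) :
  (forall i, f (sg i true) = f (sg i false)) ->
  (forall i, f (sg (i + 1) true) = f (sg i false)) ->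
  exists c, forall g, g \in G -> f g = c.
Proof.
move=> f0 f1; have fp b : periodic 1 (fun i => f (sg i b)).
  by case: b => i; [rewrite f1 f0 | rewrite -f0 f1].
exists (f 1%g) => g /(sg_surj D)[i [b ->]].
have -> : sg i b = sg (0 + i * 1%N%:Z) b by congr sg; lia.
by rewrite (periodicM (fp b)); case: b; rewrite ?f0 one.
Qed.

(* In the four resolutions below, T takes the differences of a function along the
   edges of a graph whose vertices are the cosets, and S sums over a family of
   cycles permuted by G.  When m is odd these cycles satisfy a single relation,
   which an extra direct summand absorbs since 2 * ((m + 1) / 2) - m = 1. *)
Lemma quasi_permutation_DD m : (0 < m)%N -> (m %| n)%N ->
  quasi_permutation G (Jlat G [:: Dm m 0; Dm m 1]).
Proof.
move=> m0 mn.
(* The cosets form a cycle of 2m edges, edge [g] joining the two cosets of [g]. The alternating sum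
   round it changes sign under reflections; the invariant coordinate [T 1] splits it into sums over
   the two rotation classes, with values in the permutation lattice Z[G/<s>]. *)
pose T l (phi : nat -> gT -> int) g := if l is 0%N then phi 1%N g - phi 0%N g
  else \sum_(k < m) (phi 0%N (g * sg k%:Z false)%g - phi 1%N (g * sg k%:Z false)%g).
pose S (l : nat) (psi : nat -> gT -> int) g :=
  psi 1%N g + \sum_(k < m) psi 0%N (g * sg k%:Z false)%g.
have invH phi : inv_fam G [:: Dm m 0; Dm m 1] phi ->
    [/\ forall b, periodic m (fun i => phi 0%N (sg i b)),
        forall b, periodic m (fun i => phi 1%N (sg i b)),
        forall i, phi 0%N (sg i true) = phi 0%N (sg i false) &
        forall i, phi 1%N (sg (i + 1) true) = phi 1%N (sg i false)].
  move=> iv; have [p0 r0] := (right_inv_Dm D _ _ _).1 (iv 0%N isT).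
  have [p1 r1] := (right_inv_Dm D _ _ _).1 (iv 1%N isT); split=> // i.
  by rewrite -r0 addr0.
have T1E phi i b : inv_fam G [:: Dm m 0; Dm m 1] phi ->
    T 1%N phi (sg i b) = psum m (fun j => phi 0%N (sg j b)) - psum m (fun j => phi 1%N (sg j b)).
  by move=> /invH[p0 p1 _ _]; rewrite /T sumrB !sum_rot.
have SE psi l i b : inv_fam G [:: Cm m; G] psi ->
    S l psi (sg i b) = psi 1%N 1%g + psum m (fun j => psi 0%N (sg j b)).
  move=> iv; have p0 := (right_inv_Cm D _ _).1 (iv 0%N isT).
  by have c1 := (right_inv_full D _).1 (iv 1%N isT); rewrite /S sum_rot // c1.
have oT : ops G [:: Dm m 0; Dm m 1] [:: Cm m; G] T.
  split=> [[|[|//]] _|phi iv [|[|//]] _]; try by rewrite /T /=; rcomb_tac.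
    have [p0 p1 _ _] := invH phi iv; apply/(right_inv_Cm D) => b i.
    by rewrite /apply_ops /T p0 p1.
  have [p0 p1 r0 r1] := invH phi iv.
  apply/(right_inv_full D) => i b; rewrite -one /apply_ops !T1E //; case: b => //; congr (_ - _).
    exact: eq_psum.
  by rewrite -(psum_shift1 (p1 true)); apply: eq_psum.
have oS : ops G [:: Cm m; G] [:: Cm 1] S.
  split=> [[|//] _|psi iv [|//] _]; first by rewrite /S; rcomb_tac.
  by apply/(right_inv_Cm D) => b i; rewrite /apply_ops !SE.
apply: (@quasi_permutation_Jlat _ G _ [:: Cm m; G] [:: Cm 1] T S) => //.
- by rewrite /all_sub /= !(DmG D).
- by rewrite /all_sub /= (CmG D) subxx.
- by rewrite /all_sub /= (CmG D).
- by move=> [|[|//]] _; rewrite /T ?subrr // big1.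
- move=> phi iv T0; have [p0 p1 r0 r1] := invH phi iv.
  have e i b : phi 1%N (sg i b) = phi 0%N (sg i b).
    by have /eqP := T0 0%N _ isT (sgin D i b); rewrite subr_eq0 => /eqP.
  have [|c cE] := const_of_rot_ref r0; first by move=> i; rewrite -!e.
  exists c => -[|[|//]] g _ Gg; rewrite -(cE g Gg) //.
  by have [i [b ->]] := sg_surj D Gg; rewrite e.
- move=> phi iv [|//] g _ /(sg_surj D)[i [b ->]]; have [p0 p1 r0 r1] := invH phi iv.
  rewrite /apply_ops SE; last exact: oT.2.
  rewrite -one T1E // [X in _ + X = _](_ : _ =
    psum m (fun j => phi 1%N (sg j b)) - psum m (fun j => phi 0%N (sg j b))).
    have -> : psum m (fun j => phi 1%N (sg j b)) = psum m (fun j => phi 1%N (sg j false)).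
      by case: b => //; rewrite -(psum_shift1 (p1 true)); apply: eq_psum.
    have -> : psum m (fun j => phi 0%N (sg j b)) = psum m (fun j => phi 0%N (sg j false)).
      by case: b => //; apply: eq_psum.
    ring.
  by rewrite -psumN -psumD.
- move=> psi iv S0; have p0 := (right_inv_Cm D _ _).1 (iv 0%N isT).
  have c1 := (right_inv_full D _).1 (iv 1%N isT).
  have Sb b : psi 1%N 1%g + psum m (fun j => psi 0%N (sg j b)) = 0.
    by have := S0 0%N _ isT (sgin D 0 b); rewrite /apply_ops SE.
  (* The solution sought is [P] on the first coset space and [P + psi 0] on the second. Invariance
     of [P] under t asks for zero differences along t; invariance of [P + psi 0] under s t
     prescribes [E1]. *)
  pose E1 (i : int) (b : bool) : int := if b then psi 0%N (sg i true) - psi 0%N (sg (i - 1) false)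
                 else psi 0%N (sg i false) - psi 0%N (sg (i + 1) true).
  have [| | | | |P [pP r0 r1]] := @potential m (fun _ _ => 0) E1 m0.
  + by [].
  + by case=> i /=; rewrite /E1 addrAC !p0.
  + by [].
  + by move=> i; rewrite /E1 addrK opprB.
  + rewrite /E1 /= psumD psumN.
    have -> : psum m (fun j => psi 0%N (sg (j - 1) false)) = psum m (fun j => psi 0%N (sg j false)).
      by rewrite -[RHS](psum_shift (-1) (p0 false)); apply: eq_psum => j; rewrite addrC.
    have := Sb true; have := Sb false; rewrite psumC; lia.
  exists (fun k => if k is 0%N then coord P else fun g => coord P g + psi 0%N g).
    move=> [|[|//]] _ /=; apply/(right_inv_Dm D); split=> [b i|i];
      rewrite !(coordE _ _ mn pP) ?pP ?p0 //.
      by rewrite addr0 r0 addr0.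
    by rewrite r1 /E1; ring.
  move=> [|[|//]] g _ /(sg_surj D)[i [b ->]]; rewrite /apply_ops /=.
    by rewrite addrC addKr.
  rewrite c1 sumrB big_split /= !sum_rot //; do ?[by move=> j; rewrite !(coordE _ _ mn pP) pP].
  have := Sb b; lia.
- move=> chi iv; have c1 := (right_inv_Cm D _ _).1 (iv 0%N isT).
  pose u (i : int) b := if b then comb m (chi 0%N (sg 0 true) - chi 0%N (sg 0 false)) i else 0.
  have pu b : periodic m (u^~ b) by case: b => i //=; rewrite /u comb_periodic.
  exists (fun k => if k is 0%N then coord u else fun=> chi 0%N (sg 0 false)).
    move=> [|[|//]] _ /=; last by apply/(right_inv_full D).
    by apply/(right_inv_Cm D) => b i; rewrite !(coordE _ _ mn pu) pu.
  move=> [|//] g _ /(sg_surj D)[i [b ->]]; rewrite /apply_ops /S /= sum_rot.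
    rewrite (coord_psum b mn pu).
    have -> : sg i b = sg (0 + i * 1%N%:Z) b by congr sg; lia.
    rewrite (periodicM (c1 b)); case: b; rewrite /u ?psum_comb // ?psumC; ring.
  by move=> j; rewrite !(coordE _ _ mn pu) pu.
Qed.

Lemma mul_t i b : (sg i b * sg 0 true)%g = sg i (~~ b).
Proof. by rewrite (sgM D) addbT; case: b; rewrite ?oppr0 addr0. Qed.

Lemma mul_st i b : (sg i b * sg 1 true)%g = sg (if b then i - 1 else i + 1) (~~ b).
Proof. by rewrite (sgM D) addbT; case: b. Qed.

Lemma coord_rot (u : int -> bool -> int) m i b : (m %| n)%N ->
  (forall b, periodic m (u^~ b)) ->
  \sum_(k < m) coord u (sg i b * sg k%:Z false)%g = psum m (u^~ b).
Proof.
move=> mn pu; rewrite sum_rot; first exact: coord_psum.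
by move=> j; rewrite !(coordE _ _ mn pu) pu.
Qed.

Lemma coord_ref (u : int -> bool -> int) m i b : (m %| n)%N ->
  (forall b, periodic m (u^~ b)) ->
  \sum_(k < m) coord u (sg i b * sg k%:Z true)%g = psum m (u^~ (~~ b)).
Proof.
move=> mn pu; rewrite sum_ref; first exact: coord_psum.
by move=> j; rewrite !(coordE _ _ mn pu) pu.
Qed.

Lemma periodic1 (f : gT -> int) b i : periodic 1 (fun i => f (sg i b)) -> f (sg i b) = f (sg 0 b).
Proof.
move=> pf; have -> : sg i b = sg (0 + i * 1%N%:Z) b by congr sg; lia.
exact: (periodicM pf).
Qed.

(** The graph is the Cayley graph of G/<s^m> for t and s t, a cycle of length 2m with each edge
    listed in both directions. [S 0] and [S 1] say that reversal changes the sign, [S 2] that the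
    sum round the cycle is zero in each direction; these equations are linked by one relation, which
    the constant [psi 2] absorbs. *)
Lemma quasi_permutation_C m : odd m -> (m %| n)%N -> quasi_permutation G (Jlat G [:: Cm m]).
Proof.
move=> om mn; have m0 : (0 < m)%N by case: (m) om.
pose B : int := (m.+1)./2%:Z.
have BE x : 2 * (B * x) = m%:Z * x + x := half_odd x om.
pose T l phi g := match l with
  | 0%N => phi 0%N (g * sg 0 true)%g - phi 0%N g
  | 1%N => phi 0%N (g * sg 1 true)%g - phi 0%N g
  | _ => 0 end.
pose S l psi g := match l with
  | 0%N => psi 0%N g + psi 0%N (g * sg 0 true)%g + psi 2%N g
  | 1%N => psi 1%N g + psi 1%N (g * sg 1 true)%g
  | _ => \sum_(k < m) psi 0%N (g * sg k%:Z false)%g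
         + \sum_(k < m) psi 1%N (g * sg k%:Z true)%g + B * psi 2%N g end.
pose Rs := [:: Cm m; Cm m; G]; pose Fs := [:: Dm m 0; Dm m 1; Cm 1].
have invR psi : inv_fam G Rs psi ->
    [/\ forall b, periodic m (fun i => psi 0%N (sg i b)),
        forall b, periodic m (fun i => psi 1%N (sg i b)) &
        forall i b, psi 2%N (sg i b) = psi 2%N 1%g].
  move=> iv; split; first exact: ((right_inv_Cm D _ _).1 (iv 0%N isT)).
    exact: ((right_inv_Cm D _ _).1 (iv 1%N isT)).
  exact: ((right_inv_full D _).1 (iv 2%N isT)).
have S2E psi i b : inv_fam G Rs psi -> S 2%N psi (sg i b) =
    psum m (fun j => psi 0%N (sg j b)) + psum m (fun j => psi 1%N (sg j (~~ b)))
    + B * psi 2%N 1%g.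
  by move=> /invR[p0 p1 c2]; rewrite /S sum_rot // sum_ref // c2.
have oT : ops G [:: Cm m] Rs T.
  split=> [[|[|[|//]]] _|phi iv]; try by rewrite /T /=; rcomb_tac.
  have p0 := (right_inv_Cm D _ _).1 (iv 0%N isT).
  move=> [|[|[|//]]] _; last by [].
    by apply/(right_inv_Cm D) => b i; rewrite /apply_ops /T !mul_t !p0.
  apply/(right_inv_Cm D) => b i; rewrite /apply_ops /T !mul_st p0.
  by case: b; rewrite addrAC p0.
have oS : ops G Rs Fs S.
  split=> [[|[|[|//]]] _|psi iv]; try by rewrite /S /=; rcomb_tac.
  have [p0 p1 c2] := invR psi iv; move=> [|[|[|//]]] _.
  - apply/(right_inv_Dm D); split=> [b i|i]; rewrite /apply_ops /S !mul_t ?p0 !c2 //.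
    by rewrite addr0; congr (_ + _); rewrite addrC.
  - apply/(right_inv_Dm D); split=> [b i|i]; rewrite /apply_ops /S !mul_st.
      by rewrite p1; case: b; rewrite addrAC p1.
    by rewrite addrK addrC.
  - by apply/(right_inv_Cm D) => b i; rewrite /apply_ops !S2E.
apply: (@quasi_permutation_Jlat _ G _ Rs Fs T S) => //.
- by rewrite /all_sub /= (CmG D).
- by rewrite /all_sub /= !(CmG D) subxx.
- by rewrite /all_sub /= !(CmG D) !(DmG D).
- by move=> [|[|[|//]]] _; rewrite /T ?subrr.
- move=> phi iv T0.
  have [i|i|c cE] := @const_of_rot_ref (phi 0%N).
  + by have /eqP := T0 0%N _ isT (sgin D i false); rewrite /apply_ops /T mul_t subr_eq0 => /eqP.
  + by have /eqP := T0 1%N _ isT (sgin D i false); rewrite /apply_ops /T mul_st subr_eq0 => /eqP.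
  by exists c => -[|//] g _ Gg; apply: cE.
- move=> phi iv [|[|[|//]]] g _ /(sg_surj D)[i [b ->]]; rewrite /apply_ops.
  + by rewrite /S /T !mul_t negbK; ring.
  + by rewrite /S /T !mul_st; case: b; rewrite /= ?subrK ?addrK; ring.
  + have p0 := (right_inv_Cm D _ _).1 (iv 0%N isT).
    rewrite S2E; last exact: oT.2.
    have -> : psum m (fun j => T 0%N phi (sg j b)) =
        psum m (fun j => phi 0%N (sg j (~~ b))) - psum m (fun j => phi 0%N (sg j b)).
      by rewrite -psumN -psumD; apply: eq_psum => j; rewrite /T mul_t.
    have -> : psum m (fun j => T 1%N phi (sg j (~~ b))) =
        psum m (fun j => phi 0%N (sg j b)) - psum m (fun j => phi 0%N (sg j (~~ b))).
      case: b => /=.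
        rewrite -(psum_shift 1 (p0 true)) -psumN -psumD; apply: eq_psum => j.
        by rewrite /T mul_st [1 + j]addrC.
      rewrite -(psum_shift (-1) (p0 false)) -psumN -psumD; apply: eq_psum => j.
      by rewrite /T mul_st [-1 + j]addrC.
    rewrite /T; ring.
- move=> psi iv S0; have [p0 p1 c2] := invR psi iv.
  have A0 i : psi 0%N (sg i false) + psi 0%N (sg i true) + psi 2%N 1%g = 0.
    by have := S0 0%N _ isT (sgin D i false); rewrite /apply_ops /S mul_t c2.
  have A1 i : psi 1%N (sg i false) + psi 1%N (sg (i + 1) true) = 0.
    by have := S0 1%N _ isT (sgin D i false); rewrite /apply_ops /S mul_st.
  have A2 b : psum m (fun j => psi 0%N (sg j b)) + psum m (fun j => psi 1%N (sg j (~~ b)))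
      + B * psi 2%N 1%g = 0.
    by have := S0 2%N _ isT (sgin D 0 b); rewrite /apply_ops S2E.
  (* Adding the two cycle equations and subtracting the summed reversal equations leaves (2B - m)
     psi 2 = 0, where 2B - m = 1. *)
  have c0 : psi 2%N 1%g = 0.
    have := A2 true; have := A2 false; have := BE (psi 2%N 1%g).
    have := eq_psum m A0; rewrite !psumD !psumC mulr0.
    have := eq_psum m A1; rewrite !psumD !psumC mulr0 (psum_shift1 (p1 true)) /=.
    lra.
  have [| | |P [pP r0 r1]] := @potential m (fun i b => psi 0%N (sg i b))
      (fun i b => psi 1%N (sg i b)) m0 p0 p1.
  + by move=> i /=; have := A0 i; rewrite c0; lra.
  + by move=> i /=; have := A1 i; lra.
  + by have := A2 false; rewrite c0 mulr0 addr0.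
  exists (fun=> coord P).
    by move=> [|//] _; apply/(right_inv_Cm D) => b i; rewrite !(coordE _ _ mn pP) pP.
  move=> [|[|[|//]]] g _ /(sg_surj D)[i [b ->]]; rewrite /apply_ops /T ?mul_t ?mul_st
    ?(coordE _ _ mn pP).
  + by case: b; rewrite /= r0; have := A0 i; rewrite c0; lra.
  + case: b => /=; last by rewrite r1; ring.
    have := r1 (i - 1); have := A1 (i - 1); rewrite subrK; lra.
  + by rewrite c2.
- move=> chi iv; have [q0 x0] := (right_inv_Dm D _ _ _).1 (iv 0%N isT).
  have [q1 x1] := (right_inv_Dm D _ _ _).1 (iv 1%N isT).
  have q2 := (right_inv_Cm D _ _).1 (iv 2%N isT).
  pose X0 := psum m (fun j => chi 0%N (sg j false)).
  pose X1 := psum m (fun j => chi 1%N (sg j false)).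
  pose y b := chi 2%N (sg 0 b).
  (* The combination of equations that forces [psi 2 = 0] on the kernel, taken with right-hand side
     [chi], determines [psi 2]. *)
  pose c := y false + y true - X0 - X1.
  pose x := comb m (y false - B * c).
  have px : periodic m x := comb_periodic m _.
  pose u (i : int) (b : bool) : int := if b then chi 0%N (sg i false) - c - x i else x i.
  pose v (i : int) (b : bool) : int := if b then 0 else chi 1%N (sg i false).
  have pu b : periodic m (u^~ b) by case: b => i; rewrite /u ?q0 px.
  have pv b : periodic m (v^~ b) by case: b => i; rewrite /v ?q1.
  exists (fun k => match k with 0%N => coord u | 1%N => coord v | _ => fun=> c end).
    move=> [|[|[|//]]] _; try by apply/(right_inv_full D).
    + by apply/(right_inv_Cm D) => b i; rewrite !(coordE _ _ mn pu) pu.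
    + by apply/(right_inv_Cm D) => b i; rewrite !(coordE _ _ mn pv) pv.
  move=> [|[|[|//]]] g _ /(sg_surj D)[i [b ->]]; rewrite /apply_ops /S ?mul_t ?mul_st
    ?(coordE _ _ mn pu) ?(coordE _ _ mn pv).
  + by case: b; rewrite /u /=; [have := x0 i; rewrite addr0 => -> |]; ring.
  + by case: b; rewrite /v /=; [have := x1 (i - 1); rewrite subrK => -> |]; ring.
  + rewrite (coord_rot _ _ mn pu) (coord_ref _ _ mn pv) (periodic1 _ (q2 b)) -/(y b).
    have px' : psum m x = y false - B * c := psum_comb _ m0.
    have Bc := BE c.
    case: b; rewrite /u /v /= ?psumD ?psumN ?psumC px' -/X0 -/X1.
      by move: Bc; rewrite {3}/c; lra.
    ring.
Qed.

Lemma mul_s i b : (sg i b * sg 1 false)%g = sg (if b then i - 1 else i + 1) b.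
Proof. by rewrite (sgM D) addbF; case: b. Qed.

Lemma sum_steps (f : gT -> int) d m i b a : periodic (d * m) (fun i => f (sg i b)) ->
  \sum_(k < m) f (sg i b * sg (a + k%:Z * d%:Z) false)%g =
  steps d m (fun j => f (sg j b)) (if b then i - a else i + a).
Proof.
move=> pf; under eq_bigr => k _ do rewrite (sgM D) addbF; rewrite /steps; case: b pf => pf.
  rewrite -(psum_reflect 0 (periodic_steps pf (i - a))); apply: eq_bigr => k _.
  by congr (f (sg _ _)); ring.
by apply: eq_bigr => k _; congr (f (sg _ _)); ring.
Qed.

Lemma sum_rot2 (f : gT -> int) m i b : periodic (2 * m) (fun i => f (sg i b)) ->
  \sum_(k < m) f (sg i b * sg (k%:Z * 2) false)%g = step2 m (fun j => f (sg j b)) i.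
Proof.
move=> pf; under eq_bigr => k _ do rewrite (sgM D) addbF; rewrite /steps; case: b pf => pf //.
rewrite -(psum_reflect 0 (periodic_steps pf i)); apply: eq_bigr => k _.
by congr (f (sg _ _)); lia.
Qed.

Lemma sum_rot2' (f : gT -> int) m i b : periodic (2 * m) (fun i => f (sg i b)) ->
  \sum_(k < m) f (sg i b * sg (k%:Z * 2 + 1) false)%g = step2 m (fun j => f (sg j b)) (i + 1).
Proof.
move=> pf; under eq_bigr => k _ do rewrite (sgM D) addbF; rewrite /steps; case: b pf => pf.
  rewrite -(psum_reflect (-1) (periodic_steps pf (i + 1))); apply: eq_bigr => k _.
  by congr (f (sg _ _)); lia.
by apply: eq_bigr => k _; congr (f (sg _ _)); lia.
Qed.

(** The 2m cosets are the vertices of a polygon with edges from g to g s, the reversed edge being g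
    s t. Adding every other edge gives an alternating sum of vertex values, which [T 1] records up
    to sign: [S 1] compares the two, [S 2] says that it changes sign under one rotation step, [S 0]
    treats reversal, and [psi 2] again absorbs the redundancy. *)
Lemma quasi_permutation_D m : odd m -> (2 * m %| n)%N ->
  quasi_permutation G (Jlat G [:: Dm (2 * m) 0]).
Proof.
move=> om mn; have m0 : (0 < m)%N by case: (m) om.
pose B : int := (m.+1)./2%:Z.
have BE x : 2 * (B * x) = m%:Z * x + x := half_odd x om.
pose T l phi g := match l with
  | 0%N => phi 0%N (g * sg 1 false)%g - phi 0%N g
  | 1%N => \sum_(k < m) phi 0%N (g * sg (k%:Z * 2) false)%g
           - \sum_(k < m) phi 0%N (g * sg (k%:Z * 2 + 1) false)%g
  | _ => 0 end.
pose S l psi g := match l with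
  | 0%N => psi 0%N g + psi 0%N (g * sg 1 true)%g + psi 2%N g
  | 1%N => psi 1%N g + \sum_(k < m) psi 0%N (g * sg (k%:Z * 2) false)%g + B * psi 2%N g
  | _ => psi 1%N g + psi 1%N (g * sg 1 false)%g end.
pose Hs := [:: Dm (2 * m) 0].
pose Rs := [:: Cm (2 * m); Dm 2 0; Dm 2 1]; pose Fs := [:: Dm (2 * m) 1; Cm 2; G].
have d2 : (2 %| 2 * m)%N by rewrite dvdn_mulr.
have n2 : (2 %| n)%N by apply: dvdn_trans mn.
have invH phi : inv_fam G Hs phi ->
    (forall b, periodic (2 * m) (fun i => phi 0%N (sg i b))) /\
    (forall i, phi 0%N (sg i true) = phi 0%N (sg i false)).
  by move=> iv; have [p r] := (right_inv_Dm D _ _ _).1 (iv 0%N isT); split=> // i; rewrite -r addr0.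
have invR psi : inv_fam G Rs psi ->
    [/\ forall b, periodic (2 * m) (fun i => psi 0%N (sg i b)),
        forall b, periodic 2 (fun i => psi 1%N (sg i b)),
        forall i, psi 1%N (sg i true) = psi 1%N (sg i false),
        forall b, periodic 2 (fun i => psi 2%N (sg i b)) &
        forall i, psi 2%N (sg (i + 1) true) = psi 2%N (sg i false)].
  move=> iv; have p0 := (right_inv_Cm D _ _).1 (iv 0%N isT).
  have [p1 r1] := (right_inv_Dm D _ _ _).1 (iv 1%N isT).
  by have [p2 r2] := (right_inv_Dm D _ _ _).1 (iv 2%N isT); split=> // i; rewrite -r1 addr0.
have T1E phi i b : inv_fam G Hs phi -> T 1%N phi (sg i b) =
    step2 m (fun j => phi 0%N (sg j b)) i - step2 m (fun j => phi 0%N (sg j b)) (i + 1).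
  by move=> /invH[p _]; rewrite /T sum_rot2 // sum_rot2'.
have S1E psi i b : inv_fam G Rs psi -> S 1%N psi (sg i b) =
    psi 1%N (sg i b) + step2 m (fun j => psi 0%N (sg j b)) i + B * psi 2%N (sg i b).
  by move=> /invR[p0 _ _ _ _]; rewrite /S sum_rot2.
have S2E psi i b : inv_fam G Rs psi -> S 2%N psi (sg i b) =
    psi 1%N (sg i false) + psi 1%N (sg (i + 1) false).
  move=> /invR[_ p1 r1 _ _]; rewrite /S mul_s; case: b; rewrite // !r1; congr (_ + _).
  by rewrite -[LHS](p1 false); congr (psi _ (sg _ _)); lia.
have oT : ops G Hs Rs T.
  split=> [[|[|[|//]]] _|phi iv]; try by rewrite /T /=; rcomb_tac.
  have [p0 r0] := invH phi iv; move=> [|[|[|//]]] _; last by [].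
    apply/(right_inv_Cm D) => b i; rewrite /apply_ops /T !mul_s p0.
    by case: b; rewrite addrAC p0.
  apply/(right_inv_Dm D); split=> [b i|i]; rewrite /apply_ops !T1E //.
    by rewrite addrAC !(steps_periodic (p0 b)).
  by rewrite addr0 !(eq_steps _ _ r0).
have oS : ops G Rs Fs S.
  split=> [[|[|[|//]]] _|psi iv]; try by rewrite /S /=; rcomb_tac.
  have [p0 p1 r1 p2 r2] := invR psi iv; move=> [|[|[|//]]] _.
  - apply/(right_inv_Dm D); split=> [b i|i]; rewrite /apply_ops /S !mul_st.
      rewrite p0 (periodic_dvd d2 (p2 b)); congr (_ + _ + _).
      by case: b; rewrite addrAC p0.
    by rewrite addrK r2; congr (_ + _); rewrite addrC.
  - apply/(right_inv_Cm D) => b i; rewrite /apply_ops !S1E // p1 p2.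
    by rewrite (steps_periodic (p0 b)).
  - apply/(right_inv_full D) => i b; rewrite -one /apply_ops !S2E //.
    pose f g := psi 1%N g + psi 1%N (g * sg 1 false)%g.
    have pf : periodic 1 (fun i => f (sg i false)).
      move=> j; rewrite /f !mul_s addrC; congr (_ + _).
      by rewrite -[RHS](p1 false); congr (psi _ (sg _ _)); lia.
    by have := periodic1 i pf; rewrite /f !mul_s.
have ST phi : inv_fam G Hs phi -> eq_fam G Fs (apply_ops S (apply_ops T phi)) (fun _ _ => 0).
  move=> iv [|[|[|//]]] g _ /(sg_surj D)[i [b ->]]; have [p0 r0] := invH phi iv; rewrite /apply_ops.
  - by rewrite /S /T !mul_st !mul_s; case: b; rewrite /= ?subrK ?addrK !r0; ring.
  - rewrite S1E; last exact: oT.2.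
    have -> : step2 m (fun j => T 0%N phi (sg j b)) i =
        step2 m (fun j => phi 0%N (sg j b)) (i + 1) - step2 m (fun j => phi 0%N (sg j b)) i.
      have -> : step2 m (fun j => phi 0%N (sg j b)) (i + 1) =
          step2 m (fun j => phi 0%N (sg j b)) (if b then i - 1 else i + 1).
        by case: (b); rewrite // (step2_pred (p0 _)).
      rewrite /T -stepsN; case: b => /=.
        by rewrite -steps_add -stepsD; apply: eq_steps => j; rewrite mul_s.
      by rewrite -steps_add -stepsD; apply: eq_steps => j; rewrite mul_s.
    by rewrite T1E // /T; ring.
  - rewrite S2E; last exact: oT.2.
    rewrite !T1E // -[step2 _ _ (i + 1 + 1)](_ : step2 m (fun j => phi 0%N (sg j false)) i = _).
      ring.
    by rewrite -(steps_periodic (p0 false)); congr steps; lia.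
apply: (@quasi_permutation_Jlat _ G _ Rs Fs T S) => //.
- by rewrite /all_sub /= (DmG D).
- by rewrite /all_sub /= (CmG D) !(DmG D).
- by rewrite /all_sub /= (CmG D) (DmG D) subxx.
- by move=> [|[|[|//]]] _; rewrite /T ?subrr.
- move=> phi iv T0; have [p0 r0] := invH phi iv.
  have [i|c cE] := const_of_rot_ref r0.
    rewrite r0; have /eqP := T0 0%N _ isT (sgin D i false).
    by rewrite /apply_ops /T mul_s subr_eq0 => /eqP.
  by exists c => -[|//] g _ Gg; apply: cE.
- move=> psi iv S0; have [p0 p1 r1 p2 r2] := invR psi iv.
  have A0 i : psi 0%N (sg i false) + psi 0%N (sg (i + 1) true) + psi 2%N (sg i false) = 0.
    by have := S0 0%N _ isT (sgin D i false); rewrite /apply_ops /S mul_st.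
  have A1 i b : psi 1%N (sg i b) + step2 m (fun j => psi 0%N (sg j b)) i
      + B * psi 2%N (sg i b) = 0.
    by have := S0 1%N _ isT (sgin D i b); rewrite /apply_ops S1E.
  have A2 i : psi 1%N (sg i false) + psi 1%N (sg (i + 1) false) = 0.
    by have := S0 2%N _ isT (sgin D i false); rewrite /apply_ops S2E.
  have c0 i : psi 2%N (sg i false) = 0.
    have := A1 i false; have := A1 (i + 1) true; rewrite r1 r2.
    have := A2 i; have := BE (psi 2%N (sg i false)).
    have := eq_steps 2 m A0 i; rewrite !stepsD (steps_add 2 m (fun j => psi 0%N (sg j true))).
    rewrite (steps_const _ _ (p2 false)).
    have -> : step2 m (fun=> 0) i = 0 by rewrite /steps psumC mulr0.
    lra.
  have c0' i b : psi 2%N (sg i b) = 0.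
    by case: b => //; have := r2 (i - 1); rewrite subrK c0.
  have [| | | | | |P [pP q0 q1]] := @potential (2 * m) (fun _ _ => 0) (fun i b => psi 0%N (sg i b)).
  + by rewrite muln_gt0.
  + by [].
  + exact: p0.
  + by [].
  + by move=> i; have := A0 i; rewrite c0; lra.
  + rewrite psumC mulr0 add0r psum_step2; have := A1 0 true; have := A1 1 true.
    by rewrite !c0' !r1; have := A2 0; rewrite add0r; lra.
  have iP : inv_fam G Hs (fun=> coord P).
    move=> [|//] _; apply/(right_inv_Dm D); split=> [b i|i]; rewrite !(coordE _ _ mn pP) ?pP //.
    by rewrite addr0 q0 addr0.
  have T0E i b : T 0%N (fun=> coord P) (sg i b) = psi 0%N (sg i b).
    rewrite /T mul_s !(coordE _ _ mn pP); case: b => /=.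
      have := q1 (i - 1); have := A0 (i - 1); have := q0 (i - 1); rewrite c0 subrK; lra.
    by have := q0 (i + 1); have := q1 i; lra.
  exists (fun=> coord P) => //.
  move=> [|[|[|//]]] g _ /(sg_surj D)[i [b ->]]; rewrite /apply_ops ?T0E //.
    have := ST _ iP 1%N _ isT (sgin D i b); rewrite /apply_ops S1E; last exact: oT.2.
    rewrite (eq_steps 2 m (T0E^~ b)); have := A1 i b; rewrite c0' /T; lra.
- move=> chi iv; have [q0 x0] := (right_inv_Dm D _ _ _).1 (iv 0%N isT).
  have q1 := (right_inv_Cm D _ _).1 (iv 1%N isT).
  have x2 := (right_inv_full D _).1 (iv 2%N isT).
  pose c := chi 2%N 1%g.
  pose Q := step2 m (fun j => chi 0%N (sg j false)).
  have pQ : periodic 2 Q := steps_periodic (q0 false).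
  (* [z] is the forced value of [psi 2], found by adding the equations [S 1] at (i, false) and (i +
     1, true); [c] is subtracted because consecutive values of [psi 1] must add up to it. *)
  pose z (i : int) : int := chi 1%N (sg i false) + chi 1%N (sg (i + 1) true) - Q i - c.
  have pz : periodic 2 z by move=> i; rewrite /z q1 [_ + _ + 1]addrAC q1 pQ.
  have pc := comb_periodic 2 c.
  pose eta (i : int) : int := chi 1%N (sg i false) - comb 2 c i - B * z i.
  have pe : periodic 2 eta by move=> i; rewrite /eta q1 pc pz.
  (* Concentrated on one vertex in each parity class of a period: at i = 2k or 2k + 1 it is zero
     unless m divides k. Hence the sum over the class of i is [eta i]. *)
  pose w (i : int) : int := comb m (eta i) (i %/ 2)%Z.
  have wE i : step2 m w i = eta i.
    rewrite -(psum_comb (eta i) m0) -(psum_shift (i %/ 2)%Z (comb_periodic m (eta i))).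
    apply: eq_psum => k; rewrite /w divzDr ?dvdz_mull // mulzK //.
    by rewrite (periodicM pe).
  have pw : periodic (2 * m) w.
    move=> i; rewrite /w (periodic_dvd d2 pe) PoszM mulrC divzDr ?dvdz_mull // mulzK //.
    exact: comb_periodic.
  pose u0 (i : int) (b : bool) : int :=
    if b then chi 0%N (sg i true) - z (i - 1) - w (i - 1) else w i.
  pose u2 (i : int) (b : bool) : int := if b then z (i - 1) else z i.
  have pu0 b : periodic (2 * m) (u0^~ b).
    by case: b => i; rewrite /u0 ?pw // q0 [_ + _ - 1]addrAC pw (periodic_dvd d2 pz).
  have pu1 b : periodic 2 ((fun i (_ : bool) => comb 2 c i)^~ b) by [].
  have pu2 b : periodic 2 (u2^~ b) by case: b => i; rewrite /u2 ?pz // [_ + _ - 1]addrAC pz.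
  exists (fun k => match k with 0%N => coord u0 | 1%N => coord (fun i _ => comb 2 c i)
                              | _ => coord u2 end).
    move=> [|[|[|//]]] _.
    + by apply/(right_inv_Cm D) => b i; rewrite !(coordE _ _ mn pu0) pu0.
    + by apply/(right_inv_Dm D); split=> [b i|i]; rewrite !(coordE _ _ n2 pu1) ?pu1 ?addr0.
    + apply/(right_inv_Dm D); split=> [b i|i]; rewrite !(coordE _ _ n2 pu2) ?pu2 //.
      by rewrite /u2 addrK.
  move=> [|[|[|//]]] g _ /(sg_surj D)[i [b ->]]; rewrite /apply_ops /S.
  + rewrite mul_st !(coordE _ _ mn pu0) (coordE _ _ n2 pu2).
    case: b; rewrite /u0 /u2 /=; first by ring.
    by rewrite addrK -x0; ring.
  + rewrite sum_rot2; last by move=> j; rewrite !(coordE _ _ mn pu0) pu0.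
    rewrite (coordE _ _ n2 pu1) (coordE _ _ n2 pu2) (eq_steps _ _ (fun j => coordE j b mn pu0)).
    case: b; rewrite /u0 /u2 /=; last by rewrite wE /eta; ring.
    rewrite !stepsD !stepsN (steps_add 2 m w) (steps_add 2 m z) wE (steps_const _ _ pz).
    have -> : step2 m (fun j => chi 0%N (sg j true)) i = Q (i - 1).
      by rewrite -[i in LHS](subrK 1) -steps_add; apply: eq_steps => j; rewrite x0.
    have zE : z (i - 1) =
      chi 1%N (sg (i - 1) false) + chi 1%N (sg i true) - Q (i - 1) - c by rewrite /z subrK.
    have eE : eta (i - 1) = chi 1%N (sg (i - 1) false) - comb 2 c (i - 1) - B * z (i - 1) by [].
    have := BE (z (i - 1)); have := comb2 c (i - 1); rewrite subrK; move: zE eE.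
    move: (z _) (eta _) => *; lra.
  + rewrite x2 mul_s !(coordE _ _ n2 pu1); case: b => /=; last by rewrite comb2.
    by have := comb2 c (i - 1); rewrite subrK addrC.
Qed.

Lemma mul_rot (f : gT -> int) m i b : (forall b, periodic (2 * m) (fun i => f (sg i b))) ->
  f (sg i b * sg m%:Z false)%g = f (sg (i + m%:Z) b).
Proof.
move=> pf; rewrite (sgM D) addbF; case: b => //.
by rewrite -[LHS](pf true); congr (f (sg _ _)); lia.
Qed.

Lemma mul_ref (f : gT -> int) m i b : (forall b, periodic (2 * m) (fun i => f (sg i b))) ->
  f (sg i b * sg m%:Z true)%g = f (sg (i + m%:Z) (~~ b)).
Proof.
move=> pf; rewrite (sgM D) addbT; case: b => //.
by rewrite -[LHS](pf false); congr (f (sg _ _)); lia.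
Qed.

(** The edges of [T 0], joining the two kinds of cosets, form m quadrilaterals. [T 1] records, up to
    sign, the common sum over either pair of opposite edges, which avoids a sign-twisted target for
    the quadrilateral relation; [T 2] adds the edges of s t between cosets of the rotation group. *)
Lemma quasi_permutation_CD m : odd m -> (2 * m %| n)%N ->
  quasi_permutation G (Jlat G [:: Cm m; Dm (2 * m) 0]).
Proof.
move=> om mn; have m0 : (0 < m)%N by case: (m) om.
pose B : int := (m.+1)./2%:Z.
have BE x : 2 * (B * x) = m%:Z * x + x := half_odd x om.
pose T l phi g := match l with
  | 0%N => phi 0%N g - phi 1%N g
  | 1%N => phi 1%N g + phi 1%N (g * sg m%:Z false)%g - phi 0%N g - phi 0%N (g * sg 0 true)%g
  | 2%N => phi 0%N (g * sg 1 true)%g - phi 0%N g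
  | _ => 0 end.
pose S l psi g := match l with
  | 0%N => psi 1%N g + psi 0%N g + psi 0%N (g * sg m%:Z true)%g
  | 1%N => psi 2%N g + psi 2%N (g * sg 1 true)%g + psi 3%N g
  | _ => \sum_(k < m) psi 2%N (g * sg k%:Z false)%g + \sum_(k < m) psi 1%N (g * sg k%:Z false)%g
         + \sum_(k < 2 * m) psi 0%N (g * sg k%:Z false)%g + B * psi 3%N g end.
pose Hs := [:: Cm m; Dm (2 * m) 0].
pose Rs := [:: Cm (2 * m); Dm m 0; Cm m; G]; pose Fs := [:: Dm (2 * m) m; Dm m 1; Cm 1].
have dm : (m %| 2 * m)%N by rewrite dvdn_mull.
have nm : (m %| n)%N by apply: dvdn_trans mn.
have invH phi : inv_fam G Hs phi ->
    [/\ forall b, periodic m (fun i => phi 0%N (sg i b)),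
        forall b, periodic (2 * m) (fun i => phi 1%N (sg i b)) &
        forall i, phi 1%N (sg i true) = phi 1%N (sg i false)].
  move=> iv; have p0 := (right_inv_Cm D _ _).1 (iv 0%N isT).
  by have [p r] := (right_inv_Dm D _ _ _).1 (iv 1%N isT); split=> // i; rewrite -r addr0.
have invR psi : inv_fam G Rs psi ->
    [/\ forall b, periodic (2 * m) (fun i => psi 0%N (sg i b)),
        forall b, periodic m (fun i => psi 1%N (sg i b)),
        forall i, psi 1%N (sg i true) = psi 1%N (sg i false),
        forall b, periodic m (fun i => psi 2%N (sg i b)) &
        forall i b, psi 3%N (sg i b) = psi 3%N 1%g].
  move=> iv; have p0 := (right_inv_Cm D _ _).1 (iv 0%N isT).
  have [p1 r1] := (right_inv_Dm D _ _ _).1 (iv 1%N isT).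
  have p2 := (right_inv_Cm D _ _).1 (iv 2%N isT).
  by have c3 := (right_inv_full D _).1 (iv 3%N isT); split=> // i; rewrite -r1 addr0.
have T1E phi i b : inv_fam G Hs phi -> T 1%N phi (sg i b) =
    phi 1%N (sg i false) + phi 1%N (sg (i + m%:Z) false)
    - phi 0%N (sg i false) - phi 0%N (sg i true).
  by move=> /invH[p0 p1 r1]; rewrite /T mul_rot // mul_t; case: b; rewrite ?r1 /=; ring.
have S0E psi i b : inv_fam G Rs psi -> S 0%N psi (sg i b) =
    psi 1%N (sg i false) + psi 0%N (sg i b) + psi 0%N (sg (i + m%:Z) (~~ b)).
  by move=> /invR[p0 p1 r1 _ _]; rewrite /S mul_ref //; case: b; rewrite ?r1.
have S2E psi i b : inv_fam G Rs psi -> S 2%N psi (sg i b) =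
    psum m (fun j => psi 2%N (sg j b)) + psum m (fun j => psi 1%N (sg j false))
    + psum (2 * m) (fun j => psi 0%N (sg j b)) + B * psi 3%N 1%g.
  move=> /invR[p0 p1 r1 p2 c3]; rewrite /S !sum_rot // c3; case: b => //.
  by rewrite [psum m (fun j => psi 1%N (sg j true))](eq_psum _ r1).
have oT : ops G Hs Rs T.
  split=> [[|[|[|[|//]]]] _|phi iv]; try by rewrite /T /=; rcomb_tac.
  have [p0 p1 r1] := invH phi iv; move=> [|[|[|[|//]]]] _; last by [].
  - apply/(right_inv_Cm D) => b i; rewrite /apply_ops /T p1.
    by rewrite (periodic_dvd dm (p0 b)).
  - apply/(right_inv_Dm D); split=> [b i|i]; rewrite /apply_ops !T1E //; last by rewrite addr0.
    have -> : i + m%:Z + m%:Z = i + (2 * m)%N%:Z by lia.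
    by rewrite p1 !p0 [_ + phi 1%N (sg i false)]addrC.
  - apply/(right_inv_Cm D) => b i; rewrite /apply_ops /T !mul_st p0.
    by case: b; rewrite [i + _ + _]addrAC p0.
have oS : ops G Rs Fs S.
  split=> [[|[|[|//]]] _|psi iv]; try by rewrite /S /=; rcomb_tac.
  have [p0 p1 r1 p2 c3] := invR psi iv; move=> [|[|[|//]]] _.
  - apply/(right_inv_Dm D); split=> [b i|i]; rewrite /apply_ops !S0E //.
      by rewrite (periodic_dvd dm (p1 false)) p0 [i + _ + _]addrAC p0.
    have -> : i + m%:Z + m%:Z = i + (2 * m)%N%:Z by lia.
    by rewrite p1 p0 /=; ring.
  - apply/(right_inv_Dm D); split=> [b i|i]; rewrite /apply_ops /S !mul_st !c3.
      by rewrite p2; case: b; rewrite [i + _ + _]addrAC p2.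
    by rewrite addrK; congr (_ + _); rewrite addrC.
  - by apply/(right_inv_Cm D) => b i; rewrite /apply_ops !S2E.
have ST phi : inv_fam G Hs phi -> eq_fam G Fs (apply_ops S (apply_ops T phi)) (fun _ _ => 0).
  move=> iv [|[|[|//]]] g _ /(sg_surj D)[i [b ->]]; have [p0 p1 r1] := invH phi iv; rewrite /apply_ops.
  - rewrite S0E; last exact: oT.2.
    by rewrite T1E // /T; case: b; rewrite /= ?r1 p0; ring.
  - by rewrite /S /T !mul_st; case: b; rewrite /= ?subrK ?addrK; ring.
  - rewrite S2E; last exact: oT.2.
    have -> : psum m (fun j => T 2%N phi (sg j b)) =
        psum m (fun j => phi 0%N (sg j (~~ b))) - psum m (fun j => phi 0%N (sg j b)).
      case: b => /=.
        rewrite -(psum_shift (-1) (p0 false)) -psumN -psumD; apply: eq_psum => j.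
        by rewrite /T mul_st [-1 + j]addrC.
      rewrite -(psum_shift 1 (p0 true)) -psumN -psumD; apply: eq_psum => j.
      by rewrite /T mul_st [1 + j]addrC.
    have -> : psum m (fun j => T 1%N phi (sg j false)) = psum (2 * m) (fun j => phi 1%N (sg j b))
        - psum m (fun j => phi 0%N (sg j false)) - psum m (fun j => phi 0%N (sg j true)).
      have -> : psum (2 * m) (fun j => phi 1%N (sg j b)) =
          psum (2 * m) (fun j => phi 1%N (sg j false)) by case: b => //; apply: eq_psum.
      by rewrite psum_double -!psumN -!psumD; apply: eq_psum => j; rewrite T1E.
    have -> : psum (2 * m) (fun j => T 0%N phi (sg j b)) =
        psum m (fun j => phi 0%N (sg j b)) + psum m (fun j => phi 0%N (sg j b))
        - psum (2 * m) (fun j => phi 1%N (sg j b)).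
      rewrite -[X in X + _ - _]/(psum m _) -[X in _ + X - _](eq_psum m (p0 b)) -psum_double.
      by rewrite -psumN -psumD.
    by rewrite /T; case: b => /=; ring.
apply: (@quasi_permutation_Jlat _ G _ Rs Fs T S) => //.
- by rewrite /all_sub /= (CmG D) (DmG D).
- by rewrite /all_sub /= !(CmG D) (DmG D) subxx.
- by rewrite /all_sub /= (CmG D) !(DmG D).
- by move=> [|[|[|[|//]]]] _; rewrite /T ?subrr //; ring.
- move=> phi iv T0; have [p0 p1 r1] := invH phi iv.
  have e i b : phi 0%N (sg i b) = phi 1%N (sg i b).
    by have /eqP := T0 0%N _ isT (sgin D i b); rewrite subr_eq0 => /eqP.
  have [i|i|c cE] := @const_of_rot_ref (phi 0%N); first by rewrite !e.
    by have /eqP := T0 2%N _ isT (sgin D i false); rewrite /apply_ops /T mul_st subr_eq0 => /eqP.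
  exists c => -[|[|//]] g _ Gg; rewrite -(cE g Gg) //.
  by have [i [b ->]] := sg_surj D Gg; rewrite e.
- move=> psi iv S0; have [p0 p1 r1 p2 c3] := invR psi iv.
  have A0 i b : psi 1%N (sg i false) + psi 0%N (sg i b) + psi 0%N (sg (i + m%:Z) (~~ b)) = 0.
    by have := S0 0%N _ isT (sgin D i b); rewrite /apply_ops S0E.
  have A1 i : psi 2%N (sg i false) + psi 2%N (sg (i + 1) true) + psi 3%N 1%g = 0.
    by have := S0 1%N _ isT (sgin D i false); rewrite /apply_ops /S mul_st c3.
  have A2 b : psum m (fun j => psi 2%N (sg j b)) + psum m (fun j => psi 1%N (sg j false))
    + psum (2 * m) (fun j => psi 0%N (sg j b)) + B * psi 3%N 1%g = 0.
    by have := S0 2%N _ isT (sgin D 0 b); rewrite /apply_ops S2E.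
  pose h b := psum m (fun j => psi 0%N (sg (j + m%:Z) b)).
  have A0' b : psum m (fun j => psi 1%N (sg j false)) + psum m (fun j => psi 0%N (sg j b))
     + h (~~ b) = 0.
    by have := eq_psum m (A0^~ b); rewrite !psumD psumC mulr0.
  have A2' b : psum m (fun j => psi 2%N (sg j b)) + psum m (fun j => psi 1%N (sg j false))
    + (psum m (fun j => psi 0%N (sg j b)) + h b) + B * psi 3%N 1%g = 0.
    by rewrite -psum_double.
  have c0 : psi 3%N 1%g = 0.
    have := A2' true; have := A2' false; have := BE (psi 3%N 1%g).
    have := A0' true; have := A0' false.
    have := eq_psum m A1; rewrite !psumD !psumC mulr0 (psum_shift1 (p2 true)) /=.
    lra.
  (* The second component of the solution is [P - psi 0], and its invariance under t prescribes the
     differences of [P] along t. *)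
  pose E0 (i : int) b : int := psi 0%N (sg i (~~ b)) - psi 0%N (sg i b).
  have [| | | |P [pP q0 q1]] := @potential m E0 (fun i b => psi 2%N (sg i b)) m0 _ p2.
  + move=> b i; have := A0 i b; have := A0 i (~~ b); rewrite /E0 negbK; lra.
  + by move=> i; rewrite /E0 /=; ring.
  + by move=> i; have := A1 i; rewrite c0; lra.
  + rewrite /E0 psumD psumN /=; have := A2' true; have := A0' false; rewrite c0 /=; lra.
  exists (fun k => if k is 0%N then coord P else fun g => coord P g - psi 0%N g).
    move=> [|[|//]] _.
      by apply/(right_inv_Cm D) => b i; rewrite !(coordE _ _ nm pP) pP.
    apply/(right_inv_Dm D); split=> [b i|i]; rewrite !(coordE _ _ nm pP).
      by rewrite p0 (periodic_dvd dm (pP b)).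
    by rewrite addr0 q0 /E0 /=; ring.
  move=> [|[|[|[|//]]]] g _ /(sg_surj D)[i [b ->]]; rewrite /apply_ops /T ?mul_t ?mul_st
    ?c3 ?c0 //.
  + by rewrite opprB addrC subrK.
  + rewrite (mul_rot i b (f := coord P)); last first.
      by move=> c j; rewrite !(coordE _ _ nm pP) (periodic_dvd dm (pP c)).
    rewrite (mul_rot i b p0) !(coordE _ _ nm pP) pP.
    have := A0 i true; have := A0 i false; have := q0 i; rewrite /E0 /=.
    by case: b; rewrite /= ?r1; lra.
  + rewrite !(coordE _ _ nm pP); case: b => /=; last by rewrite q1; ring.
    have := q1 (i - 1); have := A1 (i - 1); rewrite c0 subrK; lra.
- move=> chi iv; have [q0 x0] := (right_inv_Dm D _ _ _).1 (iv 0%N isT).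
  have [q1 x1] := (right_inv_Dm D _ _ _).1 (iv 1%N isT).
  have q2 := (right_inv_Cm D _ _).1 (iv 2%N isT).
  pose X0 := psum (2 * m) (fun j => chi 0%N (sg j true)).
  pose X1 := psum m (fun j => chi 1%N (sg j true)).
  pose y b := chi 2%N (sg 0 b).
  pose c := y false + y true - X0 - X1.
  pose x := comb m (y false - B * c).
  have px : periodic m x := comb_periodic m _.
  pose u (i : int) (b : bool) : int := if b then chi 0%N (sg i true) else 0.
  pose v (i : int) (b : bool) : int := if b then chi 1%N (sg i true) - c - x (i - 1) else x i.
  have pu b : periodic (2 * m) (u^~ b) by case: b => i; rewrite /u ?q0.
  have pv b : periodic m (v^~ b) by case: b => i; rewrite /v ?px // q1 [i + _ - 1]addrAC px.
  exists (fun k => match k with 0%N => coord u | 1%N => fun=> 0 | 2%N => coord v | _ => fun=> c end).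
    move=> [|[|[|[|//]]]] _ //.
    + by apply/(right_inv_Cm D) => b i; rewrite !(coordE _ _ mn pu) pu.
    + by apply/(right_inv_Cm D) => b i; rewrite !(coordE _ _ nm pv) pv.
  move=> [|[|[|//]]] g _ /(sg_surj D)[i [b ->]]; rewrite /apply_ops /S.
  + rewrite (mul_ref i b (f := coord u)); last by move=> b' j; rewrite !(coordE _ _ mn pu) pu.
    by rewrite !(coordE _ _ mn pu); case: b; rewrite /u /= ?x0; ring.
  + by rewrite mul_st !(coordE _ _ nm pv); case: b; rewrite /v /= ?addrK ?x1; ring.
  + rewrite (coord_rot _ _ nm pv) (coord_rot _ _ mn pu) (periodic1 _ (q2 b)) -/(y b) sumr_const mul0rn.
    have px' : psum m x = y false - B * c := psum_comb _ m0.
    have px1 : psum m (fun j => x (j - 1)) = y false - B * c.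
      by rewrite -px' -(psum_shift (-1) px); apply: eq_psum => j; rewrite addrC.
    have Bc := BE c; have cE : c = y false + y true - X0 - X1 by [].
    case: b; rewrite /u /v /= ?psumD ?psumN ?psumC ?px1 ?px' -/X0 -/X1.
      by move: Bc cE; move: (c) => *; lra.
    ring.
Qed.

End QuasiPermutation.

(** * Invariant vectors of prescribed augmentation *)

Section Reach.
Local Open Scope ring_scope.
Variables (gT : finGroupType) (G : {group gT}).
Implicit Types Hs Rs : seq {group gT}.

(* The permutation module on Hs contains an H'-invariant vector of augmentation z. *)
Definition reach Hs (H' : {set gT}) (z : int) :=
  exists F, [/\ rcomb G Hs F, forall phi, inv_fam G Hs phi -> right_inv G (F phi) H' &
                F (fun _ _ => 1) 1%g = z].

Lemma reach_mono Hs (H H' : {set gT}) z : H' \subset H -> reach Hs H z -> reach Hs H' z.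
Proof.
move=> /subsetP sH [F [rF iF F1]]; exists F; split=> // phi iv g h Gg Hh.
by apply: iF => //; apply: sH.
Qed.

Lemma reach_mem Hs (H : {group gT}) : H \in Hs -> reach Hs H 1.
Proof.
move=> mH; pose k := index H Hs; have ks : (k < size Hs)%N by rewrite index_mem.
exists (fun phi g => phi k g); split=> //; first exact: rcomb_id.
by move=> phi iv; have := iv k ks; rewrite nth_index.
Qed.

Lemma reach0 Hs H : reach Hs H 0.
Proof. by exists (fun _ _ => 0); split=> //; apply: rcomb0. Qed.

Lemma reachD Hs H z z' a b : reach Hs H z -> reach Hs H z' -> reach Hs H (a * z + b * z').
Proof.
move=> [F [rF iF <-]] [F' [rF' iF' <-]].
exists (fun phi g => a * F phi g + b * F' phi g); split=> //.
  by apply: rcomb_add; apply: rcomb_scale.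
by move=> phi iv g h Gg Hh; rewrite iF // iF'.
Qed.

Lemma reach_gcd Hs H (p q : nat) : reach Hs H p%:Z -> reach Hs H q%:Z -> reach Hs H (gcdn p q)%:Z.
Proof.
move=> rp rq; have [u [v e]] := Bezoutz p%:Z q%:Z.
by have := reachD u v rp rq; rewrite e.
Qed.

Lemma reach_coprime Hs H (p q : nat) : coprime p q ->
  reach Hs H p%:Z -> reach Hs H q%:Z -> reach Hs H 1.
Proof. by move=> /eqP cpq rp rq; have := reach_gcd rp rq; rewrite cpq. Qed.

Lemma reach_ops Hs Rs : (forall R, R \in Rs -> reach Hs R 1) ->
  exists T, ops G Hs Rs T /\ forall l, (l < size Rs)%N -> T l (fun _ _ => 1) 1%g = 1.
Proof.
move=> rR; have /fin_all_exists[f fP] : forall i : 'I_(size Rs), exists F,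
    [/\ rcomb G Hs F, forall phi, inv_fam G Hs phi -> right_inv G (F phi) (nth 1%G Rs i) &
                F (fun _ _ => 1) 1%g = 1] by move=> i; apply/rR/mem_nth.
pose T l := if insub l is Some i then f i else fun _ _ => 0.
have TE l (ls : (l < size Rs)%N) : T l = f (Ordinal ls) by rewrite /T insubT.
exists T; split=> [|l ls]; last by rewrite TE; case: (fP (Ordinal ls)).
split=> [l ls|phi iv l ls]; rewrite ?/apply_ops TE; first by case: (fP (Ordinal ls)).
by case: (fP (Ordinal ls)) => _ + _; apply.
Qed.

Lemma similar_reach Hs Rs : all_sub G Hs -> all_sub G Rs ->
  (forall R, R \in Rs -> reach Hs R 1) -> (forall H, H \in Hs -> reach Rs H 1) ->
  lat_similar G (Jlat G Hs) (Jlat G Rs).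
Proof.
move=> sHs sRs /reach_ops[T [oT T1]] /reach_ops[S [oS S1]].
exact: similar_Jlat oT oS T1 S1.
Qed.

End Reach.

(** * Subgroups of the dihedral group and transfers between them *)

Section DihedralReach.
Local Open Scope ring_scope.
Variables (gT : finGroupType) (G : {group gT}) (n : nat) (s t : gT).
Hypothesis D : dihedral G n s t.
Local Notation sg := (sg n s t).
Local Notation Cm := (Cm s).
Local Notation Dm := (Dm s t).
Implicit Types Hs Rs : seq {group gT}.

(** The coordinate criterion is itself a right-invariant function, so its value on the subgroup is
    its value at 1; this spares an enumeration of the generated group. *)
Lemma mem_Dm m x i b : (m %| n)%N ->
  (sg i b \in Dm m x) = (m %| i - (if b then x%:Z else 0))%Z.
Proof.
move=> mn; pose u (i : int) (b : bool) := (m %| i - (if b then x%:Z else 0))%Z.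
have pu b' : periodic m (u^~ b') by move=> j; rewrite /u addrAC rpredDr ?dvdzz.
have pn b' : periodic n (u^~ b') := periodic_dvd mn (pu b').
apply/idP/idP => [h|/dvdzP[q e]].
  have : right_inv G (of_coord n s t u) (Dm m x).
    apply/(right_inv_Dm D); split=> [c j|j]; rewrite !(of_coordE D) ?pu //.
    by rewrite /u addrK subr0.
  move=> /(_ 1%g _ (group1 G) h); rewrite mul1g -(sg1 D) !(of_coordE D) //.
  by rewrite /u subr0 dvdz0.
have sm : sg m%:Z false \in Dm m x by rewrite -(sgX D) mem_gen // !inE eqxx.
have smq : sg (q * m%:Z) false \in Dm m x.
  elim/int_rec: q {e} => [|q IH|q IH].
  - by rewrite mul0r (sg1 D) group1.
  - have -> : sg (q.+1%:Z * m%:Z) false = (sg (q%:Z * m%:Z) false * sg m%:Z false)%g.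
      by rewrite (sgM D); congr sg; ring.
    by rewrite groupM.
  - have -> : sg (- q.+1%:Z * m%:Z) false = (sg (- q%:Z * m%:Z) false * (sg m%:Z false)^-1)%g.
      by apply: (mulIg (sg m%:Z false)); rewrite mulgKV (sgM D); congr sg; ring.
    by rewrite groupM // groupV.
case: b e => /= e; last by have -> : i = q * m%:Z by lia.
have -> : sg i true = (sg (q * m%:Z) false * sg x%:Z true)%g.
  by rewrite (sgM D) /=; congr sg; lia.
by rewrite groupM // -(sgXt D) mem_gen // !inE eqxx orbT.
Qed.

Lemma mem_Cm m i b : (m %| n)%N -> (sg i b \in Cm m) = ~~ b && (m %| i)%Z.
Proof.
move=> mn; apply/idP/idP => [h|].
  have pb c : periodic m ((fun (i : int) c => ~~ c && (m %| i)%Z)^~ c).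
    by move=> j; rewrite /= rpredDr ?dvdzz.
  have pn c := periodic_dvd mn (pb c).
  have : right_inv G (of_coord n s t (fun i c => ~~ c && (m %| i)%Z)) (Cm m).
    by apply/(right_inv_Cm D) => c j; rewrite !(of_coordE D) ?pb.
  move=> /(_ 1%g _ (group1 G) h); rewrite mul1g -(sg1 D) !(of_coordE D) //.
  by move=> /= ->; rewrite dvdz0.
case: b => //= mi; have [k ek] := int_mod_nat D i.
rewrite (sgE D _ ek) mulg1.
have /dvdnP[q ->] : (m %| k)%N.
  rewrite -[(m %| k)%N]/(m%:Z %| k%:Z)%Z.
  have -> : k%:Z = i - (i - k%:Z) by ring.
  apply: rpredB => //; apply: dvdz_trans (_ : (n %| i - k%:Z)%Z); first by [].
  by rewrite -eqz_mod_dvd; apply/eqP.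
by rewrite mulnC expgM mem_cycle.
Qed.

Lemma order_s : #[s]%g = n.
Proof.
have n0 : (0 < n)%N by case: D.
apply/eqP; rewrite eqn_dvd; apply/andP; split.
  by rewrite order_dvdn; case: D => _ _ _ [-> _ _].
have : sg #[s]%g%:Z false = sg 0 false by rewrite -(sgX D) expg_order (sg1 D).
by move=> /(sg_inj D)[/eqP + _]; rewrite eqz_mod_dvd subr0.
Qed.

Lemma card_Cm m : (m %| n)%N -> #|Cm m| = (n %/ m)%N.
Proof.
move=> mn; rewrite -[#|_|]/(#[(s ^+ m)%g])%g orderXdiv order_s //.
Qed.

Lemma index_Cm m : (m %| n)%N -> #|G : Cm m|%g = (2 * m)%N.
Proof.
move=> mn; have [n0 _ cG _] := D; have m0 := dvdn_gt0 n0 mn.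
have := Lagrange (CmG D m); rewrite card_Cm // cG => e.
have q0 : (0 < n %/ m)%N by rewrite divn_gt0 // dvdn_leq.
by apply/eqP; rewrite -(eqn_pmul2l q0) e mulnCA divnK.
Qed.

Lemma index_Dm m x : (m %| n)%N -> #|G : Dm m x|%g = m.
Proof.
move=> mn; have [n0 _ cG _] := D; have m0 := dvdn_gt0 n0 mn.
have sCD : Cm m \subset Dm m x by rewrite cycle_subG mem_gen // !inE eqxx.
have cD : #|Dm m x| = (2 * (n %/ m))%N.
  rewrite -(cardsID (Cm m)) (setIidPr sCD) card_Cm // mul2n -addnn; congr (_ + _)%N.
  have -> : Dm m x :\: Cm m = (Cm m :* sg x%:Z true)%g.
    apply/setP=> g; rewrite in_setD mem_rcoset; apply/andP/idP => [[nC Dg]|].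
      have Gg := subsetP (DmG D m x) _ Dg; move: nC Dg.
      have [i [b ->]] := sg_surj D Gg.
      have -> : (sg x%:Z true)^-1%g = sg x%:Z true.
        by apply: (mulgI (sg x%:Z true)); rewrite mulgV (sgM D) subrr (sg1 D).
      rewrite (sgM D) !mem_Cm // mem_Dm //; case: b => //=.
      by rewrite subr0 => /negP.
    move=> h; have hG := subsetP (CmG D m) _ h.
    have [i [b e]] := sg_surj D hG; move: h.
    have -> : g = (sg i b * sg x%:Z true)%g by rewrite -e mulgKV.
    rewrite mulgK (sgM D) !mem_Cm // mem_Dm //; case: b {e} => //= mi.
    by rewrite addrK.
  by rewrite card_rcoset card_Cm.
have := Lagrange (DmG D m x); rewrite cD cG => e.
have q0 : (0 < 2 * (n %/ m))%N by rewrite muln_gt0 /= divn_gt0 // dvdn_leq.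
by apply/eqP; rewrite -(eqn_pmul2l q0) e -mulnA divnK.
Qed.

(** The least positive exponent of a rotation in [H] determines its rotations, and one reflection,
    if there is any, determines the rest. *)
Lemma subgroup_cases (H : {group gT}) : H \subset G ->
  exists m, (m %| n)%N /\ (H = Cm m \/ exists2 x, (x < n)%N & H = Dm m x).
Proof.
move=> /subsetP sHG; have [n0 _ cG [sn _ _]] := D.
have exk : exists k, (0 < k)%N && (s ^+ k \in H)%g by exists n; rewrite n0 sn group1.
case: (ex_minnP exk) => m /andP[m0 mH] mmin.
have mE k : (s ^+ k \in H)%g = (m %| k)%N.
  apply/idP/idP => [kH|/dvdnP[q ->]]; last by rewrite mulnC expgM groupX.
  have : (s ^+ (k %% m) \in H)%g.
    move: kH; rewrite {1}(divn_eq k m) expgD mulnC expgM groupMl //.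
    by rewrite groupX.
  rewrite /dvdn; case: (posnP (k %% m)) => [-> //|r0] rH.
  by have := mmin (k %% m)%N; rewrite r0 rH => /(_ isT); rewrite leqNgt ltn_pmod.
have mn : (m %| n)%N by rewrite -mE sn group1.
have rotE i : sg i false \in H -> (m %| i)%Z.
  have [k ek] := int_mod_nat D i; rewrite (sgE D _ ek) mulg1 mE => mk.
  have -> : i = (i - k%:Z) + k%:Z by ring.
  apply: rpredD; last by [].
  apply: dvdz_trans (_ : (n %| i - k%:Z)%Z); first by [].
  by rewrite -eqz_mod_dvd; apply/eqP.
exists m; split=> //.
case: (pickP (fun x : 'I_n => sg x%:Z true \in H)) => [x xH|noref]; [right|left].
  exists x; first exact: ltn_ord.
  apply: val_inj; apply/setP=> g /=; apply/idP/idP => [Hg|].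
    have [i [b e]] := sg_surj D (sHG _ Hg).
    rewrite -[g \in _]/(g \in Dm m x) e mem_Dm //; rewrite e in Hg; case: b {e} Hg => Hg.
      by have := groupM Hg xH; rewrite (sgM D) => /rotE.
    by rewrite subr0 rotE.
  apply/subsetP; rewrite gen_subG; apply/subsetP=> y; rewrite !inE => /orP[]/eqP-> //.
  by rewrite (sgXt D).
apply: val_inj; apply/setP=> g /=; apply/idP/idP => [Hg|].
  have [i [b e]] := sg_surj D (sHG _ Hg); rewrite e in Hg.
  rewrite -[g \in _]/(g \in Cm m) e mem_Cm //; case: b {e} Hg => Hg; last exact: rotE.
  have [k ek] := int_mod_nat D i; have := noref (Ordinal (ltn_pmod k n0)).
  rewrite /= (sg_nat D) expg_mod // -(sgE D _ ek) Hg //.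
by move: g; apply/subsetP; rewrite cycle_subG.
Qed.

Lemma atom_index Hs (H : {group gT}) : H \in Hs ->
  exists2 k, (k < size Hs)%N & forall (phi : nat -> gT -> int), inv_fam G Hs phi -> right_inv G (phi k) H.
Proof.
move=> mH; have ks : (index H Hs < size Hs)%N by rewrite index_mem.
by exists (index H Hs) => // phi iv; have := iv _ ks; rewrite nth_index.
Qed.

(** The transfer along the q cosets of <s^(mq)> in <s^m>. *)
Lemma reach_C Hs m q : Cm (m * q) \in Hs -> reach G Hs (Cm m) q%:Z.
Proof.
move=> /atom_index[k ks iH].
exists (fun phi g => \sum_(i < q) phi k (g * sg (0 + i%:Z * m%:Z) false)%g); split.
- by apply: rcomb_sum => i; apply: rcomb_atom => //; apply: (sgin D).
- move=> phi /iH/(right_inv_Cm D) p; apply/(right_inv_Cm D) => b i.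
  by rewrite !(sum_steps D) //; case: b; rewrite [_ + _ + _]addrAC (steps_periodic (p _)).
- by rewrite sumr_const card_ord -mulr_natl mulr1 natz.
Qed.

(** Conjugation by s^k adds 2k to the exponent of a reflection; it is followed by the transfer of
    degree q. *)
Lemma reach_D Hs m q x y (k : int) : Dm (m * q) x \in Hs -> (m %| x%:Z + 2 * k - y%:Z)%Z ->
  reach G Hs (Dm m y) q%:Z.
Proof.
move=> /atom_index[l ls iH] /dvdzP[r re].
exists (fun phi g => \sum_(i < q) phi l (g * sg (k + i%:Z * m%:Z) false)%g); split.
- by apply: rcomb_sum => i; apply: rcomb_atom => //; apply: (sgin D).
- move=> phi /iH/(right_inv_Dm D)[p rx]; apply/(right_inv_Dm D); split=> [b i|i].
    by rewrite !(sum_steps D) //; case: b; rewrite [_ + _ + _]addrAC (steps_periodic (p _)).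
  rewrite !(sum_steps D) //=.
  have -> : i + y%:Z - k = (i + k - r * m%:Z) + x%:Z by lia.
  rewrite -steps_add (eq_steps _ _ rx) -mulNr.
  by rewrite (periodicM (steps_periodic (p false))).
- by rewrite sumr_const card_ord -mulr_natl mulr1 natz.
Qed.

(** The transfer from <s^(mq)> to the dihedral group, in which it has 2q cosets: q of rotations and
    q of reflections. *)
Lemma reach_rot Hs (H : {group gT}) m q y : Cm (m * q) \subset H -> H \in Hs ->
  reach G Hs (Dm m y) (2 * q)%N%:Z.
Proof.
move=> sCH /atom_index[l ls iH].
exists (fun phi g => \sum_(i < q) phi l (g * sg (0 + i%:Z * m%:Z) false)%g
  + \sum_(i < q) phi l (g * sg y%:Z true * sg (0 + i%:Z * m%:Z) false)%g); split.
- apply: rcomb_add; apply: rcomb_sum => i; first by apply: rcomb_atom => //; apply: (sgin D).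
  have [t' [tv tE]] := @rcomb_atom _ G Hs l (sg y%:Z true * sg (0 + i%:Z * m%:Z) false)%g ls
    (groupM (sgin D _ _) (sgin D _ _)).
  exists t'; split=> // phi g; rewrite -tE; congr (phi l _); exact/esym/mulgA.
- move=> phi iv; have {iv} p : forall b, periodic (m * q) (fun i => phi l (sg i b)).
    by apply/(right_inv_Cm D) => g h Gg Hh; rewrite (iH _ iv) // (subsetP sCH).
  have E i b : \sum_(j < q) phi l (sg i b * sg (0 + j%:Z * m%:Z) false)%g
      + \sum_(j < q) phi l (sg i b * sg y%:Z true * sg (0 + j%:Z * m%:Z) false)%g =
      steps m q (fun j => phi l (sg j b)) i +
      steps m q (fun j => phi l (sg j (~~ b))) (if b then i - y%:Z else i + y%:Z).
    rewrite [(sg i b * sg _ true)%g](sgM D) addbT !(sum_steps D) //.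
    by case: b; rewrite ?subr0 ?addr0.
  apply/(right_inv_Dm D); split=> [b i|i]; rewrite !E.
    by case: b; rewrite (steps_periodic (p _)) [i + _ + _]addrAC (steps_periodic (p _)).
  by rewrite /= addrK addrC.
- by rewrite !sumr_const card_ord -mulr_natl mulr1 natz; lia.
Qed.

End DihedralReach.

(** * Locally trivial classes and similarity; cocycles modulo constants *)

Section SimilarCocycles.
Local Open Scope ring_scope.
Variables (gT : finGroupType) (G K : {group gT}).
Hypothesis sKG : K \subset G.

(** A locally trivial class on L + R1 has locally trivial components, hence is trivial; [M] is a
    retract of L + R1 through the isomorphism with M + R2. *)
Lemma locally_trivial_similar (L M : lattice gT) : lat_similar G L M ->
  locally_trivial_trivial K L -> locally_trivial_trivial K M.
Proof.
move=> [R1 [R2 [pR1 pR2 iso]]] lL.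
have [B [A [hB BA AB]]] := Giso_sym iso; have hA := Ghom_inv hB BA AB.
have lS : locally_trivial_trivial K (lsum L R1).
  move=> b bc bl.
  have split2 (g : gT) (v : 'cV[rat]_(lrk (lsum L R1))) :
      ratm (lrep (lsum L R1) g) *m v =
      col_mx (ratm (lrep L g) *m usubmx v) (ratm (lrep R1 g) *m dsubmx v).
    by rewrite -{1}[v]vsubmxK /ratm /= map_block_mx !map_mx0 mul_block_col !mul0mx addr0 add0r.
  have int_col (v : 'cV[rat]_(lrk L)) (w : 'cV[rat]_(lrk R1)) : intm (col_mx v w) = intm v && intm w.
    apply/mxOverP/andP => [h|[/mxOverP hv /mxOverP hw] i j].
      split; apply/mxOverP=> i j; first by have := h (lshift _ i) j; rewrite col_mxEu.
      by have := h (rshift _ i) j; rewrite col_mxEd.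
    by rewrite mxE; case: splitP => i' _.
  have colB (v v' : 'cV[rat]_(lrk L)) (w w' : 'cV[rat]_(lrk R1)) :
      col_mx v w - col_mx v' w' = col_mx (v - v') (w - w').
    by rewrite opp_col_mx add_col_mx.
  have [|g Kg|f1 f1P] := lL (fun g => usubmx (b g)).
  - move=> g h Kg Kh; have := bc g h Kg Kh.
    rewrite split2 -[b (g * h)%g]vsubmxK -[b g]vsubmxK !colB int_col.
    by rewrite !col_mxKu => /andP[].
  - have [f] := bl g Kg; rewrite split2 -{1}[b g]vsubmxK -{3}[f]vsubmxK !colB int_col.
    by move=> /andP[h _]; exists (usubmx f).
  have [|g Kg|f2 f2P] := locally_trivial_permutation sKG pR1 (b := fun g => dsubmx (b g)).
  - move=> g h Kg Kh; have := bc g h Kg Kh.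
    rewrite split2 -[b (g * h)%g]vsubmxK -[b g]vsubmxK !colB int_col.
    by rewrite !col_mxKd => /andP[].
  - have [f] := bl g Kg; rewrite split2 -{1}[b g]vsubmxK -{3}[f]vsubmxK !colB int_col.
    by move=> /andP[_ h]; exists (dsubmx f).
  exists (col_mx f1 f2) => g Kg; rewrite split2 col_mxKu col_mxKd -[b g]vsubmxK !colB int_col.
  by rewrite f1P // f2P.
pose i1 : 'M[int]_(lrk (lsum M R2), lrk M) := col_mx 1%:M 0.
pose p1 : 'M[int]_(lrk M, lrk (lsum M R2)) := row_mx 1%:M 0.
have hi1 : @Ghom _ G M (lsum M R2) i1.
  by move=> g _ /=; rewrite mul_col_mx mul_block_col !mulmx0 !mul0mx mul1mx mulmx1 !addr0.
have hp1 : @Ghom _ G (lsum M R2) M p1.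
  by move=> g _ /=; rewrite mul_row_block mul_mx_row !mulmx0 !mul0mx mul1mx mulmx1 !addr0.
apply: (@locally_trivial_retract _ G K M (lsum L R1) (B *m i1) (p1 *m A)) => //.
- exact: Ghom_comp hi1 hB.
- exact: Ghom_comp hA hp1.
- by rewrite mulmxA -(mulmxA p1) AB mulmx1 mul_row_col mulmx0 mulmx1 addr0.
Qed.

Local Notation cs Hs := (coset_seq G Hs).
Local Notation c0 := (0%N, set0 : {set gT}).

Lemma intm_jvec Hs (phi : nat -> gT -> rat) : Hs != [::] -> all_sub G Hs -> inv_fam G Hs phi ->
  intm (jvec G Hs phi) <->
  exists c, forall k x, (k < size Hs)%N -> x \in G -> phi k x - c \is a Num.int.
Proof.
move=> Hs0 sHs iv; have N0 := coset_seq_nonempty G Hs0; split=> [/mxOverP h|[c cE]].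
  exists (at_coset phi (nth c0 (cs Hs) 0)) => k x ks Gx.
  rewrite -(at_cosetE sHs iv ks Gx); have mc := index_coset_seq ks Gx.
  rewrite -{1}(nth_index c0 mc); move: mc; rewrite -index_mem.
  case: (index _ _) => [|i] lti; first by rewrite subrr rpred0.
  have lti' : (i < (size (cs Hs)).-1)%N by case: (size _) lti.
  by have := h (Ordinal lti') 0; rewrite mxE.
apply/mxOverP=> i j; rewrite mxE.
have [k [x [ks Gx ex ec]]] := nth_coset_seq sHs (ltn_predS (ltn_ord i)).
have [k' [x' [ks' Gx' ex' ec']]] := nth_coset_seq sHs N0.
rewrite /at_coset -ex -ex' ec ec' /=.
have -> : phi k x - phi k' x' = (phi k x - c) - (phi k' x' - c) by ring.
by apply: rpredB; apply: cE.
Qed.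

Lemma jvecB Hs (phi psi : nat -> gT -> rat) :
  jvec G Hs (fun k x => phi k x - psi k x) = jvec G Hs phi - jvec G Hs psi.
Proof. by apply/matrixP=> i j; rewrite !mxE /at_coset; ring. Qed.

(** A cocycle in J (x) Q/Z is a family of functions satisfying the cocycle identity up to constants
    [gamma]. If it bounds, the constants [c g] bound [gamma], and wherever [g] fixes a coset, [c g]
    is the value of [beta g] there modulo Z. The obstructions play these two facts against each
    other. *)
Lemma locally_trivial_Jlat Hs (beta : gT -> nat -> gT -> rat) (gamma : gT -> gT -> rat) :
    Hs != [::] -> all_sub G Hs -> locally_trivial_trivial K (Jlat G Hs) ->
    {in K, forall g, inv_fam G Hs (beta g)} ->
    {in K &, forall g h k x, (k < size Hs)%N -> x \in G ->
       beta (g * h)%g k x - beta g k x - beta h k (g^-1 * x)%g - gamma g h \is a Num.int} ->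
    {in K, forall g, exists f c, inv_fam G Hs f /\
       forall k x, (k < size Hs)%N -> x \in G ->
       beta g k x - (f k (g^-1 * x)%g - f k x) - c \is a Num.int} ->
  exists f c, [/\ inv_fam G Hs f, {in K, forall g k x, (k < size Hs)%N -> x \in G ->
       beta g k x - (f k (g^-1 * x)%g - f k x) - c g \is a Num.int} &
     {in K &, forall g h, c (g * h)%g - c g - c h - gamma g h \is a Num.int}].
Proof.
move=> Hs0 sHs lJ ib bc bl; have sK := subsetP sKG.
have invB (phi psi : nat -> gT -> rat) : inv_fam G Hs phi -> inv_fam G Hs psi ->
    inv_fam G Hs (fun k x => phi k x - psi k x).
  by move=> i1 i2 k ks x h Gx Hh; rewrite i1 // i2.
have [|g Kg|F FP] := lJ (fun g => jvec G Hs (beta g)).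
- move=> g h Kg Kh; rewrite [ratm _ *m _]jvec_translate ?sK //; last exact: (ib).
  rewrite -!jvecB; apply/intm_jvec => //; last first.
    by exists (gamma g h) => k x ks Gx; apply: bc.
  apply: (invB); first by apply: (invB); apply: (ib) => //; apply: groupM.
  by apply: inv_fam_translate; rewrite ?sK //; apply: (ib).
- have [f [c [fi fP]]] := bl g Kg; exists (jvec G Hs f).
  rewrite [ratm _ *m _]jvec_translate ?sK // -!jvecB; apply/intm_jvec => //; last first.
    by exists c => k x ks Gx; apply: fP.
  apply: (invB); first exact: (ib).
  by apply: (invB) => //; apply: inv_fam_translate; rewrite ?sK.
pose f := jfam F; have fi : inv_fam G Hs f by apply: inv_jfam.
have FE : F = jvec G Hs f by rewrite jvecK.
have cP g : exists c, g \in K -> forall k x, (k < size Hs)%N -> x \in G ->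
    beta g k x - (f k (g^-1 * x)%g - f k x) - c \is a Num.int.
  case: (boolP (g \in K)) => [Kg|_]; last by exists 0.
  have iv : inv_fam G Hs (fun k x => beta g k x - (translate g f k x - f k x)).
    apply: (invB); first exact: (ib).
    by apply: (invB) => //; apply: inv_fam_translate; rewrite ?sK.
  have := FP g Kg; rewrite FE [ratm _ *m _]jvec_translate ?sK // -!jvecB.
  by move=> /(intm_jvec Hs0 sHs iv)[c cE]; exists c.
have /fin_all_exists[c cE] := cP.
exists f, c; split=> [//|g Kg k x|g h Kg Kh]; first exact: cE.
have k0s : (0 < size Hs)%N by case: (Hs) Hs0.
have h1 := cE _ (groupM Kg Kh) 0%N 1%g k0s (group1 G); rewrite invMg -mulgA in h1.
have h2 := cE _ Kg 0%N 1%g k0s (group1 G).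
have Gg : (g^-1 * 1)%g \in G by rewrite mulg1 groupV sK.
have h3 := cE _ Kh 0%N _ k0s Gg.
have h4 := bc _ _ Kg Kh 0%N 1%g k0s (group1 G).
have -> : c (g * h)%g - c g - c h - gamma g h =
  (beta (g * h)%g 0%N 1%g - beta g 0%N 1%g - beta h 0%N (g^-1 * 1)%g - gamma g h)
  - (beta (g * h)%g 0%N 1%g - (f 0%N (h^-1 * (g^-1 * 1))%g - f 0%N 1%g) - c (g * h)%g)
  + (beta g 0%N 1%g - (f 0%N (g^-1 * 1)%g - f 0%N 1%g) - c g)
  + (beta h 0%N (g^-1 * 1)%g - (f 0%N (h^-1 * (g^-1 * 1))%g - f 0%N (g^-1 * 1)%g) - c h) by ring.
by apply: rpredD => //; apply: rpredD => //; apply: rpredB.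
Qed.

End SimilarCocycles.

(** * Two obstructions carried by a dihedral subgroup *)

Section Obstructions.
Local Open Scope ring_scope.
Variables (gT : finGroupType) (G : {group gT}) (n : nat) (s t : gT).
Hypothesis D : dihedral G n s t.
Local Notation sg := (sg n s t).
Local Notation Cm := (Cm s).
Local Notation Dm := (Dm s t).
Local Notation coord := (of_coord n s t).
Implicit Types Hs : seq {group gT}.

Definition par (z : int) : bool := (z %% 2)%Z == 1.

Lemma parD u v : par (u + v) = par u (+) par v. Proof. rewrite /par; lia. Qed.
Lemma parN u : par (- u) = par u. Proof. rewrite /par; lia. Qed.
Lemma par_even u (m : nat) : ~~ odd m -> par (u * m%:Z) = false.
Proof. move=> em; rewrite /par -[m](odd_double_half) (negbTE em); lia. Qed.

Section Subgroup.
Variables (m j : nat).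
Hypothesis m2n : (2 * m %| n)%N.

Let mn : (m %| n)%N. Proof. exact: dvdn_trans (dvdn_mull 2 (dvdnn m)) m2n. Qed.
Let n0 : (0 < n)%N. Proof. by case: D. Qed.
Let m0 : (0 < m)%N. Proof. exact: dvdn_gt0 n0 mn. Qed.

(** Coordinates on K = <s^m, s^j t>; the pair (par u, b) is the image in the Klein quotient by
    <s^(2m)>. *)
Definition elt (u : int) (b : bool) : gT := sg (u * m%:Z + (if b then j%:Z else 0)) b.

Lemma eltP g : g \in Dm m j -> exists u b, g = elt u b.
Proof.
move=> Dg; have [a [b e]] := sg_surj D (subsetP (DmG D m j) _ Dg).
rewrite e (mem_Dm D) // in Dg; case/dvdzP: Dg => u ue; exists u, b.
by rewrite e /elt -ue subrK.
Qed.

Lemma elt_in u b : elt u b \in Dm m j.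
Proof. by rewrite (mem_Dm D) // addrK dvdz_mull. Qed.

Lemma eltM u b v c : (elt u b * elt v c)%g = elt (if b then u - v else u + v) (b (+) c).
Proof.
rewrite (sgM D) /elt; congr sg; case: b; case: c => /=; ring.
Qed.

Lemma eltV u b : (elt u b)^-1%g = elt (if b then u else - u) b.
Proof.
apply: (mulgI (elt u b)); rewrite mulgV eltM addbb; case: b; rewrite subrr /elt mul0r addr0.
all: by rewrite (sg1 D).
Qed.

(** Exponents are known modulo n; as 2m divides n, the parity of u is well defined. *)
Lemma elt_par_inj u b v c : elt u b = elt v c -> par u = par v /\ b = c.
Proof.
move=> /(sg_inj D)[/eqP + e]; rewrite -{}e eqz_mod_dvd => /dvdzP[q].
have -> : u * m%:Z + (if b then j%:Z else 0) - (v * m%:Z + (if b then j%:Z else 0)) =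
   (u - v) * m%:Z by ring.
case/dvdnP: m2n => r nr; rewrite nr !PoszM => e; split=> //.
have : (u - v) = q * r%:Z * 2.
  by apply: (@mulIf _ m%:Z); [lia | rewrite e; ring].
by rewrite /par; lia.
Qed.

(** A finite search, since u is not determined by [g]: reducing u modulo 2n changes neither
    [elt u b] nor the parity of u. *)
Definition rot_par (g : gT) : bool :=
  [exists u : 'I_(2 * n), par u%:Z && ((g == elt u%:Z false) || (g == elt u%:Z true))].

Lemma rot_parE u b : rot_par (elt u b) = par u.
Proof.
have pu c : periodic (2 * n) (elt^~ c).
  move=> v; rewrite /elt -[RHS](periodicM (sg_per n s t c) _ (2 * m%:Z)).
  by congr sg; rewrite PoszM; ring.
apply/existsP/idP => [[v /andP[pv /orP[]/eqP/elt_par_inj[-> _] //]]|hu].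
have ltv : (`|(u %% (2 * n)%N)%Z| < 2 * n)%N.
  by have := ltz_pmod u (_ : 0 < (2 * n)%N%:Z); lia.
exists (Ordinal ltv) => /=; have -> : `|(u %% (2 * n)%N)%Z|%N%:Z = (u %% (2 * n)%N)%Z.
  by rewrite gez0_abs // modz_ge0 //; lia.
rewrite !(periodic_modz (pu _)); apply/andP; split; last by case: (b); rewrite eqxx ?orbT.
have [q qE] : exists q, (u %% (2 * n)%N)%Z = u - q * n%:Z * 2.
  by exists (u %/ (2 * n)%N)%Z; have := divz_eq u (2 * n)%N; rewrite PoszM; lia.
by move: hu; rewrite qE /par; lia.
Qed.

(* Two-valued functions on G/H detecting the quotient of <s^m, s^j t> by <s^2m>. *)
Definition ref_fun (H : {set gT}) (e : gT -> bool) :=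
  right_inv G e H /\ forall u b, {in G, forall x, e (elt u b * x)%g = e x (+) b}.
Definition rot_fun (H : {set gT}) (p : gT -> bool) :=
  right_inv G p H /\ forall u, {in G, forall x, p (elt u false * x)%g = p x (+) par u}.

Definition half (b : bool) : rat := if b then 1 / 2 else 0.

Lemma half_int b : half b \is a Num.int -> b = false.
Proof. by case: b. Qed.

(* The alternating class of the Klein four-group: every cyclic subgroup
   trivialises it, and all stabilizers lie in the kernel. *)
Lemma obstruction_alternating Hs (e p : nat -> gT -> bool) : Hs != [::] -> all_sub G Hs ->
    (forall k, (k < size Hs)%N -> ref_fun (nth 1%G Hs k) (e k)) ->
    (forall k, (k < size Hs)%N -> rot_fun (nth 1%G Hs k) (p k)) ->
    (exists2 H, H \in Hs & elt 2 false \in H) ->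
  ~ locally_trivial_trivial (Dm m j) (Jlat G Hs).
Proof.
move=> Hs0 sHs eP pP [H0 mH0 fixH0] lJ.
pose beta g k x := half (rot_par g && e k x).
pose g2 g := g \notin Cm m.
have g2E u b : g2 (elt u b) = b.
  by rewrite /g2 (mem_Cm D) //; case: b => //=; rewrite addr0 dvdz_mull.
(* The cup product of the two characters of the Klein quotient: the failure of [beta] to be a
   cocycle before constants are divided out. *)
pose gamma g h := half (rot_par h && g2 g).
have [|||f [c [fi fP cM]]] := @locally_trivial_Jlat _ _ _ (DmG D m j) Hs beta gamma Hs0 sHs lJ.
- by move=> g _ k ks x h Gx Hh; rewrite /beta (proj1 (eP k ks)).
- move=> _ _ /eltP[u [b ->]] /eltP[v [b' ->]] k x ks Gx.
  rewrite eltV eltM /beta /gamma !rot_parE (proj2 (eP k ks)) // g2E.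
  have -> : par (if b then u - v else u + v) = par u (+) par v.
    by case: b; rewrite parD ?parN.
  by case: (par u); case: (par v); case: (e k x); case: b; rewrite /half /=.
- move=> _ /eltP[u [b ->]].
  (* A rotation keeps [e] and shifts [p] by its parity, so the product with [p] bounds. A reflection
     exchanges the two values of [e]; weights of a quarter then produce the half, up to a constant
     quarter. *)
  pose f k x := if b then - (half (rot_par (elt u b) && e k x) / 2)
                else half [&& rot_par (elt u b), e k x & p k x].
  exists f, (if b then half (rot_par (elt u b)) / 2 else 0); split.
    by move=> k ks x h Gx Hh; rewrite /f (proj1 (eP k ks)) // (proj1 (pP k ks)).
  move=> k x ks Gx; rewrite /f /beta eltV (proj2 (eP k ks)) // rot_parE; case: b {f} => /=.
    by case: (par u); case: (e k x); rewrite /half /=.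
  rewrite (proj2 (pP k ks)) // parN addbF.
  by case: (par u); case: (e k x); case: (p k x); rewrite /half /=.
have c2 : c (elt (- 2) false) \is a Num.int.
  have [k ks kE] : exists2 k, (k < size Hs)%N & nth 1%G Hs k = H0.
    by exists (index H0 Hs); rewrite ?index_mem ?nth_index.
  have := fP _ (elt_in (- 2) false) k 1%g ks (group1 G).
  rewrite /beta rot_parE /= /half eltV opprK mulg1 -[elt 2 false]mul1g fi ?kE //.
  by rewrite subrr !sub0r rpredN.
(* The commutator of [elt 0 true] and [elt 1 false] is [elt (-2) false], where [c] is integral
   because that element fixes a coset of [H0]. But [gamma] takes different values on the two orders
   of multiplication. *)
have h1 := cM _ _ (elt_in 1 false) (elt_in 0 true).
have h2 := cM _ _ (elt_in 0 true) (elt_in 1 false).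
have h3 := cM _ _ (elt_in (- 2) false) (elt_in 1 true).
move: h1 h2 h3; rewrite /gamma !eltM !g2E !rot_parE /=.
have -> : -2 + 1 = -1 :> int by []; have -> : 1 + 0 = 1 :> int by [].
have -> : 0 - 1 = -1 :> int by [].
move=> h1 h2 h3.
suff /half_int : half true \is a Num.int by [].
have -> : half true = (c (elt (-1) true) - c (elt (-2) false) - c (elt 1 true) - half false)
  + (c (elt 1 true) - c (elt 1 false) - c (elt 0 true) - half false)
  - (c (elt (-1) true) - c (elt 0 true) - c (elt 1 false) - half true) + c (elt (-2) false).
  by rewrite /half; ring.
by apply: rpredD => //; apply: rpredB => //; apply: rpredD.
Qed.

(* The class defined by the character of <s^m> with kernel <s^2m>, extended by
   zero to the reflections. *)
Lemma obstruction_character Hs (X1 : nat -> bool) (e : nat -> gT -> bool) :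
    Hs != [::] -> all_sub G Hs ->
    (forall k, (k < size Hs)%N ->
       if X1 k then ref_fun (nth 1%G Hs k) (e k) else rot_fun (nth 1%G Hs k) (e k)) ->
    (exists k, [/\ (k < size Hs)%N, X1 k & elt 1 false \in nth 1%G Hs k]) ->
    (forall u, exists k x h, [/\ (k < size Hs)%N, ~~ X1 k, x \in G,
       h \in nth 1%G Hs k & (elt u true * x = x * h)%g]) ->
  ~ locally_trivial_trivial (Dm m j) (Jlat G Hs).
Proof.
move=> Hs0 sHs eP [k1 [k1s X1k1 fix1]] fixr lJ.
pose beta g k (x : gT) := half (X1 k && rot_par g).
have [|||f [c [fi fP cM]]] :=
  @locally_trivial_Jlat _ _ _ (DmG D m j) Hs beta (fun _ _ => 0) Hs0 sHs lJ.
- by [].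
- move=> _ _ /eltP[u [b ->]] /eltP[v [b' ->]] k x ks Gx.
  rewrite eltM /beta !rot_parE.
  have -> : par (if b then u - v else u + v) = par u (+) par v.
    by case: b; rewrite parD ?parN.
  by case: (par u); case: (par v); case: (X1 k); rewrite /half /=.
- move=> _ /eltP[u [b ->]].
  (* For a rotation the constant takes the value of the character and [f] corrects the cosets
     outside [X1]; for a reflection the constant is 0 and [f] corrects those in [X1]. *)
  pose f k x := if X1 k (+) b then 0 else half (par u && e k x).
  exists f, (if b then 0 else half (par u)); split.
    move=> k ks x h Gx Hh; rewrite /f; have := eP k ks.
    by case: (X1 k) => -[iv _]; rewrite iv.
  move=> k x ks Gx; rewrite /f /beta eltV rot_parE; have := eP k ks.
  case: (X1 k) => -[_ eE]; case: b {f} => //=; rewrite ?eE // ?parN.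
  + by case: (par u); case: (e k x); rewrite /half /=.
  + by case: (par u); rewrite /half /=.
  + by case: (par u); case: (e k x); rewrite /half /=.
(* Here [c] is a homomorphism modulo Z. It vanishes on reflections, each of which fixes a coset
   outside [X1], hence on their products; but on s^(-m), which fixes a coset in [X1], it is a
   half. *)
have cr u : c (elt u true) \is a Num.int.
  have [k [x [h [ks Xk Gx Hh e1]]]] := fixr u.
  have := fP _ (elt_in u true) k x ks Gx.
  by rewrite /beta (negbTE Xk) eltV e1 fi // subrr !sub0r rpredN.
have c1 := fP _ (elt_in (- 1) false) k1 1%g k1s (group1 G).
rewrite /beta X1k1 rot_parE eltV opprK mulg1 -[elt 1 false]mul1g fi // subrr subr0 in c1.
have h1 := cM _ _ (elt_in (- 1) false) (elt_in 1 true).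
rewrite eltM subr0 in h1.
suff /half_int : half true \is a Num.int by [].
have -> : half true = (half true - c (elt (-1) false))
  - (c (elt (-1 + 1) true) - c (elt (-1) false) - c (elt 1 true))
  + c (elt (-1 + 1) true) - c (elt 1 true) by rewrite /half; ring.
by apply: rpredB => //; apply: rpredD => //; apply: rpredB.
Qed.

End Subgroup.
End Obstructions.

(** * Families that are not quasi-invertible *)

Section NotQuasiInvertible.
Local Open Scope ring_scope.
Variables (gT : finGroupType) (G : {group gT}) (n : nat) (s t : gT).
Hypothesis D : dihedral G n s t.
Local Notation sg := (sg n s t).
Local Notation Cm := (Cm s).
Local Notation Dm := (Dm s t).
Local Notation coord := (of_coord n s t).
Local Notation eltg := (elt n s t).

Lemma par_div_periodic m mu : (0 < m)%N -> (2 * m %| mu)%N ->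
  periodic mu (fun i => par (i %/ m%:Z)%Z).
Proof.
move=> m0 /dvdnP[q ->] i; have mz : m%:Z != 0 by lia.
have -> : i + (q * (2 * m))%N%:Z = (q%:Z * 2) * m%:Z + i by rewrite !PoszM; ring.
by rewrite divzMDl // parD (par_even _ (m := 2)).
Qed.

Lemma par_periodic mu : ~~ odd mu -> periodic mu par.
Proof. by move=> emu i; rewrite parD -[mu%:Z]mul1r par_even // addbF. Qed.

Lemma periodicB (T : Type) m (f : int -> T) a : periodic m f -> periodic m (fun i => f (i - a)).
Proof. by move=> pf i; rewrite addrAC pf. Qed.

Lemma ref_fun_C m j mu : ref_fun G n s t m j (Cm mu) (coord (fun _ c => c)).
Proof.
split; first by apply/(right_inv_Cm D) => b i; rewrite !(of_coordE D).
move=> u b x /(sg_surj D)[i [c ->]].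
by rewrite /elt (sgM D) !(of_coordE D) // addbC.
Qed.

(** The parity of the integer part of i/m flips when m is added to i, and it has period 2m. *)
Lemma rot_fun_C m j mu : (0 < m)%N -> (2 * m %| mu)%N -> (mu %| n)%N ->
  rot_fun G n s t m j (Cm mu) (coord (fun i _ => par (i %/ m%:Z)%Z)).
Proof.
move=> m0 mmu mun; have pp := par_div_periodic m0 mmu; have pn := periodic_dvd mun pp.
split; first by apply/(right_inv_Cm D) => b i; rewrite !(of_coordE D).
move=> u x /(sg_surj D)[i [c ->]]; have mz : m%:Z != 0 by lia.
by rewrite /elt (sgM D) !(of_coordE D) // addr0 divzMDl // parD addbC.
Qed.

(** For even moduli the parity of i is defined on G; after the shift by y on reflections it descends
    to the cosets. Left multiplication by a reflection of K changes it by the parity of j + y. *)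
Lemma ref_fun_D m j mu y : ~~ odd m -> ~~ odd mu -> (mu %| n)%N -> odd (j + y) ->
  ref_fun G n s t m j (Dm mu y) (coord (fun i (c : bool) => par (i - (if c then y%:Z else 0)))).
Proof.
move=> em emu mun ojy.
have pp (c : bool) : periodic mu (fun i => par (i - (if c then y%:Z else 0))).
  exact: periodicB (par_periodic emu).
have pn c := periodic_dvd mun (pp c).
split.
  apply/(right_inv_Dm D); split=> [b i|i]; rewrite !(of_coordE D) //; first exact: pp.
  by rewrite addrK subr0.
move=> u b x /(sg_surj D)[i [c ->]]; rewrite /elt (sgM D) !(of_coordE D) //.
have -> : u * m%:Z + (if b then j%:Z else 0) + (if b then - i else i)
   - (if b (+) c then y%:Z else 0) =
   u * m%:Z + ((if b then j%:Z else 0) + (if b then - i else i) - (if b (+) c then y%:Z else 0)).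
  by ring.
rewrite (parD (u * m%:Z)) par_even //=; have := odd_double_half (j + y); rewrite ojy.
by case: b; case: c => /=; rewrite /par; lia.
Qed.

Lemma rot_fun_D m j mu y : (0 < m)%N -> (2 * m %| mu)%N -> (mu %| n)%N ->
  rot_fun G n s t m j (Dm mu y)
    (coord (fun i (c : bool) => par ((i - (if c then y%:Z else 0)) %/ m%:Z)%Z)).
Proof.
move=> m0 mmu mun.
have pp (c : bool) : periodic mu (fun i => par ((i - (if c then y%:Z else 0)) %/ m%:Z)%Z).
  exact: (periodicB _ (par_div_periodic m0 mmu)).
have pn c := periodic_dvd mun (pp c).
split.
  apply/(right_inv_Dm D); split=> [b i|i]; rewrite !(of_coordE D) //; first exact: pp.
  by rewrite addrK subr0.
move=> u x /(sg_surj D)[i [c ->]]; have mz : m%:Z != 0 by lia.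
rewrite /elt (sgM D) !(of_coordE D) // addr0 /= -addrA divzMDl // parD addbC //.
Qed.

Let n0 : (0 < n)%N. Proof. by case: D. Qed.
Let mul_gt0 m : (2 * m %| n)%N -> (0 < m)%N.
Proof. by move=> /(dvdn_gt0 n0); rewrite muln_gt0 => /andP[]. Qed.

(** The rotation group is normal, so every stabilizer in K = <s^m, t> is <s^(2m)> and the
    alternating class applies. *)
Lemma not_trivial_C m : (2 * m %| n)%N ->
  ~ locally_trivial_trivial (Dm m 0) (Jlat G [:: Cm (2 * m)]).
Proof.
move=> m2n; have m0 := mul_gt0 m2n.
apply: (@obstruction_alternating _ G n s t D m 0 m2n _ (fun _ => coord (fun _ c => c))
  (fun _ => coord (fun i _ => par (i %/ m%:Z)%Z))) => //.
- by rewrite /all_sub /= (CmG D).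
- by move=> [|//] _; apply: ref_fun_C.
- by move=> [|//] _; apply: rot_fun_C.
- exists (Cm (2 * m)); first by rewrite inE.
  by rewrite (mem_Cm D) //= addr0 PoszM dvdzz.
Qed.

(** For even m conjugation preserves the parity of the exponent of a reflection. The reflections of
    <s^m, s^(y+1) t> thus lie in no conjugate of <s^(2m), s^y t>. *)
Lemma not_trivial_D m y : ~~ odd m -> (2 * m %| n)%N ->
  ~ locally_trivial_trivial (Dm m y.+1) (Jlat G [:: Dm (2 * m) y]).
Proof.
move=> em m2n; have m0 := mul_gt0 m2n; have e2 : ~~ odd (2 * m) by rewrite oddM.
apply: (@obstruction_alternating _ G n s t D m y.+1 m2n _
  (fun _ => coord (fun i (c : bool) => par (i - (if c then y%:Z else 0))))
  (fun _ => coord (fun i (c : bool) => par ((i - (if c then y%:Z else 0)) %/ m%:Z)%Z))) => //.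
- by rewrite /all_sub /= (DmG D).
- by move=> [|//] _; apply: ref_fun_D => //; rewrite addSn addnn /= odd_double.
- by move=> [|//] _; apply: rot_fun_D.
- exists (Dm (2 * m) y); first by rewrite inE.
  by rewrite (mem_Dm D) //= addr0 subr0 PoszM dvdzz.
Qed.

Lemma elt_conj m j mu u (k : int) y : (mu %| n)%N ->
  u * m%:Z + j%:Z - 2 * k = y%:Z ->
  exists x h, [/\ x \in G, h \in Dm mu y & (eltg m j u true * x = x * h)%g].
Proof.
move=> mun e; exists (sg k false), (sg y%:Z true); split; first exact: (sgin D).
  by rewrite (mem_Dm D) // subrr dvdz0.
by rewrite !(sgM D) /=; congr sg; lia.
Qed.

Lemma elt_conj_even m j mu u : ~~ odd m -> (mu %| n)%N ->
  exists x h, [/\ x \in G, h \in Dm mu j & (eltg m j u true * x = x * h)%g].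
Proof.
move=> em mun; apply: (@elt_conj m j mu u (u * m./2%:Z)) => //.
rewrite -[in u * m%:Z](odd_double_half m) (negbTE em) add0n -mul2n PoszM; ring.
Qed.

(** In K = <s^a, s^y' t>, the rotation s^a fixes cosets of [Dm a y] only, and by parity the
    reflections fix cosets of [Dm b y'] only. *)
Lemma not_trivial_DD a b y y' : ~~ odd a -> odd (y + y') -> (2 * a %| b)%N -> (b %| n)%N ->
  ~ locally_trivial_trivial (Dm a y') (Jlat G [:: Dm a y; Dm b y']).
Proof.
move=> ea oy ab bn; have a2n := dvdn_trans ab bn; have a0 := mul_gt0 a2n.
have an : (a %| n)%N by apply: dvdn_trans a2n; rewrite dvdn_mull.
apply: (@obstruction_character _ G n s t D a y' a2n _ (fun k => k == 0%N)
  (fun k => if k is 0%N then coord (fun i (c : bool) => par (i - (if c then y%:Z else 0)))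
   else coord (fun i (c : bool) => par ((i - (if c then y'%:Z else 0)) %/ a%:Z)%Z))) => //.
- by rewrite /all_sub /= !(DmG D).
- move=> [|[|//]] _; last exact: rot_fun_D.
  by apply: ref_fun_D; rewrite // addnC.
- by exists 0%N; split=> //; rewrite (mem_Dm D) //= addr0 subr0 mul1r dvdzz.
- move=> u; have [x [h [Gx Hh e]]] := elt_conj_even y' u ea bn.
  by exists 1%N, x, h; split.
Qed.

(** In K = <s^m, s^y t>, s^m fixes the cosets of [Cm c] and every reflection fixes one of [Dm b y].
    The groups in [r] have reflections of the other parity and join the part with nonzero
    character. *)
Lemma not_trivial_CD c m b y r : ~~ odd m -> (c %| m)%N -> (2 * m %| b)%N -> (b %| n)%N ->
    (forall k, (k < size r)%N -> exists mu y', [/\ nth 1%G r k = Dm mu y', ~~ odd mu,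
       (mu %| n)%N & odd (y + y')]) ->
  ~ locally_trivial_trivial (Dm m y) (Jlat G [:: Cm c, Dm b y & r]).
Proof.
move=> em cm mb bn rP; have m2n := dvdn_trans mb bn; have m0 := mul_gt0 m2n.
have mn : (m %| n)%N by apply: dvdn_trans m2n; rewrite dvdn_mull.
have /fin_all_exists[e eP] : forall k : 'I_(size r), exists e, ref_fun G n s t m y (nth 1%G r k) e.
  move=> k; have [mu [y' [-> emu mun oy]]] := rP _ (ltn_ord k).
  by eexists; apply: ref_fun_D => //; exact: em.
pose E k := match k with
  | 0%N => coord (fun _ c => c)
  | 1%N => coord (fun i (c : bool) => par ((i - (if c then y%:Z else 0)) %/ m%:Z)%Z)
  | k.+2 => if insub k is Some k' then e k' else fun=> false end.
have rG : all_sub G r.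
  apply/allP=> H Hr; have [mu [y' [E' _ _ _]]] := rP _ (etrans (index_mem H r) Hr).
  by rewrite -[H](nth_index 1%G Hr) E' (DmG D).
apply: (@obstruction_character _ G n s t D m y m2n _ (fun k => k != 1%N) E) => //.
- by rewrite /all_sub /= (CmG D) (DmG D).
- move=> [|[|k]] ks; [exact: ref_fun_C | exact: rot_fun_D |].
  have ks' : (k < size r)%N by [].
  by rewrite /E insubT; apply: eP.
- exists 0%N; split=> //; rewrite (mem_Cm D) ?(dvdn_trans cm) //= addr0 mul1r //.
- move=> u; have [x [h [Gx Hh e']]] := elt_conj_even y u em bn.
  by exists 1%N, x, h; split.
Qed.

(** For odd c the reflections s^(uc) t of K have exponents of both parities; each fixes a coset of
    the dihedral group of its own parity. *)
Lemma not_trivial_CDD c : (2 * c %| n)%N ->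
  ~ locally_trivial_trivial (Dm c 0) (Jlat G [:: Cm c; Dm (2 * c) 0; Dm (2 * c) 1]).
Proof.
move=> c2n; have c0 := mul_gt0 c2n.
have cn : (c %| n)%N by apply: dvdn_trans c2n; rewrite dvdn_mull.
apply: (@obstruction_character _ G n s t D c 0 c2n _ (fun k => k == 0%N)
  (fun k => if k is k'.+1 then
     coord (fun i (b : bool) => par ((i - (if b then k'%:Z else 0)) %/ c%:Z)%Z)
   else coord (fun _ c => c))) => //.
- by rewrite /all_sub /= (CmG D) !(DmG D).
- by move=> [|[|[|//]]] _; [exact: ref_fun_C | exact: rot_fun_D | exact: rot_fun_D].
- by exists 0%N; split=> //; rewrite (mem_Cm D) //= addr0 mul1r dvdzz.
- move=> u; pose k := ((u * c%:Z) %/ 2)%Z.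
  have [e|e] : u * c%:Z + 0%N%:Z - 2 * k = 0%N \/ u * c%:Z + 0%N%:Z - 2 * k = 1%N.
    by rewrite /k; lia.
    have [x [h [Gx Hh e']]] := elt_conj c2n e; by exists 1%N, x, h; split.
  by have [x [h [Gx Hh e']]] := elt_conj c2n e; exists 2%N, x, h; split.
Qed.

End NotQuasiInvertible.

Section IndexGcd.
Variables (gT : finGroupType) (G : {group gT}).
Implicit Types (H : {group gT}) (Hs : seq {group gT}).

Lemma dG_dvd Hs H : H \in Hs -> (dG G Hs %| #|G : H|%g).
Proof.
rewrite /dG; elim: Hs => //= K Hs IH; rewrite inE big_cons => /orP[/eqP->|/IH h].
  exact: dvdn_gcdl.
exact: dvdn_trans (dvdn_gcdr _ _) h.
Qed.

Lemma dvd_dG Hs m : (forall H, H \in Hs -> m %| #|G : H|%g) -> m %| dG G Hs.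
Proof.
rewrite /dG; elim: Hs => [|K Hs IH] h; rewrite ?big_nil ?dvdn0 // big_cons dvdn_gcd.
by rewrite h ?mem_head // IH // => H Hm; apply: h; rewrite inE Hm orbT.
Qed.

Lemma dG_gt0 Hs : Hs != [::] -> 0 < dG G Hs.
Proof.
case: Hs => // H Hs _; apply: dvdn_gt0 (indexg_gt0 G H) _.
by apply: dG_dvd; rewrite mem_head.
Qed.

End IndexGcd.

Lemma min_or_none (Q : pred nat) N : (forall c, Q c -> c <= N) ->
  (exists2 c, Q c & forall c', Q c' -> c <= c') \/ (forall c, Q c = false).
Proof.
move=> bQ; have [/hasP[c _ Qc]|/hasPn no] := boolP (has Q (iota 0 N.+1)).
  have exQ : exists c, Q c by exists c.
  by left; case: (ex_minnP exQ) => m Qm mmin; exists m.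
right=> c; apply/negP=> Qc; have := no c; rewrite mem_iota ltnS (bQ _ Qc) Qc.
by move=> /(_ isT).
Qed.

Lemma Dm_shift (gT : finGroupType) (s t : gT) m j : Dm s (s ^+ j * t)%g m 0 = Dm s t m j.
Proof. by rewrite /Dm expg0 mul1g. Qed.

(** * Reduction to minimal families and their classification *)

Section DihedralClassification.
Variables (gT : finGroupType) (G : {group gT}) (n : nat) (s t : gT).
Hypothesis D : dihedral G n s t.
Local Notation sg := (sg n s t).
Local Notation Cm := (Cm s).
Local Notation Dm := (Dm s t).

Let n0 : 0 < n. Proof. by case: D. Qed.

Lemma Cm_sub_Cm a b : b %| a -> Cm a \subset Cm b.
Proof. by move=> /dvdnP[q ->]; rewrite cycle_subG mulnC expgM mem_cycle. Qed.

Lemma Cm_sub_Dm a b y : b %| a -> Cm a \subset Dm b y.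
Proof.
move=> ba; apply: subset_trans (Cm_sub_Cm ba) _.
by rewrite cycle_subG mem_gen // !inE eqxx.
Qed.

Lemma Dm_sub_Dm a b y : b %| a -> Dm a y \subset Dm b y.
Proof.
move=> ba; rewrite gen_subG; apply/subsetP=> x; rewrite !inE => /orP[]/eqP->.
  by apply: (subsetP (Cm_sub_Dm y ba)); rewrite cycle_id.
by rewrite mem_gen // !inE eqxx orbT.
Qed.

(** The gcd d of the indices divides 2n but possibly not n; this puts <s^d, s^y t> in the normal
    form used for coordinates. *)
Lemma Dm_gcd d y : 0 < d -> Dm d y = Dm (gcdn d n) y.
Proof.
move=> d0; apply: val_inj; apply/eqP; rewrite eqEsubset [X in X && _]Dm_sub_Dm ?dvdn_gcdl //=.
rewrite gen_subG; apply/subsetP=> x; rewrite !inE => /orP[]/eqP->; last first.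
  by rewrite mem_gen // !inE eqxx orbT.
case: (egcdnP n d0) => u v e _.
have sn : (s ^+ n = 1)%g by case: D => _ _ _ [].
have -> : (s ^+ gcdn d n = (s ^+ d) ^+ u)%g.
  by rewrite -expgM mulnC e expgD mulnC expgM sn expg1n mul1g.
by rewrite groupX // mem_gen // !inE eqxx.
Qed.

(** With [Dm_shift], this extends the resolutions built for j = 0 to every j. *)
Lemma dihedral_shift j : dihedral G n s (s ^+ j * t)%g.
Proof.
have [_ GE cG [sn tt ts]] := D; split=> //.
  have sin : s \in <<[set s; (s ^+ j * t)%g]>>%g by rewrite mem_gen // !inE eqxx.
  have tin : (s ^+ j * t)%g \in <<[set s; (s ^+ j * t)%g]>>%g.
    by rewrite mem_gen // !inE eqxx orbT.
  apply/eqP; rewrite GE eqEsubset !gen_subG; apply/andP; split; apply/subsetP=> x.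
    rewrite !inE => /orP[]/eqP-> //.
    by have := groupM (groupVr (groupX j sin)) tin; rewrite mulKg.
  rewrite !inE => /orP[]/eqP->; first by rewrite mem_gen // !inE eqxx.
  by rewrite groupM ?groupX // mem_gen // !inE eqxx ?orbT.
split=> //.
  by rewrite expgS expg1 (sgXt D) (sgM D) /= GRing.subrr (sg1 D).
have s1 : s = sg 1%Z false by rewrite -[1%Z]/(Posz 1) -(sgX D) expg1.
have e : (s * ((s ^+ j * t) * s) = s ^+ j * t)%g.
  have : (sg 1%Z false * (sg j true * sg 1%Z false) = sg j true)%g.
    by rewrite !(sgM D) /=; congr sg; lia.
  by rewrite -s1 -(sgXt D).
by rewrite -[X in (X * _ = _)%g](mulKg s) e -mulgA mulgV mulg1.
Qed.

Section Family.
Variable Hs : seq {group gT}.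
Hypotheses (Hs0 : Hs != [::]) (sHs : all_sub G Hs).
Variables (e d' : nat).
Hypotheses (od' : odd d') (dE : dG G Hs = 2 ^ e * d').
Local Notation J := (Jlat G Hs).

Lemma d'_gt0 : 0 < d'. Proof. by case: (d') od'. Qed.

Lemma odd_dvd_double m : d' %| 2 * m -> d' %| m.
Proof. by rewrite Gauss_dvdr // coprimen2. Qed.

Lemma member_cases H : H \in Hs ->
  exists m, m %| n /\ d' %| m /\ (H = Cm m \/ exists2 x, x < n & H = Dm m x).
Proof.
move=> mH; have [m [mn h]] := subgroup_cases D (allP sHs _ mH).
exists m; split=> //; split=> //; have : d' %| #|G : H|%g.
  by apply: dvdn_trans (dG_dvd G mH); rewrite dE dvdn_mull.
case: h => [->|[x _ ->]]; last by rewrite (index_Dm D).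
by rewrite (index_Cm D) //; apply: odd_dvd_double.
Qed.

(** Each member contributes twice its index divided by d'; the factor 2 lets rotation and dihedral
    members be treated alike, and Bezout collects them into the gcd. *)
Lemma reach_gcd_indices y : reach G Hs (Dm d' y) (Posz (2 * 2 ^ e)).
Proof.
suff h r : {subset r <= Hs} -> exists2 q, \big[gcdn/0]_(H <- r) #|G : H|%g = d' * q &
    reach G Hs (Dm d' y) (Posz (2 * q)).
  have [q qE rq] := h Hs (fun _ => id); suff -> : 2 ^ e = q by [].
  by apply/eqP; rewrite -(eqn_pmul2r d'_gt0) -dE /dG qE mulnC.
elim: r => [|H r IH] sr; first by exists 0; rewrite ?big_nil ?muln0 //; apply: reach0.
have [|q qE rq] := IH; first by move=> K Kr; apply: sr; rewrite inE Kr orbT.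
have mH : H \in Hs by apply: sr; rewrite mem_head.
have [q' iE rq'] : exists2 q', #|G : H|%g = d' * q' & reach G Hs (Dm d' y) (Posz (2 * q')).
  have [m [mn [/dvdnP[q1 mE] h]]] := member_cases mH; rewrite mulnC in mE.
  have rot : Cm (d' * q1) \subset H.
    by rewrite -mE; case: h => [->|[x _ ->]] //; apply: Cm_sub_Dm.
  have rr := reach_rot D y rot mH.
  case: h => [hE|[x _ hE]].
    exists (2 * q1); first by rewrite hE (index_Cm D) // mE mulnCA.
    have := reachD 2%Z 0%Z rr rr; rewrite GRing.mul0r GRing.addr0.
    by congr (reach _ _ _ _); lia.
  by exists q1; rewrite // hE (index_Dm D).
exists (gcdn q' q); first by rewrite big_cons qE iE muln_gcdr.
by have := reach_gcd rq' rq; rewrite -muln_gcdr.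
Qed.

(** A power of two is always reached, so any odd augmentation gives 1. From here on only 2-adic
    valuations of the exponents matter. *)
Lemma reach_odd (K : {group gT}) y q : K \subset Dm d' y -> odd q ->
  reach G Hs K (Posz q) -> reach G Hs K (Posz 1).
Proof.
move=> sK oq rq; have r2 := reach_mono sK (reach_gcd_indices y).
by apply: reach_coprime rq r2; rewrite -expnS coprimeXr // coprimen2.
Qed.

Lemma similar_odd : e = 0 -> lat_similar G J (Jlat G [:: Dm d' 0; Dm d' 1]).
Proof.
move=> e0; have dd' : dG G Hs = d' by rewrite dE e0 mul1n.
have shift x y : exists k : int, (d' %| (Posz x + 2 * k - Posz y)%R)%Z.
  (* As d' is odd, (d' + 1)/2 inverts 2 modulo d': twice this witness is (y - x)(d' + 1). *)
  exists ((Posz y - Posz x) * Posz (d'.+1)./2)%R; apply/dvdzP.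
  exists (Posz y - Posz x)%R; have := odd_double_half d'.+1; rewrite /= od' => h.
  have {}h : Posz d' = (Posz (d'.+1)./2 * 2 - 1)%R by lia.
  by rewrite [X in (_ = _ * X)%R]h; ring.
have [H mH oH] : exists2 H, H \in Hs & odd #|G : H|%g.
  apply/hasP; apply: contraT => /hasPn no; have : 2 %| dG G Hs.
    by apply: dvd_dG => H mH; rewrite dvdn2; apply: no.
  by rewrite dd' dvdn2 od'.
have [m [mn [/dvdnP[q mE] h]]] := member_cases mH.
have [x hE] : exists x, H = Dm m x.
  by case: h => [hE|[x _ hE]]; [rewrite hE (index_Cm D) // oddM in oH | exists x].
rewrite hE (index_Dm D) // mE oddM in oH; case/andP: oH => oq _.
have rD y : reach G Hs (Dm d' y) (Posz 1).
  have [k kE] := shift x y; apply: (reach_odd (subxx _) oq).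
  by apply: (@reach_D _ _ _ _ _ D _ d' q x y k) => //; rewrite mulnC -mE -hE.
apply: similar_reach => //; first by rewrite /all_sub /= !(DmG D).
  by move=> R; rewrite !inE => /orP[]/eqP->.
move=> K /member_cases[m' [mn' [dm' [->|[y _ ->]]]]].
  apply: reach_mono (Cm_sub_Dm 0 dm') _; apply: reach_mem; exact: mem_head.
apply: reach_mono (Dm_sub_Dm y dm') _; have [k kE] := shift 0 y.
by apply: (@reach_D _ _ _ _ _ D _ d' 1 0 y k) => //; rewrite muln1 mem_head.
Qed.

(** Members are retained only through the 2-adic valuation of m and, for dihedral ones, the parity
    of x, the invariant left by conjugation when m is even. *)
Definition has_C c := [exists m : 'I_n.+1, [&& m %| n, Cm m \in Hs & logn 2 m == c]].
Definition has_D (j : bool) a := [exists m : 'I_n.+1, [exists x : 'I_n,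
  [&& m %| n, Dm m x \in Hs, odd x == j & logn 2 m == a]]].

Lemma has_CP c : reflect (exists m, [/\ m %| n, Cm m \in Hs & logn 2 m = c]) (has_C c).
Proof.
apply: (iffP existsP) => [[m /and3P[mn mH /eqP lm]]|[m [mn mH lm]]]; first by exists m.
have mlt : m < n.+1 by rewrite ltnS dvdn_leq.
by exists (Ordinal mlt); rewrite /= mn mH lm eqxx.
Qed.

Lemma has_DP j a : reflect (exists m x, [/\ m %| n, x < n, Dm m x \in Hs, odd x = j & logn 2 m = a])
  (has_D j a).
Proof.
apply: (iffP existsP) => [[m /existsP[x /and4P[mn mH /eqP ox /eqP lm]]]|].
  by exists m, x; split.
move=> [m [x [mn xn mH ox lm]]]; have mlt : m < n.+1 by rewrite ltnS dvdn_leq.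
by exists (Ordinal mlt); apply/existsP; exists (Ordinal xn); rewrite /= mn mH ox lm !eqxx.
Qed.

Lemma log_split m : m %| n -> d' %| m ->
  exists2 q, odd q & m = 2 ^ logn 2 m * d' * q.
Proof.
move=> mn dm; have m0 := dvdn_gt0 n0 mn.
have [o co mE] := pfactor_coprime (isT : prime 2) m0.
have : d' %| o by move: dm; rewrite {1}mE Gauss_dvdl // coprimeXr // coprimen2.
move=> /dvdnP[q oE]; exists q; last by rewrite {1}mE oE mulnC (mulnC q) mulnA.
by move: co; rewrite coprime2n oE oddM => /andP[].
Qed.

Lemma pow_dvd m a : m %| n -> d' %| m -> a <= logn 2 m -> 2 ^ a * d' %| m.
Proof.
move=> mn dm am; have [q _ ->] := log_split mn dm.
by rewrite dvdn_mulr // dvdn_mul // dvdn_exp2l.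
Qed.

Lemma member_d' m : m %| n -> (exists x, Dm m x \in Hs) \/ Cm m \in Hs -> d' %| m.
Proof.
move=> mn h; have hd H : H \in Hs -> d' %| #|G : H|%g.
  by move=> mH; apply: dvdn_trans (dG_dvd G mH); rewrite dE dvdn_mull.
case: h => [[x /hd]|/hd]; rewrite ?(index_Dm D) ?(index_Cm D) //.
exact: odd_dvd_double.
Qed.

Lemma has_C_dvd c : has_C c -> 2 ^ c * d' %| n.
Proof.
move=> /has_CP[m [mn mH <-]]; apply: dvdn_trans (mn); apply: pow_dvd => //.
by apply: member_d' => //; right.
Qed.

Lemma has_D_dvd j a : has_D j a -> 2 ^ a * d' %| n.
Proof.
move=> /has_DP[m [x [mn _ mH _ <-]]]; apply: dvdn_trans (mn); apply: pow_dvd => //.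
by apply: member_d' => //; left; exists x.
Qed.

Lemma log_dG : logn 2 (dG G Hs) = e.
Proof.
by rewrite dE lognM ?expn_gt0 ?d'_gt0 // lognX logn_prime //= muln1 logn_coprime ?addn0 // coprime2n.
Qed.

Lemma has_C_log c : has_C c -> e <= c.+1.
Proof.
move=> /has_CP[m [mn mH <-]]; have m0 := dvdn_gt0 n0 mn.
have := dvdn_leq_log 2 (indexg_gt0 G (Cm m)) (dG_dvd G mH).
by rewrite log_dG (index_Cm D) // lognM // logn_prime //= add1n.
Qed.

Lemma has_D_log j a : has_D j a -> e <= a.
Proof.
move=> /has_DP[m [x [mn _ mH _ <-]]].
have := dvdn_leq_log 2 (indexg_gt0 G (Dm m x)) (dG_dvd G mH).
by rewrite log_dG (index_Dm D).
Qed.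

Lemma log_attained : (exists2 c, has_C c & c.+1 = e) \/ (exists j, has_D j e).
Proof.
have [/hasP[H mH /eqP lH]|/hasPn no] := boolP (has (fun H : {group gT} => logn 2 #|G : H|%g == e) Hs).
  have [m [mn [_ h]]] := member_cases mH; have m0 := dvdn_gt0 n0 mn.
  case: h => [hE|[x xn hE]]; rewrite hE in lH mH.
    left; exists (logn 2 m); first by apply/has_CP; exists m.
    by rewrite -lH (index_Cm D) // lognM // logn_prime //= add1n.
  right; exists (odd x); apply/has_DP; exists m, x; split=> //.
  by rewrite -lH (index_Dm D).
have : 2 ^ e.+1 %| dG G Hs.
  apply: dvd_dG => H mH; rewrite pfactor_dvdn ?indexg_gt0 // ltn_neqAle eq_sym no //=.
  by rewrite -log_dG dvdn_leq_log ?indexg_gt0 // dG_dvd.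
by rewrite pfactor_dvdn ?dG_gt0 // log_dG ltnn.
Qed.

Lemma reach_has_C c : has_C c -> reach G Hs (Cm (2 ^ c * d')) (Posz 1).
Proof.
move=> /has_CP[m [mn mH <-]]; have dm : d' %| m by apply: member_d' => //; right.
have [q oq mE] := log_split mn dm; apply: (reach_odd (Cm_sub_Dm 0 (dvdn_mull _ (dvdnn d'))) oq).
by apply: (reach_C D); rewrite -mE.
Qed.

Lemma reach_has_D (j : bool) a : has_D j a -> reach G Hs (Dm (2 ^ a * d') j) (Posz 1).
Proof.
move=> /has_DP[m [x [mn _ mH <- <-]]].
have dm : d' %| m by apply: member_d' => //; left; exists x.
have [q oq mE] := log_split mn dm.
apply: (reach_odd (Dm_sub_Dm _ (dvdn_mull _ (dvdnn d'))) oq).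
apply: (@reach_D _ _ _ _ _ D _ _ _ x _ (- Posz x./2)%R); first by rewrite -mE.
have -> : (Posz x + 2 * - Posz x./2 - Posz (odd x) = 0)%R.
  by have := odd_double_half x; lia.
exact: dvdz0.
Qed.

(** The groups of [L] are reached from [Hs] since odd indices can be cleared; conversely every
    member of [Hs] lies, up to conjugacy, in a group of [L] of smaller or equal exponent. *)
Lemma similar_canonical (L : seq {group gT}) :
    (forall K, K \in L -> (exists2 c, has_C c & K = Cm (2 ^ c * d')) \/
       exists (j : bool) a, has_D j a /\ K = Dm (2 ^ a * d') j) ->
    (forall c, has_C c -> (exists2 c', c' <= c & Cm (2 ^ c' * d') \in L) \/
       exists (j : bool) a, a <= c /\ Dm (2 ^ a * d') j \in L) ->
    (forall (j : bool) a, has_D j a -> exists2 a', a' <= a & Dm (2 ^ a' * d') j \in L) ->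
  lat_similar G J (Jlat G L).
Proof.
move=> LK LC LD; apply: similar_reach => //.
- by apply/allP=> K /LK[[c _ ->]|[j [a [_ ->]]]]; rewrite ?(CmG D) ?(DmG D).
- by move=> K /LK[[c hc ->]|[j [a [hd ->]]]]; [exact: reach_has_C | exact: reach_has_D].
move=> H mH; have [m [mn [dm [hE|[x xn hE]]]]] := member_cases mH; rewrite {}hE in mH *.
  have /LC[[c' c'm Lc]|[j [a [am La]]]] : has_C (logn 2 m) by apply/has_CP; exists m.
    by apply: reach_mono (reach_mem G Lc); apply: Cm_sub_Cm; apply: pow_dvd.
  by apply: reach_mono (reach_mem G La); apply: Cm_sub_Dm; apply: pow_dvd.
have /LD[a am La] : has_D (odd x) (logn 2 m) by apply/has_DP; exists m, x.
apply: (@reach_mono _ _ _ (Dm (2 ^ a * d') x)); first by apply: Dm_sub_Dm; apply: pow_dvd.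
apply: (@reach_D _ _ _ _ _ D _ _ 1 (odd x) _ (Posz x./2)); first by rewrite muln1.
have -> : (Posz (odd x) + 2 * Posz x./2 - Posz x = 0)%R.
  by have := odd_double_half x; lia.
exact: dvdz0.
Qed.

(** The minimal exponents of each type give a similar family of at most three groups, and an
    obstruction excludes every such family outside the list. [L4] is given only through its members
    because its two groups may coincide. *)
Lemma quasi_invertible_cases (L4 : seq {group gT}) : 0 < e ->
    L4 =i [:: Dm (dG G Hs) 0; Dm (dG G Hs) 1] -> quasi_invertible G J ->
  [\/ e = 1 /\ lat_similar G J (Jlat G [:: Cm d']),
      (exists j, j < 2 /\ e = 1 /\ lat_similar G J (Jlat G [:: Dm (2 * d') j])),
      (exists j, j < 2 /\ e = 1 /\ lat_similar G J (Jlat G [:: Cm d'; Dm (2 * d') j])) |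
      lat_similar G J (Jlat G L4)].
Proof.
move=> e0 L4E qi.
have bad m j L : lat_similar G J (Jlat G L) -> ~ locally_trivial_trivial (Dm m j) (Jlat G L) -> False.
  move=> sim; apply; apply: (locally_trivial_similar (DmG D m j) sim).
  exact: locally_trivial_quasi_invertible (DmG D m j) qi.
have log_bound m : m %| n -> logn 2 m <= n.
  move=> mn; apply: leq_trans (dvdn_leq n0 mn); apply/ltnW/ltn_logl.
  exact: dvdn_gt0 n0 mn.
have bC c : has_C c -> c <= n by move=> /has_CP[m [mn _ <-]]; apply: log_bound.
have bD j a : has_D j a -> a <= n by move=> /has_DP[m [x [mn _ _ _ <-]]]; apply: log_bound.
have two k : 2 * (2 ^ k * d') = 2 ^ k.+1 * d' by rewrite expnS mulnA.
have pow0 : 2 ^ 0 * d' = d' by rewrite mul1n.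
have even_pow k : 0 < k -> ~~ odd (2 ^ k * d') by case: k => // k _; rewrite -two oddM.
have dvd_pow k l : k <= l -> 2 ^ k * d' %| 2 ^ l * d' by move=> kl; rewrite dvdn_mul // dvdn_exp2l.
have Dpos j a : has_D j a -> 0 < a by move=> /has_D_log; apply: leq_trans.
have odd_flip (j : bool) : odd (j + ~~ j) by case: j.
have caseC a : (exists c, [/\ has_C c, (forall c', has_C c' -> c <= c') & c < a]) \/
    (forall c, has_C c -> a <= c).
  have [[c hc minc]|noc] := min_or_none bC; last by right=> c; rewrite noc.
  by have [ca|ac] := ltnP c a; [left; exists c | right=> c' /minc; apply: leq_trans].
(* Dihedral members of a single parity. The least rotation group is kept if its exponent is below a;
   otherwise it lies in the dihedral group and disappears. *)
have one_D (j : bool) a : has_D j a -> (forall a', has_D j a' -> a <= a') ->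
    (forall a', has_D (~~ j) a' = false) ->
    (exists j, j < 2 /\ e = 1 /\ lat_similar G J (Jlat G [:: Dm (2 * d') j])) \/
    (exists j, j < 2 /\ e = 1 /\ lat_similar G J (Jlat G [:: Cm d'; Dm (2 * d') j])).
  move=> hj minj noj; have a0 := Dpos _ _ hj; have jD := has_D_dvd hj.
  have inD j' a' : has_D j' a' -> j' = j /\ a <= a'.
    move=> h; have [ej|ne] := eqVneq j' j; first by rewrite ej in h; split=> //; apply: minj.
    have ej : j' = ~~ j by case: (j) (j') ne => -[].
    by rewrite ej noj in h.
  have [[c [hc minc ca]]|noc] := caseC a; [right|left].
    have sim : lat_similar G J (Jlat G [:: Cm (2 ^ c * d'); Dm (2 ^ a * d') j]).
      apply: similar_canonical => [K|c' /minc cc'|j' a' /inD[-> aa']].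
      - by rewrite !inE => /orP[]/eqP->; [left; exists c | right; exists j, a].
      - by left; exists c; rewrite ?mem_head.
      - by exists a; rewrite ?inE ?eqxx ?orbT.
    have [a2|a1] := leqP 2 a.
      (* The obstructing group takes m = 2^max(c, 1) d', which is even and a multiple of 2^c d'; a >
         max(c, 1) ensures that 2m divides 2^a d'. *)
      have m1 : maxn c 1 < a by rewrite gtn_max ca.
      case: (bad _ _ _ sim (@not_trivial_CD _ _ _ _ _ D _ (2 ^ maxn c 1 * d') _ _ _ _ _ _ _ _)) => //.
      + by apply: even_pow; rewrite leq_max orbT.
      + by apply: dvd_pow; rewrite leq_maxl.
      + by rewrite two; apply: dvd_pow.
    have aE : a = 1 by lia. have cE : c = 0 by lia.
    exists j; split; first by case: (j). split; first by have := has_C_log hc; lia.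
    by move: sim; rewrite aE cE pow0 expn1.
  have sim : lat_similar G J (Jlat G [:: Dm (2 ^ a * d') j]).
    apply: similar_canonical => [K|c' /noc ac'|j' a' /inD[-> aa']].
    - by rewrite !inE => /eqP->; right; exists j, a.
    - by right; exists j, a; rewrite mem_head.
    - by exists a; rewrite ?mem_head.
  have [a2|a1] := leqP 2 a.
    case: (a) a2 jD sim => // k k1 jD sim.
    exfalso; apply: (bad (2 ^ k * d') j.+1 _ sim).
    rewrite -two; apply: (not_trivial_D D); rewrite ?two //.
    exact: even_pow.
  have aE : a = 1 by lia.
  exists j; split; first by case: (j). split; first by have := has_D_log hj; lia.
  by move: sim; rewrite aE expn1.
have two_D a (aD : bool -> nat) : (forall j, has_D j (aD j)) ->
    (forall j a', has_D j a' -> aD j <= a') -> a = minn (aD true) (aD false) ->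
    lat_similar G J (Jlat G L4).
  move=> hD minD aE.
  have sD L : (forall K, K \in L -> exists j : bool, K = Dm (2 ^ aD j * d') j) ->
      (forall j : bool, Dm (2 ^ aD j * d') j \in L) -> (forall c, has_C c -> a <= c) ->
      lat_similar G J (Jlat G L).
    move=> LK LD aC; apply: similar_canonical => [K /LK[j ->]|c /aC ac|j a' /minD aa'].
    - by right; exists j, (aD j).
    - right; have [le|lt] := leqP (aD true) (aD false); [exists true|exists false].
        by exists (aD true); split; [lia | apply: LD].
      by exists (aD false); split; [lia | apply: LD].
    - by exists (aD j).
  have posD j := Dpos _ _ (hD j); have jD j := has_D_dvd (hD j).
  have [[c [hc minc ca]]|aC] := caseC a.
    have sim (j : bool) : lat_similar G J
        (Jlat G [:: Cm (2 ^ c * d'); Dm (2 ^ aD j * d') j; Dm (2 ^ aD (~~ j) * d') (~~ j)]).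
      apply: similar_canonical => [K|c' /minc cc'|j' a' /minD aa'].
      - rewrite !inE => /or3P[]/eqP->; [by left; exists c | right; exists j, (aD j) | right].
          by [].
        by exists (~~ j), (aD (~~ j)).
      - by left; exists c; rewrite ?mem_head.
      - exists (aD j') => //; have [->|->] : j' = j \/ j' = ~~ j by case: (j) (j') => -[]; auto.
          by rewrite !inE eqxx orbT.
        by rewrite !inE eqxx !orbT.
    (* The dihedral group of exponent above 1 supplies the fixed points of reflections; the one of
       the other parity becomes the remaining list. *)
    have big (j : bool) : 1 < aD j -> False.
      move=> a2; have m1 : maxn c 1 < aD j by rewrite gtn_max a2; case: (j) => /=; lia.
      apply: (bad (2 ^ maxn c 1 * d') j _ (sim j)).
      apply: (@not_trivial_CD _ _ _ _ _ D _ (2 ^ maxn c 1 * d')) => //.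
      + by apply: even_pow; rewrite leq_max orbT.
      + by apply: dvd_pow; rewrite leq_maxl.
      + by rewrite two; apply: dvd_pow.
      + move=> [|//] _; exists (2 ^ aD (~~ j) * d'), (~~ j : nat); split=> //.
        exact: even_pow.
    have [aT aF] : aD true = 1 /\ aD false = 1.
      split; apply/eqP; rewrite eqn_leq posD andbT leqNgt; apply/negP; exact: big.
    have cE : c = 0 by lia.
    exfalso; apply: (bad d' 0 _ (sim false)); rewrite /= aT aF cE pow0 expn1.
    by apply: (not_trivial_CDD D); have := jD true; rewrite aT expn1.
  have [eqa|nea] := eqVneq (aD true) (aD false).
    (* The common exponent a is that of d: if a rotation group attained the latter, then c + 1 = e
       <= a, against a <= c. *)
    have dD : dG G Hs = 2 ^ a * d'.
      rewrite dE; congr (2 ^ _ * _); apply/eqP; rewrite eqn_leq.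
      have := has_D_log (hD true); rewrite aE eqa minnn => -> /=.
      have [[c /aC ac ce]|[j /minD]] := log_attained; first by have := has_D_log (hD true); lia.
      by case: j; rewrite ?eqa.
    have aj j : aD j = a by rewrite aE; case: j; rewrite eqa minnn.
    apply: sD => [K|j|]; last exact: aC.
      rewrite L4E !inE dD => /orP[]/eqP->; [exists false | exists true]; by rewrite aj.
    by rewrite L4E !inE dD aj; case: j; rewrite eqxx ?orbT.
  have [j lt] : exists j, aD j < aD (~~ j).
    have [lt|le] := ltnP (aD true) (aD false); first by exists true.
    by exists false; rewrite /= ltn_neqAle eq_sym nea.
  have sim : lat_similar G J (Jlat G [:: Dm (2 ^ aD j * d') j; Dm (2 ^ aD (~~ j) * d') (~~ j)]).
    apply: sD => [K|j'|]; last exact: aC.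
      by rewrite !inE => /orP[]/eqP->; [exists j | exists (~~ j)].
    have [->|->] : j' = j \/ j' = ~~ j by case: (j) (j') => -[]; auto.
      by rewrite !inE eqxx.
    by rewrite !inE eqxx orbT.
  exfalso; apply: (bad (2 ^ aD j * d') (~~ j) _ sim).
  apply: (not_trivial_DD D) => //; first exact: even_pow.
  by rewrite two; apply: dvd_pow.
have [[a1 h1 min1]|no1] := min_or_none (bD true);
  have [[a0 h0 min0]|no0] := min_or_none (bD false).
- apply: Or44; apply: (two_D _ (fun j : bool => if j then a1 else a0)) => //; first by case.
  by case.
- by case: (one_D true a1) => //; [move=> h; apply: Or42 | move=> h; apply: Or43].
- by case: (one_D false a0) => //; [move=> h; apply: Or42 | move=> h; apply: Or43].
- have [[c hc minc]|noc] := min_or_none bC; last first.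
    by have [[c]|[j]] := log_attained; [rewrite noc | case: j; rewrite ?no1 ?no0].
  have noD j a : has_D j a = false by case: j.
  have sim : lat_similar G J (Jlat G [:: Cm (2 ^ c * d')]).
    apply: similar_canonical => [K|c' /minc cc'|j a]; last by rewrite noD.
      by rewrite !inE => /eqP->; left; exists c.
    by left; exists c; rewrite ?mem_head.
  case: c hc {minc} sim => [|k] hc sim.
    by apply: Or41; split; [have := has_C_log hc; lia | rewrite pow0 in sim].
  exfalso; apply: (bad (2 ^ k * d') 0 _ sim); rewrite -two; apply: (not_trivial_C D); rewrite ?two //.
  exact: has_C_dvd.
Qed.

End Family.

Lemma quasi_permutation_odd Hs : Hs != [::] -> all_sub G Hs -> odd (dG G Hs) ->
  quasi_permutation G (Jlat G Hs).
Proof.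
move=> Hs0 sHs od; have dE : dG G Hs = 2 ^ 0 * dG G Hs by rewrite mul1n.
have sim := similar_odd Hs0 sHs od dE erefl.
apply: quasi_permutation_similar sim _.
apply: (quasi_permutation_DD D); first by case: (dG _ _) od.
case: Hs Hs0 sHs od {dE} => // H Hs _ sHs od.
have := dvdn_trans (dG_dvd G (mem_head H Hs)) (dvdn_indexg G H).
have [_ _ -> _] := D; rewrite Gauss_dvdr // coprimen2 //.
Qed.

(** For odd n the index of [Dm d y] is the odd number gcd(d, n), even if d is even; this covers the
    cases where the resolutions cannot ask for 2m to divide n. *)
Lemma quasi_permutation_odd_mem L d y : odd n -> 0 < d -> all_sub G L -> Dm d y \in L ->
  quasi_permutation G (Jlat G L).
Proof.
move=> on d0 sL mD; apply: quasi_permutation_odd => //; first by case: (L) mD.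
have := dG_dvd G mD; rewrite Dm_gcd // (index_Dm D) ?dvdn_gcdr // => dd.
exact: dvdn_odd dd (dvdn_odd (dvdn_gcdr _ _) on).
Qed.

Lemma double_dvd m : odd m -> m %| n -> ~~ odd n -> 2 * m %| n.
Proof.
by move=> om mn en; rewrite Gauss_dvd ?coprime2n // dvdn2 en.
Qed.

Lemma quasi_permutation_Dj m j : odd m -> m %| n ->
  quasi_permutation G (Jlat G [:: Dm (2 * m) j]).
Proof.
move=> om mn; have m0 : 0 < m by case: (m) om.
have [on|en] := boolP (odd n).
  apply: (@quasi_permutation_odd_mem _ (2 * m) j) => //; rewrite ?muln_gt0 ?mem_head //.
  by rewrite /all_sub /= (DmG D).
rewrite -Dm_shift; apply: (quasi_permutation_D (dihedral_shift j)) => //.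
exact: double_dvd.
Qed.

Lemma quasi_permutation_CDj m j : odd m -> m %| n ->
  quasi_permutation G (Jlat G [:: Cm m; Dm (2 * m) j]).
Proof.
move=> om mn; have m0 : 0 < m by case: (m) om.
have [on|en] := boolP (odd n).
  apply: (@quasi_permutation_odd_mem _ (2 * m) j) => //; rewrite ?muln_gt0 //.
    by rewrite /all_sub /= (CmG D) (DmG D).
  by rewrite !inE eqxx orbT.
rewrite -Dm_shift; apply: (quasi_permutation_CD (dihedral_shift j)) => //.
exact: double_dvd.
Qed.

(** Order and repetitions in the family do not affect the similarity class, which takes care of
    [undup]. *)
Lemma quasi_permutation_eq_mem (L L' : seq {group gT}) : all_sub G L -> L =i L' ->
  quasi_permutation G (Jlat G L) -> quasi_permutation G (Jlat G L').
Proof.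
move=> sL LL'; apply: quasi_permutation_similar.
apply: similar_reach => //.
- by apply/allP=> H; rewrite -LL'; apply: (allP sL).
- by move=> H; rewrite LL'; apply: reach_mem.
- by move=> H; rewrite -LL'; apply: reach_mem.
Qed.

Lemma quasi_permutation_DDmem L d : 0 < d -> L =i [:: Dm d 0; Dm d 1] ->
  quasi_permutation G (Jlat G L).
Proof.
move=> d0 LE; apply: (@quasi_permutation_eq_mem [:: Dm d 0; Dm d 1]).
- by rewrite /all_sub /= !(DmG D).
- by move=> H; rewrite LE.
rewrite !(Dm_gcd _ d0); apply: (quasi_permutation_DD D); rewrite ?dvdn_gcdr //.
by rewrite gcdn_gt0 d0.
Qed.

End DihedralClassification.

Theorem theorem8p2 (gT : finGroupType) (G : {group gT}) (sigma tau : gT)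
    (n : nat) (Hs : seq {group gT}) :
  0 < n ->
  (* G is the dihedral group D_n with generators sigma, tau *)
  G :=: <<[set sigma; tau]>>%g -> #|G| = (2 * n)%N ->
  (sigma ^+ n = 1)%g -> (tau ^+ 2 = 1)%g -> (tau * sigma * tau^-1 = sigma^-1)%g ->
  (* a nonempty multiset of subgroups of G *)
  Hs != [::] -> all (fun H : {group gT} => H \subset G) Hs ->
  let d := dG G Hs in
  let J := Jlat G Hs in
  (odd d -> quasi_permutation G J) /\
  (~~ odd d ->
    (quasi_permutation G J <-> quasi_invertible G J) /\
    (quasi_permutation G J <->
      ((d %% 4 = 2 /\
        (lat_similar G J (Jlat G [:: <[(sigma ^+ (d %/ 2))%g]>%G]))) \/
       (exists j, j < 2 /\ d %% 4 = 2 /\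
        lat_similar G J (Jlat G [:: <<[set (sigma ^+ d)%g; (sigma ^+ j * tau)%g]>>%G])) \/
       (exists j, j < 2 /\ d %% 4 = 2 /\
        lat_similar G J (Jlat G [:: <[(sigma ^+ (d %/ 2))%g]>%G;
                                <<[set (sigma ^+ d)%g; (sigma ^+ j * tau)%g]>>%G])) \/
       lat_similar G J (Jlat G (undup [:: <<[set (sigma ^+ d)%g; tau]>>%G;
                                      <<[set (sigma ^+ d)%g; (sigma * tau)%g]>>%G]))))).
Proof.
move=> n0 GE cG sn tt ts Hs0 sHs d J.
have D : dihedral G n sigma tau by split.
split; first exact: (quasi_permutation_odd D).
move=> ed; have d0 : 0 < d := dG_gt0 G Hs0.
pose L4 := undup [:: <<[set (sigma ^+ d)%g; tau]>>%G; <<[set (sigma ^+ d)%g; (sigma * tau)%g]>>%G].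
have L4E : L4 =i [:: Dm sigma tau d 0; Dm sigma tau d 1].
  by move=> H; rewrite mem_undup /Dm expg0 mul1g expg1.
have d2n : d %| 2 * n.
  rewrite -cG /d; case: (Hs) Hs0 => // H r _.
  exact: dvdn_trans (dG_dvd G (mem_head H r)) (dvdn_indexg G H).
have half : d %% 4 = 2 -> [/\ odd (d %/ 2), d %/ 2 %| n & d = 2 * (d %/ 2)].
  move=> d4; have dE : d = 2 * (d %/ 2) by lia.
  by split=> //; [lia | rewrite -(dvdn_pmul2l (isT : 0 < 2)) -dE].
have back : (d %% 4 = 2 /\ lat_similar G J (Jlat G [:: Cm sigma (d %/ 2)])) \/
    (exists j, j < 2 /\ d %% 4 = 2 /\ lat_similar G J (Jlat G [:: Dm sigma tau d j])) \/
    (exists j, j < 2 /\ d %% 4 = 2 /\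
       lat_similar G J (Jlat G [:: Cm sigma (d %/ 2); Dm sigma tau d j])) \/
    lat_similar G J (Jlat G L4) -> quasi_permutation G J.
  case=> [[/half[om mn _] sim]|[[j [_ [/half[om mn dE] sim]]]|[[j [_ [/half[om mn dE] sim]]]|sim]]];
    apply: quasi_permutation_similar sim _.
  - exact: (quasi_permutation_C D).
  - by rewrite dE; apply: (quasi_permutation_Dj D).
  - by rewrite {2}dE; apply: (quasi_permutation_CDj D).
  - exact: (quasi_permutation_DDmem D d0).
have forth : quasi_invertible G J ->
    (d %% 4 = 2 /\ lat_similar G J (Jlat G [:: Cm sigma (d %/ 2)])) \/
    (exists j, j < 2 /\ d %% 4 = 2 /\ lat_similar G J (Jlat G [:: Dm sigma tau d j])) \/
    (exists j, j < 2 /\ d %% 4 = 2 /\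
       lat_similar G J (Jlat G [:: Cm sigma (d %/ 2); Dm sigma tau d j])) \/
    lat_similar G J (Jlat G L4).
  move=> qi; have [d' co dE] := pfactor_coprime (isT : prime 2) d0.
  rewrite coprime2n in co; rewrite mulnC in dE.
  have e0 : 0 < logn 2 d by rewrite -pfactor_dvdn // dvdn2.
  have d1 : logn 2 d = 1 -> [/\ d %% 4 = 2, d %/ 2 = d' & d = 2 * d'].
    move=> l1; have {}dE : d = 2 * d' by rewrite dE l1.
    by have := odd_double_half d'; rewrite co dE; split; lia.
  have [[/d1[-> -> _]]|[j [j2 [/d1[-> _ <-]]]]|[j [j2 [/d1[-> -> <-]]]]|] :=
    quasi_invertible_cases D Hs0 sHs co dE e0 L4E qi; first by left.
  - by right; left; exists j.
  - by right; right; left; exists j.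
  - by right; right; right.
split; split=> [qp|]; first exact: quasi_permutation_invertible.
- by move/forth/back.
- exact/forth/quasi_permutation_invertible.
- exact: back.
Qed.
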